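(* Let $\Omega\subset\mathbb R^3$ be a smooth bounded domain, let $f\in L^2(\Omega)$ be independent of time, and let $\varphi\in C(\mathbb R)$ satisfy, for some constant $c>0$, $$|\varphi(u)-\varphi(v)|\le c|u-v|(1+|u|^4+|v|^4),\quad\forall u,v\in\mathbb R,$$ and $$\liminf_{|u|\to\infty}\frac{\varphi(u)}{u}>-\lambda_1,$$ where $\lambda_1>0$ is the first eigenvalue of $A=-\Delta$ on $L^2(\Omega)$ with domain $H^2(\Omega)\cap H^1_0(\Omega)$. Let $S(t)$ be the strongly continuous semigroup on $\mathcal H=\mathcal H^0=H^1_0(\Omega)\times L^2(\Omega)$ generated by the strongly damped wave equation $$u_{tt}-\Delta u_t-\Delta u+\varphi(u)=f\ \text{ in }\Omega,\qquad u_{|\partial\Omega}=0,$$ and let $\mathfrak A\subset\mathcal H$ be its global attractor. Then $\mathfrak A$ is bounded in $\mathcal H^1$.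
   Context: For $r\in\mathbb R$, $H^r=\mathrm{dom}(A^{r/2})$ with inner product $\langle u,v\rangle_r=\langle A^{r/2}u,A^{r/2}v\rangle_{L^2(\Omega)}$ and norm $\|u\|_r=\|A^{r/2}u\|_{L^2(\Omega)}$, where $A=-\Delta$ with domain $H^2(\Omega)\cap H^1_0(\Omega)$ (Dirichlet Laplacian); $\mathcal H^r=H^{r+1}\times H^r$, and the index is omitted when $r=0$. In particular $\mathcal H=H^1_0(\Omega)\times L^2(\Omega)$ and $\mathcal H^1=(H^2(\Omega)\cap H^1_0(\Omega))\times H^1_0(\Omega)$. It is known from earlier work, under the stated assumptions, that the equation generates a strongly continuous semigroup $S(t)$ on $\mathcal H$ (that is, $S(0)$ is the identity, $S(t+\tau)=S(t)S(\tau)$, and $S(t)\in C(\mathcal H,\mathcal H)$ for every $t\ge 0$): for $x\in\mathcal H$, $S(t)x=(u(t),u_t(t))$, where $u$ is the unique weak solution with $(u(0),u_t(0))=x$. It is likewise known that $S(t)$ has a global attractor. The global attractor of $S(t)$ is the unique compact set $\mathfrak A\subset\mathcal H$ such that $S(t)\mathfrak A=\mathfrak A$ for all $t\ge 0$ and $\lim_{t\to\infty}\sup_{x\in\mathfrak B}\inf_{a\in\mathfrak A}\|S(t)x-a\|_{\mathcal H}=0$ for every bounded $\mathfrak B\subset\mathcal H$. *)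

(* Defs.v *)
From HB Require Import structures.
From mathcomp Require Import all_boot all_order all_algebra lra.
From mathcomp Require Import all_classical all_reals all_analysis.
From mathcomp Require Import measurable_realfun.
Set Implicit Arguments.
Unset Strict Implicit.
Unset Printing Implicit Defensive.
Import Order.TTheory GRing.Theory Num.Def Num.Theory.
Import numFieldNormedType.Exports.
Local Open Scope classical_set_scope.
Local Open Scope ring_scope.

Notation R3 R :=
  (measurableTypeR R * measurableTypeR R * measurableTypeR R)%type.

Section calculus.
Context {R : realType}.
Implicit Types (f : R3 R -> R) (i : 'I_3).

Definition basis3 i : R3 R := ((i == 0)%:R, (i == 1)%:R, (i == 2)%:R).

Definition partial i f (x : R3 R) : R := 'D_(basis3 i) f x.

Definition laplacian f (x : R3 R) : R := \sum_i partial i (partial i f) x.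

Fixpoint Ck (k : nat) f : Prop :=
  continuous f /\
  if k is k'.+1 then
    forall i, (forall x, derivable f x (basis3 i)) /\ Ck k' (partial i f)
  else True.

Definition smooth f := forall k, Ck k f.

Definition test_function (Omega : set (R3 R)) f :=
  [/\ smooth f,
      compact (closure [set x | f x != 0]) &
      closure [set x | f x != 0] `<=` Omega].

End calculus.

(* The boundary is locally the regular zero level set of a smooth defining
   function [rho], with the domain lying on the side [rho < 0] only. *)
Record smooth_bounded_domain (R : realType) := SmoothBoundedDomain {
  domain :> set (R3 R) ;
  domain_open : open domain ;
  domain_connected : connected domain ;
  domain_nonempty : domain !=set0 ;
  domain_bounded : bounded_set domain ;
  domain_smooth : forall x0, closure domain x0 -> ~ domain x0 ->
    exists rho : R3 R -> R,
      [/\ smooth rho,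
          exists i, partial i rho x0 != 0 &
          \forall x \near x0, domain x <-> rho x < 0]
}.

Arguments domain_open {R} _.

Section lebesgue_measure_on_domain.
Context {R : realType}.

Let ball_rat (x e : R) : 0 < e -> exists q : rat, ball x e (ratr q : R).
Proof.
move=> e0.
have [] := @dense_rat R (ball x e) _ (ball_open x e).
  by exists x; exact: ballxx.
by move=> y [bx [q _ qy]]; exists q; rewrite qy.
Qed.

Lemma open_measurable3 (A : set (R3 R)) : open A -> measurable A.
Proof.
move=> oA.
pose rball (q : rat * rat) : set R := ball (ratr q.1 : R) (ratr q.2).
pose box (c : (rat * rat * rat) * rat) : set (R * R * R) :=
  (rball (c.1.1.1, c.2) `*` rball (c.1.1.2, c.2)) `*` rball (c.1.2, c.2).
have mrball q : measurable (rball q : set (measurableTypeR R)).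
  by apply: measurable_realfun.open_measurable; exact: ball_open.
have mbox c : measurable (box c : set (R3 R)).
  exact: (measurableX (measurableX (mrball _) (mrball _)) (mrball _)).
rewrite (_ : A = \bigcup_(c in [set c | box c `<=` A]) box c).
  rewrite bigcup_mkcond; apply: countable_bigcupT_measurable => // c.
  by case: ifPn.
apply/seteqP; split=> [x Ax|x [c +]]; last exact.
have /nbhs_ballP[e /= e0 eA] : nbhs x A by exact: open_nbhs_nbhs.
have [r /= re] : exists r : rat, ball (e / 4) (e / 4) (ratr r : R).
  by apply: ball_rat; rewrite divr_gt0.
have [r0 re2] : 0 < (ratr r : R) /\ (ratr r : R) < e / 2.
  move: re; rewrite /ball /= ltr_distlC => /andP[]; rewrite subrr => -> h.
  by split=> //; rewrite (lt_le_trans h)// -mulrDr ler_wpM2l ?(ltW e0)//; lra.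
case: x Ax eA => -[x1 x2] x3 Ax eA.
have [q1 xq1] := ball_rat x1 r0.
have [q2 xq2] := ball_rat x2 r0.
have [q3 xq3] := ball_rat x3 r0.
exists ((q1, q2, q3), r); last first.
  by split; [split|]; exact: ball_sym.
move=> -[[y1 y2] y3] [[/= b1 b2] b3]; apply: eA.
have H q a b : ball a (ratr r : R) (ratr q : R) -> rball (q, r) b -> ball a e b.
  move=> h1 h2; apply: le_ball (ball_triangle h1 h2).
  by rewrite /=; lra.
by split; [split|]; [exact: H xq1 b1|exact: H xq2 b2|exact: H xq3 b3].
Qed.

Definition lebesgue3 : {measure set (R3 R) -> \bar R} :=
  ((@lebesgue_measure R \x @lebesgue_measure R) \x @lebesgue_measure R)%E.

Definition lebesgue_on (Omega : smooth_bounded_domain R) :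
    {measure set (R3 R) -> \bar R} :=
  mrestr lebesgue3 (open_measurable3 (domain_open Omega)).

Definition L2 (Omega : smooth_bounded_domain R) : Type :=
  LspaceType (lebesgue_on Omega) (lee1n 2).

Coercion L2_fun (Omega : smooth_bounded_domain R) (u : L2 Omega) : R3 R -> R :=
  (u : LspaceType (lebesgue_on Omega) (lee1n 2)).
End lebesgue_measure_on_domain.

Section L2_metric.
Context {R : realType} (Omega : smooth_bounded_domain R).
Let mu := lebesgue_on Omega.
Implicit Types u v w : L2 Omega.

Definition norm2 (f : R3 R -> R) : R := fine ('N[mu]_2%:E[EFin \o f])%E.

HB.instance Definition _ := gen_eqMixin (L2 Omega).
HB.instance Definition _ := gen_choiceMixin (L2 Omega).


Let L2_measurable u : measurable_fun [set: R3 R] (u : R3 R -> measurableTypeR R).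
Proof.
rewrite /L2_fun /aqEqMfun_to_fun; case: (repr _) => f [[fP]] /=; exact: fP. Qed.

Let L2_EFin_measurable u v :
  measurable_fun [set: R3 R] (fun x => (u x - v x)%:E).
Proof. by apply/measurable_EFinP; exact: (measurable_funB (L2_measurable u) (L2_measurable v)). Qed.


Let N (f : R3 R -> R) : \bar R := ('N[mu]_2%:E[EFin \o f])%E.

Let ND (f g : R3 R -> R) :
  measurable_fun [set: R3 R] f -> measurable_fun [set: R3 R] g ->
  (N (f \+ g)%R <= N f + N g)%E.
Proof. by move=> mf mg; exact: (eminkowski mu mf mg (lee1n 2)). Qed.

Let NN (f : R3 R -> R) : N (\- f)%R = N f.
Proof. exact: (oppe_Lnorm mu (EFin \o f) 2%:E). Qed.

Let mN (f : R3 R -> R) :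
  measurable_fun [set: R3 R] f -> measurable_fun [set: R3 R] (\- f).
Proof. exact: measurableT_comp. Qed.

Let mB u v : measurable_fun [set: R3 R] (u \- v).
Proof. exact: (measurable_funB (L2_measurable u) (L2_measurable v)). Qed.

Let N_fin u v : (N (u \- v)%R < +oo)%E.
Proof.
rewrite (le_lt_trans (ND (L2_measurable u) (mN (L2_measurable v))))//.
by rewrite NN lte_add_pinfty//; exact: Lebesgue_finite.
Qed.

Let distE u v : (norm2 (u \- v))%:E = N (u \- v)%R.
Proof. by rewrite fineK// fin_numElt N_fin (lt_le_trans ltNy0) ?Lnorm_ge0. Qed.

Lemma L2_ae_eq u v : u = v %[ae mu] -> u = v.
Proof.
case: u v => [u [[uP]]] [v [[vP]]] /= uv.
have {}uv : u = v.
  by rewrite -[u]reprK -[v]reprK; apply/eqmodP/asboolP; exact: uv.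
move: uP vP; rewrite uv => uP vP.
by rewrite (Prop_irrelevance uP vP).
Qed.

Let dist_xx u : norm2 (u \- u) = 0.
Proof.
rewrite /norm2 (_ : u \- u = cst 0); last by apply/funext => x /=; rewrite subrr.
by rewrite Lnorm0// pnatr_eq0.
Qed.

Let dist_eq0 u v : norm2 (u \- v) = 0 -> u = v.
Proof.
move=> uv0; have d0 : N (u \- v)%R = 0%E by rewrite -distE uv0.
have := Lnorm_eq0_eq0 (L2_EFin_measurable u v) _ d0.
rewrite lte_fin ltr0n => /(_ isT) uv.
apply: L2_ae_eq; apply: filterS uv => x /(_ I) [] /eqP.
by rewrite subr_eq0 => /eqP.
Qed.

Let dist_sym u v : norm2 (u \- v) = norm2 (v \- u).
Proof.
apply: EFin_inj; rewrite !distE -NN; congr N.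
by apply/funext => x /=; rewrite opprB.
Qed.

Let dist_triangle v u w : norm2 (u \- w) <= norm2 (u \- v) + norm2 (v \- w).
Proof.
rewrite -lee_fin [leRHS]EFinD !distE; apply: le_trans (ND (mB u v) (mB v w)).
rewrite [in leLHS](_ : u \- w = (u \- v) \+ (v \- w))//.
by apply/funext => x /=; rewrite addrA subrK.
Qed.

HB.instance Definition _ :=
  isMetric.Build R (L2 Omega) dist_xx dist_eq0 dist_sym dist_triangle.

End L2_metric.

Section dirichlet_laplacian.
Context {R : realType} (Omega : smooth_bounded_domain R).
Let mu := lebesgue_on Omega.
Implicit Types (u v w g : L2 Omega) (psi : R3 R -> R).

Definition inner (f g : R3 R -> R) : R := (\int[mu]_x (f x * g x))%R.

Definition weak_partial (i : 'I_3) u g := forall psi,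
  test_function Omega psi -> inner u (partial i psi) = - inner g psi.

(* closure of the test functions in the Sobolev space H^1 *)
Definition H10 u := exists2 g : 'I_3 -> L2 Omega,
  forall i, weak_partial i u (g i) &
  forall e, 0 < e -> exists psi,
    [/\ test_function Omega psi, norm2 Omega (u \- psi) < e &
        forall i, norm2 Omega (g i \- partial i psi) < e].

(* graph of A: u lies in the intersection of H^2 and H^1_0, and w = A u *)
Definition dirichlet_laplacian u w := H10 u /\
  exists (g : 'I_3 -> L2 Omega) (h : 'I_3 -> 'I_3 -> L2 Omega),
    [/\ forall i, weak_partial i u (g i),
        forall i j, weak_partial j (g i) (h i j) &
        w = (fun x => - \sum_i h i i x) %[ae mu]].

Definition eigenpair (lambda : R) u := exists2 w,
  dirichlet_laplacian u w & w = (fun x => lambda * u x) %[ae mu].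

Definition eigenvalue (lambda : R) := exists2 u,
  eigenpair lambda u & norm2 Omega u != 0.

Definition first_eigenvalue (lambda : R) :=
  eigenvalue lambda /\ forall l, eigenvalue l -> lambda <= l.

Definition eigenbasis (e : nat -> L2 Omega) (lambda : nat -> R) :=
  [/\ forall j, eigenpair (lambda j) (e j),
      forall i j, inner (e i) (e j) = (i == j)%:R &
      forall u, (forall j, inner u (e j) = 0) -> norm2 Omega u = 0].

(* graph of A^s for s >= 0: A is positive and self-adjoint with compact
   inverse, so its functional calculus is diagonal in any orthonormal basis of
   eigenfunctions (and does not depend on the basis) *)
Definition Apow_graph (s : R) u w := exists e lambda, eigenbasis e lambda /\
  forall j, inner w (e j) = lambda j `^ s * inner u (e j).

Definition Apow_dom (s : R) : set (L2 Omega) :=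
  [set u | exists w, Apow_graph s u w].

Definition Apow (s : R) (u : Apow_dom s) : L2 Omega :=
  sval (cid (set_mem (valP u))).

(* The topology of Hs r is the one that makes A^(r/2) : Hs r -> L2 an isometry
   onto its image, that is, the topology of the norm ||A^(r/2) u||. *)
Definition Hs (r : R) : Type := initial_topology (@Apow (r / 2)).

HB.instance Definition _ r := PseudoMetric.on (Hs r).

Definition Hs_val r (u : Hs r) : L2 Omega := val (u : Apow_dom (r / 2)).

Definition Hs_norm r (u : Hs r) : R := norm2 Omega (@Apow (r / 2) u).

(* ||u - v||_r, by linearity of A^(r/2) *)
Definition Hs_dist r (u v : Hs r) : R :=
  norm2 Omega (@Apow (r / 2) u \- @Apow (r / 2) v).

End dirichlet_laplacian.

Section phase_space.
Context {R : realType} (Omega : smooth_bounded_domain R).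

Definition calH (r : R) : Type := (Hs Omega (r + 1) * Hs Omega r)%type.

Definition calH_val r (z : calH r) : L2 Omega * L2 Omega :=
  (Hs_val z.1, Hs_val z.2).

Definition calH_norm r (z : calH r) : R :=
  Num.sqrt (Hs_norm z.1 ^+ 2 + Hs_norm z.2 ^+ 2).

Definition calH_dist r (z z' : calH r) : R :=
  Num.sqrt (Hs_dist z.1 z'.1 ^+ 2 + Hs_dist z.2 z'.2 ^+ 2).

(* B is contained in calH r, and bounded there *)
Definition bounded_in (r : R) r0 (B : set (calH r0)) := exists M : R,
  forall z, B z -> exists2 y : calH r, calH_val y = calH_val z &
                                       calH_norm y <= M.

End phase_space.

Section strongly_damped_wave_equation.
Context {R : realType} (Omega : smooth_bounded_domain R).
Variables (phi : R -> R) (f : L2 Omega).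

(* z = (u, v) is continuous in time with values in calH 0, v = u_t in L2, and
   v_t = Laplacian v + Laplacian u - phi(u) + f in the sense of distributions
   on Omega *)
Definition weak_solution (z : R -> calH Omega 0) :=
  let u t := Hs_val (z t).1 in
  let v t := Hs_val (z t).2 in
  [/\ {within [set t | 0 <= t], continuous z},
      forall t : R, 0 < t ->
        norm2 Omega (fun x => (u (t + h) x - u t x) / h - v t x)
          @[h --> 0^'] --> 0 &
      forall psi, test_function Omega psi -> forall t : R, 0 < t ->
        is_derive t 1 (fun s => inner Omega (v s) psi)
          (inner Omega (v t) (laplacian psi)
           + inner Omega (u t) (laplacian psi)
           - inner Omega (phi \o u t) psi + inner Omega f psi)].

Definition generated_semigroup (S : R -> calH Omega 0 -> calH Omega 0) :=
  [/\ S 0 = id,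
      forall t tau, 0 <= t -> 0 <= tau -> S (t + tau) = S t \o S tau,
      forall t, 0 <= t -> continuous (S t),
      forall x, weak_solution (S ^~ x) &
      forall x z, weak_solution z -> z 0 = x -> forall t, 0 <= t -> z t = S t x].

End strongly_damped_wave_equation.

Definition global_attractor (R : realType) (Omega : smooth_bounded_domain R)
    (S : R -> calH Omega 0 -> calH Omega 0) (A : set (calH Omega 0)) :=
  [/\ compact A,
      forall t, 0 <= t -> S t @` A = A &
      forall B, B !=set0 -> bounded_in 0 B ->
        ereal_sup [set ereal_inf [set (calH_dist (S t x) a)%:E | a in A]
                  | x in B] @[t --> +oo] --> 0%E].

Definition abs_infty (R : realType) : set_system R :=
  [set P | exists M, forall s, M < `|s| -> P s].

(* Main.v *)
(* By compactness of the attractor, each of its displacements splits as a bounded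
   part plus a remainder small in the critical space L^6, uniformly on the
   attractor. This makes u |-> phi(u) Lipschitz from H^1_0 to its dual with an
   arbitrarily small constant, at the price of an L^2 term.

   Step 1. In the eigenbasis of the Laplacian, a perturbed energy of the
   difference u(t+h) - u(t) is damped up to this small Lipschitz term. Since
   trajectories on the attractor extend backwards in time, the difference is
   O(h) in the energy space, hence u_t is bounded in H^1_0.

   Step 2. p = u + (u(t+h) - u(t)) / h solves an elliptic equation whose
   right-hand side is bounded in L^2 up to phi(u). Testing with a truncation of
   p^3 and using the splitting again bounds p in L^12 by a fraction of the bound
   for u; since u(t+h) is a convex combination of u(t) and p, this bounds u in
   L^12, and phi(u) in L^2.

   Step 3. y = A u + u_t solves y' = - y + u_t + f - phi(u), so y is bounded in
   L^2 and u is bounded in H^2. *)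

Require Import Defs.
From HB Require Import structures.
From mathcomp Require Import all_boot all_order all_algebra.
From mathcomp Require Import all_classical all_reals all_analysis.
From mathcomp Require Import measurable_realfun ring lra.
Set Implicit Arguments.
Unset Strict Implicit.
Unset Printing Implicit Defensive.
Import Order.TTheory GRing.Theory Num.Def Num.Theory.
Import numFieldNormedType.Exports.
Local Open Scope classical_set_scope.
Local Open Scope ring_scope.

Local Notation R3 R :=
  (measurableTypeR R * measurableTypeR R * measurableTypeR R)%type.

(** A priori [phi \o u] is only a functional on H^1_0: its integral against [eta] converges through
    three sixth-power norms, with exponents 4/6 + 1/6 + 1/6. Hence, until its square integrability
    is known, estimates are stated weakly, and time derivatives are taken of the tested quantity
    [A u + u_t], whose derivative contains no gradient of the velocity.

    The bounds share one mechanism. A quantity is finite on the attractor for a poor reason, with a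
    bound that may depend on the number of modes or on the truncation. The equation and invariance
    turn any bound [W] valid on the whole attractor into [q * W + C] with [q < 1], so that
    [C / (1 - q)] is a bound too, free of the poor one. This is why one may work with finitely many
    modes and truncated powers, where differentiating and testing are legitimate.

    The exponent 12 is 2 * 6: testing with p^3 controls the gradient of p^2 in L^2, so p^2 in L^6.
    The truncation with parameter [dl] costs an error [h ^+ 2 / dl], so the time step [h] is chosen
    after [dl]. *)

Lemma le_of_eq (d : Order.disp_t) (T : porderType d) (x y : T) :
  x = y -> (x <= y)%O.
Proof. by move=> ->. Qed.

(** The discriminant of a nonnegative quadratic. Both the L^2 product [ip] and the sum over gradient
    components [gip] get Cauchy-Schwarz from it. *)
Lemma le_of_quadratic_ge0 (R : realType) (a b c : R) : 0 <= a -> 0 <= c ->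
  (forall t, 0 <= a - 2 * t * b + t ^+ 2 * c) -> `|b| <= Num.sqrt a * Num.sqrt c.
Proof.
move=> a0 c0 key.
have bb : b ^+ 2 <= a * c.
  have [cE|cN] := eqVneq c 0.
    (* With [c = 0] the polynomial is affine, and at this [t] it equals -1. *)
    have h1 := key ((a + 1) / (2 * b)).
    have [->|b0] := eqVneq b 0; first by rewrite expr0n mulr_ge0.
    exfalso; move: h1; rewrite cE mulr0 addr0.
    rewrite (_ : 2 * _ * _ = a + 1); last by field.
    lra.
  have cp : 0 < c by rewrite lt_neqAle eq_sym cN.
  have := key (b / c).
  rewrite (_ : _ + _ = (a * c - b ^+ 2) / c); last by field.
  by rewrite pmulr_lge0 ?invr_gt0// subr_ge0.
by rewrite -sqrtrM// -sqrtr_sqr ler_sqrt// mulr_ge0.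
Qed.

(** * Square-integrable functions *)

Section integration.
Context d (T : measurableType d) (R : realType) (mu : {measure set T -> \bar R}).

Implicit Types f g h : T -> R.

Definition ig f := mu.-integrable setT (EFin \o f).
Definition J f : R := (\int[mu]_x f x)%R.

Lemma ig_meas f : ig f -> measurable_fun setT f.
Proof. by move=> /integrableP[/measurable_EFinP]. Qed.

Lemma igD f g : ig f -> ig g -> ig (fun x => f x + g x).
Proof.
move=> hf hg; have := @integrableD _ _ _ mu setT measurableT _ _ hf hg.
by apply: eq_integrable => // x _; rewrite /= EFinD.
Qed.

Lemma igZ k f : ig f -> ig (fun x => k * f x).
Proof.
move=> hf; have := @integrableZl _ _ _ mu setT measurableT k _ hf.
by apply: eq_integrable => // x _; rewrite /= EFinM.
Qed.

Lemma igN f : ig f -> ig (fun x => - f x).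
Proof.
move=> /(igZ (-1)); apply: eq_integrable => // x _.
by rewrite /= mulN1r.
Qed.

Lemma ig_le f g : measurable_fun setT f -> (forall x, `|f x| <= g x) -> ig g ->
  ig f.
Proof.
move=> mf fg; apply: le_integrable => //; first exact/measurable_EFinP.
by move=> x _ /=; rewrite lee_fin (le_trans (fg x))// ler_norm.
Qed.

Lemma ig_abs f : ig f -> ig (fun x => `|f x|).
Proof.
move=> hf; apply: le_integrable (hf) => //.
  by apply/measurable_EFinP; apply: measurableT_comp => //; exact: ig_meas.
by move=> x _ /=; rewrite normr_id.
Qed.

Lemma ig0 : ig (fun=> 0).
Proof. exact: (integrable0 mu setT). Qed.

Lemma ig_sum (I : Type) (s : seq I) (h : I -> T -> R) :
  (forall i, ig (h i)) -> ig (fun x => \sum_(i <- s) h i x).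
Proof.
move=> hi; elim: s => [|i s ih].
  by apply: eq_integrable ig0 => // x _; rewrite /= big_nil.
by apply: eq_integrable (igD (hi i) ih) => // x _; rewrite /= big_cons.
Qed.

Lemma eq_ig f g : f =1 g -> ig f -> ig g.
Proof. by move=> fg; rewrite (_ : f = g)//; apply/funext. Qed.

Lemma eq_J f g : f =1 g -> J f = J g.
Proof. by move=> fg; rewrite (_ : f = g)//; apply/funext. Qed.

Lemma JD f g : ig f -> ig g -> J (fun x => f x + g x) = J f + J g.
Proof. by move=> hf hg; rewrite /J RintegralD. Qed.

Lemma JZ k f : ig f -> J (fun x => k * f x) = k * J f.
Proof. by move=> hf; rewrite /J RintegralZl. Qed.

Lemma JN f : ig f -> J (fun x => - f x) = - J f.
Proof. by move=> /(JZ (-1)); rewrite mulN1r => <-; apply: eq_J => x; rewrite mulN1r. Qed.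

Lemma JB f g : ig f -> ig g -> J (fun x => f x - g x) = J f - J g.
Proof. by move=> hf hg; rewrite JD ?JN//; exact: igN. Qed.

Lemma J0 : J (fun=> 0) = 0.
Proof. by rewrite /J /Rintegral integral0. Qed.

Lemma J_sum (I : Type) (s : seq I) (h : I -> T -> R) :
  (forall i, ig (h i)) -> J (fun x => \sum_(i <- s) h i x) = \sum_(i <- s) J (h i).
Proof.
move=> hi; elim: s => [|i s ih].
  by rewrite big_nil -[RHS]J0; apply: eq_J => x; rewrite big_nil.
rewrite big_cons -ih -JD//; last exact: ig_sum.
by apply: eq_J => x; rewrite big_cons.
Qed.

Lemma J_le f g : ig f -> ig g -> (forall x, f x <= g x) -> J f <= J g.
Proof. by move=> hf hg fg; apply: le_Rintegral. Qed.

Lemma J_ge0 f : (forall x, 0 <= f x) -> 0 <= J f.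
Proof. by move=> f0; apply: Rintegral_ge0. Qed.

Lemma J_abs f : ig f -> `|J f| <= J (fun x => `|f x|).
Proof. by move=> hf; apply: le_normr_Rintegral. Qed.

Lemma EFin_J f : ig f -> (\int[mu]_x (f x)%:E)%E = (J f)%:E.
Proof. by move=> hf; rewrite /J /Rintegral fineK// integrable_fin_num. Qed.

Lemma ig_ge0 f (M : R) : measurable_fun setT f -> (forall x, 0 <= f x) ->
  (\int[mu]_x (f x)%:E <= M%:E)%E -> ig f /\ J f <= M.
Proof.
move=> mf f0 fM; have hf : ig f.
  apply/integrableP; split; first exact/measurable_EFinP.
  apply: le_lt_trans (ltry M); apply: le_trans fM.
  by apply/le_of_eq; apply: eq_integral => x _ /=; rewrite ger0_norm.
by split => //; rewrite -lee_fin -EFin_J.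
Qed.

Lemma ae_eq_J f g : measurable_fun setT f -> measurable_fun setT g ->
  (f = g %[ae mu]) -> J f = J g.
Proof.
move=> mf mg fg; rewrite /J /Rintegral; congr fine; apply: ae_eq_integral => //.
- exact/measurable_EFinP.
- exact/measurable_EFinP.
- by apply: filterS fg => x /= fgx _; rewrite fgx.
Qed.

Lemma ae_eq_ig f g : measurable_fun setT g -> (f = g %[ae mu]) -> ig f -> ig g.
Proof.
move=> mg fg hf; apply/integrableP; split; first exact/measurable_EFinP.
have /integrableP[_] := hf; apply: le_lt_trans.
apply/le_of_eq; apply: ae_eq_integral => //.
- by apply: measurableT_comp => //; exact/measurable_EFinP.
- by apply: measurableT_comp => //; apply/measurable_EFinP; exact: ig_meas.
- by apply: filterS fg => x /= fgx _; rewrite fgx.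
Qed.

(** Square integrability of functions, not of classes: limits and gradients are handled as plain
    functions and turned into elements of [L2] only where the definitions ask for one. *)
Definition sqint f := measurable_fun setT f /\ ig (fun x => f x ^+ 2).

Definition ip f g : R := J (fun x => f x * g x).

Definition nrm f : R := Num.sqrt (ip f f).

Lemma sqint_meas f : sqint f -> measurable_fun setT f. Proof. by case. Qed.

Lemma igM f g : sqint f -> sqint g -> ig (fun x => f x * g x).
Proof.
move=> [mf f2] [mg g2]; apply: ig_le (igD f2 g2); first exact: measurable_funM.
move=> x; rewrite normrM -[f x ^+ 2]real_normK ?num_real//.
rewrite -[g x ^+ 2]real_normK ?num_real//.
have := sqr_ge0 (`|f x| - `|g x|); have := normr_ge0 (f x).
have := normr_ge0 (g x); nra.
Qed.

Lemma sqintD f g : sqint f -> sqint g -> sqint (fun x => f x + g x).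
Proof.
move=> hf hg; split; first by apply: measurable_funD; exact: sqint_meas.
apply: eq_ig (igD (igD hf.2 hg.2) (igZ 2 (igM hf hg))) => x.
by rewrite sqrrD; ring.
Qed.

Lemma sqintZ k f : sqint f -> sqint (fun x => k * f x).
Proof.
move=> hf; split; first by apply: measurable_funM => //; exact: sqint_meas.
by apply: eq_ig (igZ (k ^+ 2) hf.2) => x; rewrite exprMn.
Qed.

Lemma eq_sqint f g : f =1 g -> sqint f -> sqint g.
Proof. by move=> fg; rewrite (_ : f = g)//; apply/funext. Qed.

Lemma sqintN f : sqint f -> sqint (fun x => - f x).
Proof. by move=> /(sqintZ (-1)); apply: eq_sqint => x; rewrite mulN1r. Qed.

Lemma sqintB f g : sqint f -> sqint g -> sqint (fun x => f x - g x).
Proof. by move=> hf hg; apply: sqintD => //; exact: sqintN. Qed.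

Lemma sqint0 : sqint (fun=> 0).
Proof. by split => //; apply: eq_ig ig0 => x; rewrite expr0n. Qed.

Lemma sqint_sum (I : Type) (s : seq I) (h : I -> T -> R) :
  (forall i, sqint (h i)) -> sqint (fun x => \sum_(i <- s) h i x).
Proof.
move=> hi; elim: s => [|i s ih].
  by apply: eq_sqint sqint0 => x; rewrite big_nil.
by apply: eq_sqint (sqintD (hi i) ih) => x; rewrite big_cons.
Qed.

Lemma sqint_le f g : measurable_fun setT f -> (forall x, `|f x| <= `|g x|) ->
  sqint g -> sqint f.
Proof.
move=> mf fg [mg g2]; split => //; apply: ig_le g2.
  by apply: measurable_funX.
move=> x; rewrite -[g x ^+ 2]real_normK ?num_real// normrX.
by rewrite lerXn2r// nnegrE.
Qed.

Lemma sqint_abs f : sqint f -> sqint (fun x => `|f x|).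
Proof.
move=> hf; apply: sqint_le (hf); last by move=> x; rewrite normr_id.
by apply: measurableT_comp => //; exact: sqint_meas.
Qed.

Lemma ipC f g : ip f g = ip g f.
Proof. by apply: eq_J => x; rewrite mulrC. Qed.

Lemma eq_ip f f' g g' : f =1 f' -> g =1 g' -> ip f g = ip f' g'.
Proof. by move=> hf hg; apply: eq_J => x; rewrite hf hg. Qed.

Lemma ipDl f g h : sqint f -> sqint g -> sqint h ->
  ip (fun x => f x + g x) h = ip f h + ip g h.
Proof.
move=> hf hg hh; rewrite -JD; [|exact: igM|exact: igM].
by apply: eq_J => x; rewrite mulrDl.
Qed.

Lemma ipZl k f h : sqint f -> sqint h -> ip (fun x => k * f x) h = k * ip f h.
Proof.
by move=> hf hh; rewrite -JZ; [apply: eq_J => x; rewrite mulrA|exact: igM].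
Qed.

Lemma ipNl f h : sqint f -> sqint h -> ip (fun x => - f x) h = - ip f h.
Proof.
move=> hf hh; rewrite -mulN1r -ipZl//.
by apply: eq_ip => x //; rewrite mulN1r.
Qed.

Lemma ipBl f g h : sqint f -> sqint g -> sqint h ->
  ip (fun x => f x - g x) h = ip f h - ip g h.
Proof. by move=> hf hg hh; rewrite ipDl ?ipNl//; exact: sqintN. Qed.

Lemma ipDr f g h : sqint f -> sqint g -> sqint h ->
  ip h (fun x => f x + g x) = ip h f + ip h g.
Proof. by move=> *; rewrite ipC ipDl// !(ipC h). Qed.

Lemma ipZr k f h : sqint f -> sqint h -> ip h (fun x => k * f x) = k * ip h f.
Proof. by move=> *; rewrite ipC ipZl// (ipC h). Qed.

Lemma ipBr f g h : sqint f -> sqint g -> sqint h ->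
  ip h (fun x => f x - g x) = ip h f - ip h g.
Proof. by move=> *; rewrite ipC ipBl// !(ipC h). Qed.

Lemma ip_suml (I : Type) (s : seq I) (u : I -> T -> R) h :
  (forall i, sqint (u i)) -> sqint h ->
  ip (fun x => \sum_(i <- s) u i x) h = \sum_(i <- s) ip (u i) h.
Proof.
move=> hu hh; rewrite -J_sum; last by move=> i; exact: igM.
by apply: eq_J => x; rewrite mulr_suml.
Qed.

Lemma ip_sumr (I : Type) (s : seq I) (u : I -> T -> R) h :
  (forall i, sqint (u i)) -> sqint h ->
  ip h (fun x => \sum_(i <- s) u i x) = \sum_(i <- s) ip h (u i).
Proof.
by move=> hu hh; rewrite ipC ip_suml//; apply: eq_bigr => i _; rewrite ipC.
Qed.

Lemma ip_ge0 f : 0 <= ip f f.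
Proof. by apply: J_ge0 => x; rewrite -expr2 sqr_ge0. Qed.

Lemma ipE f : ip f f = J (fun x => f x ^+ 2).
Proof. by apply: eq_J => x; rewrite expr2. Qed.

Lemma nrm_ge0 f : 0 <= nrm f. Proof. exact: sqrtr_ge0. Qed.

Lemma nrm_sq f : nrm f ^+ 2 = ip f f.
Proof. by rewrite sqr_sqrtr// ip_ge0. Qed.

Lemma eq_nrm f g : f =1 g -> nrm f = nrm g.
Proof. by move=> fg; rewrite /nrm (eq_ip fg fg). Qed.

Lemma cauchy_schwarz f g : sqint f -> sqint g -> `|ip f g| <= nrm f * nrm g.
Proof.
move=> hf hg.
apply: le_of_quadratic_ge0 => [||t]; [exact: ip_ge0|exact: ip_ge0|].
have tg := sqintZ t hg; have := ip_ge0 (fun x => f x - t * g x).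
rewrite ipBl//; last exact: sqintB.
rewrite !ipBr// !ipZl// !ipZr// (ipC g f) => /le_trans; apply.
by apply/le_of_eq; ring.
Qed.

Lemma ip_le f g : sqint f -> sqint g -> ip f g <= nrm f * nrm g.
Proof. by move=> hf hg; apply: le_trans (cauchy_schwarz hf hg); exact: ler_norm. Qed.

Lemma nrmD f g : sqint f -> sqint g -> nrm (fun x => f x + g x) <= nrm f + nrm g.
Proof.
move=> hf hg; rewrite -(@ler_pXn2r _ 2)// ?nnegrE ?addr_ge0 ?nrm_ge0//.
rewrite nrm_sq sqrrD !nrm_sq ipDl ?ipDr//; last exact: sqintD.
by rewrite (ipC g f); have := ip_le hf hg; lra.
Qed.

Lemma nrmZ k f : sqint f -> nrm (fun x => k * f x) = `|k| * nrm f.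
Proof.
move=> hf; rewrite /nrm ipZl ?ipZr//; last exact: sqintZ.
by rewrite mulrA -expr2 sqrtrM ?sqr_ge0// sqrtr_sqr.
Qed.

Lemma nrmN f : nrm (fun x => - f x) = nrm f.
Proof. by rewrite /nrm; congr Num.sqrt; apply: eq_J => x; rewrite mulrNN. Qed.

Lemma nrmB f g : sqint f -> sqint g -> nrm (fun x => f x - g x) <= nrm f + nrm g.
Proof.
by move=> hf hg; rewrite -(nrmN g); apply: nrmD => //; exact: sqintN.
Qed.

Lemma nrm_subC f g : nrm (fun x => f x - g x) = nrm (fun x => g x - f x).
Proof. by rewrite -nrmN; apply: eq_nrm => x; rewrite opprB. Qed.

Lemma nrm_tri f g h : sqint f -> sqint g -> sqint h ->
  nrm (fun x => f x - h x) <= nrm (fun x => f x - g x) + nrm (fun x => g x - h x).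
Proof.
move=> hf hg hh; rewrite (@eq_nrm _ (fun x => (f x - g x) + (g x - h x))).
  by apply: nrmD; exact: sqintB.
by move=> x; rewrite addrA subrK.
Qed.

Lemma nrm_le_sub f g : sqint f -> sqint g -> nrm f <= nrm g + nrm (fun x => f x - g x).
Proof.
move=> hf hg; rewrite addrC (@eq_nrm f (fun x => (f x - g x) + g x)).
  by apply: nrmD => //; exact: sqintB.
by move=> x; rewrite subrK.
Qed.

Lemma le_nrm f g : sqint f -> sqint g -> (forall x, `|f x| <= `|g x|) ->
  nrm f <= nrm g.
Proof.
move=> hf hg fg; rewrite /nrm ler_sqrt ?ip_ge0// !ipE.
apply: J_le (hf.2) (hg.2) _ => x.
by rewrite -real_normK ?num_real// -[leRHS]real_normK ?num_real// lerXn2r ?nnegrE.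
Qed.

Lemma nrm_abs f : nrm (fun x => `|f x|) = nrm f.
Proof.
by rewrite /nrm !ipE; congr Num.sqrt; apply: eq_J => x; rewrite real_normK ?num_real.
Qed.

Lemma ae_eq_sqint f g : measurable_fun setT g -> (f = g %[ae mu]) ->
  sqint f -> sqint g.
Proof.
move=> mg fg [mf f2]; split=> //; apply: ae_eq_ig f2; first exact: measurable_funX.
by apply: filterS fg => x /= fgx _; rewrite fgx.
Qed.

Lemma ae_eq_ip f f' g : measurable_fun setT f -> measurable_fun setT f' ->
  measurable_fun setT g -> (f = f' %[ae mu]) -> ip f g = ip f' g.
Proof.
move=> mf mf' mg ff'; apply: ae_eq_J; [exact: measurable_funM|exact: measurable_funM|].
by apply: filterS ff' => x /= fgx _; rewrite fgx.
Qed.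

(** The series of the [h k] has integral at most 2 by monotone convergence, so it is finite almost
    everywhere and bounds each of its nonnegative terms. It is the common source of the almost
    everywhere convergence in [ae_cvg_of_fast] and [riesz_fischer]. *)
Lemma ae_bounded_of_summable (h : nat -> T -> R) :
  (forall k x, 0 <= h k x) -> (forall k, ig (h k)) ->
  (forall k, J (h k) <= 2^-1 ^+ k) ->
  {ae mu, forall x, exists M, forall k, h k x <= M}.
Proof.
move=> h0 hi hJ.
pose s x := (\sum_(0 <= k <oo) (h k x)%:E)%E.
have ms k : measurable_fun setT (fun x => (h k x)%:E).
  by apply/measurable_EFinP; exact: ig_meas.
have h0e k x : (0 <= (h k x)%:E)%E by rewrite lee_fin.
have is_ : mu.-integrable setT s.
  apply/integrableP; split.
    apply: (@ge0_emeasurable_sum _ _ _ setT (fun k x => (h k x)%:E) xpredT) => //.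
  have -> : (\int[mu]_x `|s x| = \int[mu]_x s x)%E.
    apply: eq_integral => x _; rewrite gee0_abs//.
    by apply: nneseries_ge0 => k _ _; exact: h0e.
  rewrite integral_nneseries//.
  apply: (@le_lt_trans _ _ 2%:E); last exact: ltry.
  apply: lime_le.
    by apply: is_cvg_nneseries => k _ _; exact: integral_ge0.
  near=> n; rewrite (eq_bigr (fun k => (J (h k))%:E)); last first.
    by move=> k _; rewrite EFin_J.
  rewrite sumEFin lee_fin.
  apply: (@le_trans _ _ (\sum_(0 <= k < n) 2^-1 ^+ k)).
    by apply: ler_sum => k _.
  suff -> : \sum_(0 <= k < n) 2^-1 ^+ k = 2 - 2 * 2^-1 ^+ n :> R.
    by rewrite gerBl mulr_ge0// exprn_ge0// invr_ge0.
  elim: (n) => [|m ih]; first by rewrite big_geq// expr0 mulr1 subrr.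
  by rewrite big_nat_recr//= ih exprS; lra.
have := integrable_ae measurableT is_; apply: filterS => x /(_ I) sx.
exists (fine (s x)) => k; rewrite -lee_fin fineK//.
apply: le_trans (nneseries_lim_ge k.+1 _) => //.
rewrite big_nat_recr//= leeDr//.
by apply: sume_ge0.
Unshelve. all: by end_near. Qed.

(** Fatou's lemma with [Th] applied first: by continuity the lower limit of [Th \o f n] is [Th \o g]
    almost everywhere. The bound is asked only for large [n], since it may come from a convergent
    sequence of bounds. *)
Lemma fatou_ae (f : nat -> T -> R) (g : T -> R) (Th : R -> R) (C : R) :
  (forall n, measurable_fun setT (f n)) -> measurable_fun setT g ->
  continuous Th -> (forall s, 0 <= Th s) ->
  {ae mu, forall x, f n x @[n --> \oo] --> g x} ->
  (forall n, ig (Th \o f n)) -> (\forall n \near \oo, J (Th \o f n) <= C) ->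
  ig (Th \o g) /\ J (Th \o g) <= C.
Proof.
move=> mf mg cT T0 fg iT hC.
have mT : measurable_fun setT Th by exact: continuous_measurable_fun.
have mTf n : measurable_fun setT (fun x => (Th (f n x))%:E).
  by apply/measurable_EFinP; apply: measurableT_comp.
have mTg : measurable_fun setT (Th \o g) by exact: measurableT_comp.
apply: ig_ge0 => //; first by move=> x /=.
have -> : (\int[mu]_x ((Th \o g) x)%:E =
           \int[mu]_x limn_einf (fun n => (Th (f n x))%:E))%E.
  apply: ae_eq_integral => //.
  - by apply/measurable_EFinP; apply: measurableT_comp.
  - rewrite (_ : (fun _ => _) = -%E \o (fun x => limn_esup (fun n => (- (Th (f n x))%:E)%E))).
      apply: measurableT_comp => //; apply: measurable_fun_limn_esup => n.
      by apply: measurableT_comp.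
    by apply/funext => x /=; rewrite -limn_einfN; congr limn_einf; apply/funext => n; rewrite /= ?oppeK ?opprK.
  - apply: filterS fg => x /= fgx _; apply/esym.
    apply: (cvg_limn_einf_sup _).1.
    apply: cvg_EFin; first by near=> n.
    by apply: cvg_comp fgx _; exact: cT.
have h0 n x : setT x -> (0 <= (Th (f n x))%:E)%E by move=> _; rewrite lee_fin.
apply: le_trans (@fatou _ _ _ mu setT measurableT (fun n x => (Th (f n x))%:E) mTf h0) _.
rewrite limn_einf_lim; apply: lime_le; first exact: is_cvg_einfs.
near=> n.
apply: (@le_trans _ _ (\int[mu]_x (Th (f n x))%:E)%E).
  by apply: ereal_inf_lbound; exists n => /=.
rewrite EFin_J ?lee_fin; last exact: iT.
by near: n.
Unshelve. all: by end_near. Qed.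

(** The squared distance is at most 4^-n, so multiplied by 2^n it is still summable; boundedness of
    the weighted squares then gives pointwise decay like 2^(-n/2). *)
Lemma ae_cvg_of_fast (f : nat -> T -> R) (g : T -> R) :
  (forall n, sqint (f n)) -> sqint g ->
  (forall n, nrm (fun x => f n x - g x) <= 2^-1 ^+ n) ->
  {ae mu, forall x, f n x @[n --> \oo] --> g x}.
Proof.
move=> sf sg hfg.
have sB n : sqint (fun x => f n x - g x) by exact: sqintB.
have := @ae_bounded_of_summable (fun n x => 2 ^+ n * (f n x - g x) ^+ 2).
have h1 k x : 0 <= 2 ^+ k * (f k x - g x) ^+ 2 by rewrite mulr_ge0 ?sqr_ge0// exprn_ge0.
have h2 k : ig (fun x => 2 ^+ k * (f k x - g x) ^+ 2) by apply: igZ; exact: (sB k).2.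
have h3 k : J (fun x => 2 ^+ k * (f k x - g x) ^+ 2) <= 2^-1 ^+ k.
  rewrite JZ; last exact: (sB k).2.
  rewrite -ipE -nrm_sq.
  have : nrm (fun x => f k x - g x) ^+ 2 <= (2^-1 ^+ k) ^+ 2.
    by rewrite lerXn2r// ?nnegrE ?nrm_ge0// exprn_ge0// invr_ge0.
  move=> /(ler_wpM2l (exprn_ge0 k (ler0n R 2)))/le_trans; apply.
  by rewrite expr2 mulrA -exprMn divff// expr1n mul1r.
move=> /(_ h1 h2 h3); apply: filterS => x [M hM].
have hM1 n : `|f n x - g x| <= Num.sqrt (M * 2^-1 ^+ n).
  rewrite -sqrtr_sqr ler_sqrt; last first.
    apply: le_trans (mulr_ge0 (h1 n x) (exprn_ge0 n _ : 0 <= 2^-1 ^+ n)) _ => //.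
    by rewrite ler_wpM2r ?exprn_ge0.
  by rewrite exprVn ler_pdivlMr ?exprn_gt0// mulrC hM.
apply/cvgrPdist_lt => e e0.
have c0 : (fun n => M * 2^-1 ^+ n) @ \oo --> (0 : R).
  rewrite -[X in _ --> X](mulr0 M); apply: cvgMr; apply: cvg_expr.
  by rewrite ger0_norm ?invf_lt1 ?ltr1n ?invr_ge0.
near=> n; rewrite distrC; apply: le_lt_trans (hM1 n) _.
rewrite -(ger0_norm (ltW e0)) -sqrtr_sqr ltr_sqrt ?exprn_gt0//.
near: n.
have [N _ hN] := @cvgr0_norm_lt _ _ _ _ _ _ c0 (e ^+ 2) (exprn_gt0 2 e0).
by exists N => // n Nn; apply: le_lt_trans (ler_norm _) (hN n Nn).
Unshelve. all: by end_near. Qed.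

Definition nlim (f : nat -> T -> R) (g : T -> R) :=
  nrm (fun x => f n x - g x) @[n --> \oo] --> (0 : R).

Lemma nlimP (f : nat -> T -> R) (g : T -> R) : nlim f g <->
  forall e, 0 < e -> exists N, forall n, (N <= n)%N -> nrm (fun x => f n x - g x) < e.
Proof.
split=> [h e e0|h].
  have /cvgr0_norm_lt/(_ e e0)[N _ hN] := h.
  by exists N => n Nn; apply: le_lt_trans (hN n Nn); exact: ler_norm.
apply/cvgr0Pnorm_lt => e e0; have [N hN] := h e e0.
by exists N => // n /= Nn; rewrite ger0_norm ?nrm_ge0//; exact: hN.
Qed.

Lemma nlim_subseq (f : nat -> T -> R) (g : T -> R) : (forall n, sqint (f n)) -> sqint g -> nlim f g ->
  exists k : nat -> nat, (forall n, (n <= k n)%N) /\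
    {ae mu, forall x, f (k n) x @[n --> \oo] --> g x}.
Proof.
move=> sf sg /nlimP h.
have hk n : exists k, (n <= k)%N /\ nrm (fun x => f k x - g x) <= 2^-1 ^+ n.
  have e0 : 0 < (2^-1 ^+ n : R) by rewrite exprn_gt0// invr_gt0.
  have [N hN] := h _ e0.
  by exists (maxn n N); rewrite leq_maxl; split => //; apply/ltW/hN; exact: leq_maxr.
have [k /all_and2[k1 k2]] := choice hk.
by exists k; split => //; exact: ae_cvg_of_fast.
Qed.

Lemma fatou_nlim (f : nat -> T -> R) (g : T -> R) (Th : R -> R) (C : R) :
  (forall n, sqint (f n)) -> sqint g -> nlim f g ->
  continuous Th -> (forall s, 0 <= Th s) ->
  (forall n, ig (Th \o f n)) -> (\forall n \near \oo, J (Th \o f n) <= C) ->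
  ig (Th \o g) /\ J (Th \o g) <= C.
Proof.
move=> sf sg fg cT T0 iT [N _ hN].
have [k [k1 k2]] := nlim_subseq sf sg fg.
apply: (@fatou_ae (fun n => f (k n))) => //.
- by move=> n; exact: sqint_meas.
- exact: sqint_meas.
- by exists N => // n /= Nn; apply: hN => /=; exact: leq_trans (k1 n).
Qed.

Lemma cvg_of_fast_cauchy (a : nat -> R) (M : R) :
  (forall n, `|a n.+1 - a n| <= M * 2^-1 ^+ n) -> cvgn a.
Proof.
move=> h.
have M0 : 0 <= M by have := le_trans (normr_ge0 _) (h 0%N); rewrite expr0 mulr1.
have hb n m : `|a (n + m)%N - a n| <= M * 2^-1 ^+ n * (2 - 2 * 2^-1 ^+ m).
  elim: m => [|m ih]; first by rewrite addn0 subrr normr0 expr0 mulr1 subrr mulr0.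
  rewrite addnS -(subrK (a (n + m)%N) (a (n + m).+1)) -addrA.
  apply: le_trans (ler_normD _ _) _; apply: le_trans (lerD (h _) ih) _.
  rewrite exprD exprS -!mulrA -mulrDr ler_wpM2l// -mulrDr ler_wpM2l ?exprn_ge0//.
  lra.
apply: cauchy_cvg; apply: cauchy_exP => e e0.
have c0 : (fun n => M * 2 * 2^-1 ^+ n) @ \oo --> (0 : R).
  rewrite -[X in _ --> X](mulr0 (M * 2)); apply: cvgMr; apply: cvg_expr.
  by rewrite ger0_norm ?invf_lt1 ?ltr1n ?invr_ge0.
have e20 : 0 < e / 2 by rewrite divr_gt0.
have [N _ hN] := @cvgr0_norm_lt _ _ _ _ _ _ c0 _ e20.
have hN2 n : (N <= n)%N -> `|a n - a N| < e / 2.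
  move=> Nn; rewrite -(subnKC Nn); apply: le_lt_trans (hb _ _) _.
  apply: le_lt_trans (hN N _) => //=.
  rewrite ger0_norm ?mulr_ge0// ?exprn_ge0// -!mulrA ler_wpM2l// mulrC.
  by rewrite ler_wpM2r ?exprn_ge0// gerBl mulr_ge0// exprn_ge0// invr_ge0.
exists (a N); exists N => // n /= Nn; rewrite /ball/= distrC.
by apply: lt_trans (hN2 n Nn) _; rewrite ltr_pdivrMr// ltr_pMr// ltr1n.
Qed.

Lemma riesz_fischer (f : nat -> T -> R) : (forall n, sqint (f n)) ->
  (forall e, 0 < e -> exists N, forall m n, (N <= m)%N -> (N <= n)%N ->
     nrm (fun x => f m x - f n x) < e) ->
  exists2 g, sqint g & nlim f g.
Proof.
move=> sf hC.
have hk (k : nat) : exists N, forall m n, (N <= m)%N -> (N <= n)%N ->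
     nrm (fun x => f m x - f n x) < 4^-1 ^+ k.
  by apply: hC; rewrite exprn_gt0// invr_gt0.
have [N hN] := choice hk.
(* [k] is nondecreasing and [k n] dominates both [n] and [N n], so consecutive selected terms are
   within 4^-n of each other. *)
pose k n := (n + \sum_(i < n.+1) N i)%N.
have kN n : (N n <= k n)%N by rewrite /k big_ord_recr/= addnA leq_addl.
have kS n : (k n <= k n.+1)%N by rewrite {2}/k big_ord_recr/= addnA addSn leqW// leq_addr.
have knd m n : (m <= n)%N -> (k m <= k n)%N.
  by move=> /subnKC <-; elim: (n - m)%N => [|p ih]; rewrite ?addn0 ?addnS// (leq_trans ih).
have sB n : sqint (fun x => f (k n.+1) x - f (k n) x) by exact: sqintB.
have h1 n x : 0 <= 4 ^+ n * (f (k n.+1) x - f (k n) x) ^+ 2.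
  by rewrite mulr_ge0 ?sqr_ge0// exprn_ge0.
have h2 n : ig (fun x => 4 ^+ n * (f (k n.+1) x - f (k n) x) ^+ 2).
  by apply: igZ; exact: (sB n).2.
have h3 n : J (fun x => 4 ^+ n * (f (k n.+1) x - f (k n) x) ^+ 2) <= 2^-1 ^+ n.
  rewrite JZ; last exact: (sB n).2.
  rewrite -ipE -nrm_sq.
  have : nrm (fun x => f (k n.+1) x - f (k n) x) ^+ 2 <= (4^-1 ^+ n) ^+ 2.
    rewrite lerXn2r// ?nnegrE ?nrm_ge0 ?exprn_ge0// ?invr_ge0//.
    by apply/ltW/hN; rewrite (leq_trans (kN n)).
  move=> /(ler_wpM2l (exprn_ge0 n (ler0n R 4)))/le_trans; apply.
  rewrite expr2 mulrA -exprMn divff// expr1n mul1r lerXn2r// ?nnegrE ?invr_ge0//.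
  by rewrite lef_pV2 ?posrE// ler_nat.
have hb := ae_bounded_of_summable h1 h2 h3.
have hcv : {ae mu, forall x, cvgn (fun n => f (k n) x)}.
  apply: filterS hb => x [M hM].
  apply: (@cvg_of_fast_cauchy _ (Num.sqrt M)) => n.
  have M0 : 0 <= M by exact: le_trans (h1 n x) (hM n).
  have p0 : 0 <= 2^-1 ^+ n :> R by rewrite exprn_ge0 ?invr_ge0.
  rewrite -(ger0_norm p0) -(sqrtr_sqr (2^-1 ^+ n)) -sqrtrM//.
  rewrite -sqrtr_sqr ler_sqrt; last by rewrite mulr_ge0 ?sqr_ge0.
  rewrite exprAC (_ : 2^-1 ^+ 2 = 4^-1); last by rewrite exprVn -natrX.
  by rewrite exprVn ler_pdivlMr ?exprn_gt0// mulrC hM.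
(* The upper limit makes [g] measurable on the whole space; it equals the limit wherever the
   subsequence converges. *)
pose g x := fine (limn_esup (fun n => (f (k n) x)%:E)).
have mg : measurable_fun setT g.
  apply: measurableT_comp => //; apply: measurable_fun_limn_esup => n.
  by apply/measurable_EFinP; exact: sqint_meas.
have hg : {ae mu, forall x, f (k n) x @[n --> \oo] --> g x}.
  apply: filterS hcv => x hx.
  suff -> : g x = limn (fun n => f (k n) x) by [].
  have hx' : (f (k n) x)%:E @[n --> \oo] --> (limn (fun n => f (k n) x))%:E.
    by apply: cvg_EFin => //; near=> n.
  by rewrite /g (cvg_limn_einf_sup hx').2.
(* Fatou along the subsequence lets the Cauchy bound pass to the limit in one index; this yields
   both the square integrability of [g] and the convergence of the whole sequence. *)
have hm e M : 0 < e -> (forall m n, (M <= m)%N -> (M <= n)%N ->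
     nrm (fun x => f m x - f n x) < e) -> forall m, (M <= m)%N ->
     sqint (fun x => g x - f m x) /\ nrm (fun x => g x - f m x) <= e.
  move=> e0 hM m Mm.
  pose Th (s : R) := s ^+ 2.
  have cT : continuous Th by move=> s; exact: exprn_continuous.
  have T0 s : 0 <= Th s by exact: sqr_ge0.
  have hd : {ae mu, forall x, f (k n) x - f m x @[n --> \oo] --> g x - f m x}.
    by apply: filterS hg => x hx; apply: cvgB => //; exact: cvg_cst.
  have [||||h1' h2'] := @fatou_ae (fun n x => f (k n) x - f m x)
      (fun x => g x - f m x) Th (e ^+ 2) _ _ cT T0 hd.
  - by move=> n; apply: sqint_meas; exact: sqintB.
  - by apply: measurable_funB => //; exact: sqint_meas.
  - by move=> n; exact: (sqintB (sf _) (sf _)).2.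
  - exists M => // n /= Mn; rewrite -[leLHS]ipE -nrm_sq lerXn2r ?nnegrE ?nrm_ge0 ?(ltW e0)//.
    by apply/ltW/hM => //; rewrite (leq_trans Mn)// leq_addr.
  split; first by split=> //; apply: measurable_funB => //; exact: sqint_meas.
  by rewrite -(@ler_pXn2r _ 2)// ?nnegrE ?nrm_ge0 ?(ltW e0)// nrm_sq ipE.
have sg : sqint g.
  have [M hM] := hC 1 ltr01.
  have [h4 _] := hm _ _ ltr01 hM M (leqnn _).
  by apply: eq_sqint (sqintD h4 (sf M)) => x; rewrite subrK.
exists g => //; apply/nlimP => e e0.
have e20 : 0 < e / 2 by rewrite divr_gt0.
have [M hM] := hC _ e20; exists M => n Mn; rewrite nrm_subC.
apply: le_lt_trans (hm _ _ e20 hM n Mn).2 _.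
by rewrite ltr_pdivrMr// ltr_pMr// ltr1n.
Unshelve. all: by end_near. Qed.

Lemma nlim_ip (f : nat -> T -> R) g h : (forall n, sqint (f n)) -> sqint g -> sqint h ->
  nlim f g -> ip (f n) h @[n --> \oo] --> ip g h.
Proof.
move=> sf sg sh /nlimP fg; apply/cvgrPdist_lt => e e0.
have nh1 : 0 < nrm h + 1 by rewrite ltr_wpDl ?nrm_ge0.
have [N hN] := fg (e / (nrm h + 1)) (divr_gt0 e0 nh1).
exists N => // n /= Nn; rewrite distrC -ipBl//.
apply: le_lt_trans (cauchy_schwarz (sqintB (sf n) sg) sh) _.
have := hN n Nn; rewrite ltr_pdivlMr//; apply: le_lt_trans.
by rewrite ler_wpM2l ?nrm_ge0// lerDl.
Qed.

Lemma nlim_nrm (f : nat -> T -> R) g : (forall n, sqint (f n)) -> sqint g ->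
  nlim f g -> nrm (f n) @[n --> \oo] --> nrm g.
Proof.
move=> sf sg /nlimP fg; apply/cvgrPdist_lt => e e0.
have [N hN] := fg e e0; exists N => // n /= Nn.
apply: le_lt_trans (hN n Nn); rewrite ler_norml; apply/andP; split.
  by rewrite lerBrDl addrC subr_le0 || rewrite lerNl opprB lerBlDl; exact: nrm_le_sub.
by rewrite nrm_subC lerBlDl; exact: nrm_le_sub.
Qed.

Lemma Lnorm2E f : sqint f -> 'N[mu]_2%:E[EFin \o f]%E = (nrm f)%:E.
Proof.
move=> hf; rewrite unlock.
have -> : (\int[mu]_x `|(EFin \o f) x| `^ 2 = (ip f f)%:E)%E.
  rewrite ipE -EFin_J; last exact: hf.2.
  apply: eq_integral => x _ /=.
  by rewrite powR_mulrn// real_normK ?num_real.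
by rewrite poweR_EFin powR12_sqrt ?ip_ge0.
Qed.

Lemma finite_norm_sqint f : measurable_fun setT f ->
  (sqint f <-> finite_norm mu 2%:E f).
Proof.
move=> mf; split; rewrite /finite_norm; first by move=> hf; rewrite Lnorm2E// ltry.
move=> h; split=> //; apply/integrableP; split.
  by apply/measurable_EFinP; exact: measurable_funX.
rewrite (_ : (\int[mu]_x _)%E = ('N[mu]_2%:E[EFin \o f] `^ 2)%E); last first.
  rewrite powR_Lnorm//; apply: eq_integral => x _ /=.
  by rewrite powR_mulrn// -normrX.
by rewrite poweR_lty.
Qed.

(** A bound on the L^6 norm, stated through sixth powers so that no root occurs; [r] is meant to be
    nonnegative. *)
Definition L6 (r : R) f := [/\ measurable_fun setT f, ig (fun x => f x ^+ 6) &
  J (fun x => f x ^+ 6) <= r ^+ 6].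

Lemma even_pow (n : nat) (x : R) : `|x| ^+ (n.*2) = x ^+ (n.*2).
Proof. by rewrite -mul2n !exprM real_normK ?num_real. Qed.

(* Weighted AM-GM: [r^4 w e <= r^6 + w^6 + e^6], then homogeneity. *)
Lemma holder6 (a b c : R) f g h : 0 < a -> 0 < b -> 0 < c ->
  L6 a f -> L6 b g -> L6 c h ->
  ig (fun x => f x ^+ 4 * `|g x| * `|h x|) /\
  J (fun x => f x ^+ 4 * `|g x| * `|h x|) <= a ^+ 4 * b * c.
Proof.
move=> a0 b0 c0 [mf f6 fJ] [mg g6 gJ] [mh h6 hJ].
(* The weights are fixed by homogeneity: [k1 * a ^+ 6 + k2 * b ^+ 6 + k3 * c ^+ 6] is exactly
   [a ^+ 4 * b * c]. *)
pose k1 := a ^+ 4 * b * c * (2 / 3) / a ^+ 6.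
pose k2 := a ^+ 4 * b * c / 6 / b ^+ 6.
pose k3 := a ^+ 4 * b * c / 6 / c ^+ 6.
have key (x y z : R) : 0 <= x -> 0 <= y -> 0 <= z ->
    x ^+ 4 * y * z <= 2 / 3 * x ^+ 6 + y ^+ 6 / 6 + z ^+ 6 / 6.
  move=> x0 y0 z0.
  have h1 : y * z <= (y ^+ 2 + z ^+ 2) / 2 by have := sqr_ge0 (y - z); nra.
  have am (p q : R) : 0 <= p -> 0 <= q -> p ^+ 2 * q <= 2 / 3 * p ^+ 3 + q ^+ 3 / 3.
    move=> p0 q0; have := mulr_ge0 (addr_ge0 (mulr_ge0 (ler0n R 2) p0) q0) (sqr_ge0 (p - q)).
    by nra.
  have h2 := am _ _ (sqr_ge0 x) (sqr_ge0 y).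
  have h3 := am _ _ (sqr_ge0 x) (sqr_ge0 z).
  have x40 : 0 <= x ^+ 4 by rewrite exprn_ge0.
  have := ler_wpM2l x40 h1.
  rewrite -!exprM /= in h2 h3.
  move: h2 h3; rewrite mulrA; lra.
have pt x : f x ^+ 4 * `|g x| * `|h x| <= k1 * f x ^+ 6 + k2 * g x ^+ 6 + k3 * h x ^+ 6.
  have := key (`|f x| / a) (`|g x| / b) (`|h x| / c).
  rewrite !divr_ge0// ?(ltW a0) ?(ltW b0) ?(ltW c0)// => /(_ isT isT isT).
  have abc : 0 <= a ^+ 4 * b * c by rewrite !mulr_ge0 ?exprn_ge0// ltW.
  move=> /(ler_wpM2l abc); rewrite !expr_div_n (even_pow 2) !(even_pow 3).
  rewrite /k1 /k2 /k3 => hh; apply: le_trans (le_trans _ hh) _.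
    by apply/le_of_eq; field; rewrite ?gt_eqF.
  by apply/le_of_eq; field; rewrite ?gt_eqF.
have igr : ig (fun x => k1 * f x ^+ 6 + k2 * g x ^+ 6 + k3 * h x ^+ 6).
  by apply: igD; [apply: igD|]; exact: igZ.
have igl : ig (fun x => f x ^+ 4 * `|g x| * `|h x|).
  apply: ig_le igr.
    apply: measurable_funM; last exact: measurableT_comp.
    by apply: measurable_funM; [exact: measurable_funX|exact: measurableT_comp].
  move=> x; rewrite ger0_norm//; apply: mulr_ge0 => //; apply: mulr_ge0 => //.
  exact: exprn_even_ge0.
split=> //; apply: le_trans (J_le igl igr pt) _.
rewrite !JD ?JZ//; try exact: igZ; last by apply: igD; exact: igZ.
have k10 : 0 <= k1 by rewrite /k1 !mulr_ge0 ?exprn_ge0 ?invr_ge0 ?exprn_ge0// ltW.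
have k20 : 0 <= k2 by rewrite /k2 !mulr_ge0 ?exprn_ge0 ?invr_ge0 ?exprn_ge0// ltW.
have k30 : 0 <= k3 by rewrite /k3 !mulr_ge0 ?exprn_ge0 ?invr_ge0 ?exprn_ge0// ltW.
apply: le_trans (lerD (lerD (ler_wpM2l k10 fJ) (ler_wpM2l k20 gJ)) (ler_wpM2l k30 hJ)) _.
rewrite /k1 /k2 /k3 !divfK ?expf_neq0 ?gt_eqF//.
apply/le_of_eq; by field.
Qed.

Lemma L6_le (a b : R) f : 0 <= a -> a <= b -> L6 a f -> L6 b f.
Proof.
move=> a0 ab [h1 h2 h3]; split=> //; apply: le_trans h3 _.
by rewrite lerXn2r// nnegrE// (le_trans a0).
Qed.

Lemma L6Z k (a : R) f : L6 a f -> L6 (`|k| * a) (fun x => k * f x).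
Proof.
move=> [h1 h2 h3]; split.
- exact: measurable_funM.
- by apply: eq_ig (igZ (k ^+ 6) h2) => x; rewrite exprMn.
- rewrite (@eq_J _ (fun x => k ^+ 6 * f x ^+ 6)); last by move=> x; rewrite exprMn.
  by rewrite JZ// exprMn (even_pow 3) ler_wpM2l//; exact: exprn_even_ge0.
Qed.

(* [r] can be taken small in [L^6] uniformly on a compact set. *)
Definition split6 (K rho : R) f :=
  exists r : T -> R, L6 rho r /\ forall x, `|f x - r x| <= K.

End integration.

Arguments ipC {d T R mu} f g.

Lemma summable_cauchy (R : realType) (a : nat -> R) (M : R) :
  (forall j, 0 <= a j) -> (forall n, \sum_(0 <= j < n) a j <= M) ->
  forall e, 0 < e -> exists N, forall m n, (N <= m)%N -> (m <= n)%N ->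
    \sum_(m <= j < n) a j < e.
Proof.
move=> a0 aM e e0.
have nd : nondecreasing_seq (fun n => \sum_(0 <= j < n) a j).
  by apply/nondecreasing_seqP => n; rewrite big_nat_recr//= lerDl.
have cv : cvgn (fun n => \sum_(0 <= j < n) a j).
  by apply: nondecreasing_is_cvgn => //; exists M => _ [n _ <-].
have e20 : 0 < e / 2 by rewrite divr_gt0.
have /cvgrPdist_lt/(_ _ e20)[N _ hN] := cv.
exists N => m n Nm mn.
have -> : \sum_(m <= j < n) a j = \sum_(0 <= j < n) a j - \sum_(0 <= j < m) a j.
  by rewrite (big_cat_nat (leq0n m) mn)//=; ring.
apply: le_lt_trans (ler_norm _) _.
rewrite -(subrKA (limn (fun n => \sum_(0 <= j < n) a j))).
apply: le_lt_trans (ler_normD _ _) _; rewrite (splitr e) ltrD//.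
  by rewrite distrC; apply: hN => /=; exact: leq_trans mn.
exact: hN.
Qed.

(** * Expansions in an orthonormal family *)

Section orthonormal_basis.
Context d (T : measurableType d) (R : realType) (mu : {measure set T -> \bar R}).
Local Notation sqint := (sqint mu).
Local Notation ip := (ip mu).
Local Notation nrm := (nrm mu).
Local Notation nlim := (nlim mu).
Implicit Types (u v w : T -> R) (c : nat -> R).

Definition lc (e : nat -> T -> R) c n (x : T) := \sum_(0 <= j < n) c j * e j x.

Section any_family.
Variable e : nat -> T -> R.
Hypothesis se : forall j, sqint (e j).

Lemma lc_sqint c n : sqint (lc e c n).
Proof. by apply: sqint_sum => j; exact: sqintZ. Qed.

Lemma ip_lcl c n u : sqint u -> ip (lc e c n) u = \sum_(0 <= j < n) c j * ip (e j) u.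
Proof.
move=> su; rewrite ip_suml//; last by move=> j; exact: sqintZ.
by apply: eq_bigr => j _; rewrite ipZl.
Qed.

Lemma ip_lcr c n u : sqint u -> ip u (lc e c n) = \sum_(0 <= j < n) c j * ip u (e j).
Proof.
move=> su; rewrite ipC ip_lcl//.
by apply: eq_bigr => j _; rewrite ipC.
Qed.

End any_family.

Variable e : nat -> T -> R.
Hypothesis se : forall j, sqint (e j).
Hypothesis eo : forall i j, ip (e i) (e j) = (i == j)%:R.

Lemma ip_lc_e c n j : ip (lc e c n) (e j) = if (j < n)%N then c j else 0.
Proof.
rewrite ip_lcl//; case: ifPn => jn.
  rewrite (bigD1_seq j) ?mem_index_iota ?iota_uniq//=.
  rewrite eo eqxx mulr1 big1 ?addr0// => i ij.
  by rewrite eo (negbTE ij) mulr0.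
rewrite big_nat_cond big1// => i /andP[/andP[_ iltn] _].
rewrite eo (_ : (i == j) = false) ?mulr0//.
by apply/eqP => ij; rewrite -ij iltn in jn.
Qed.

Lemma ip_lc_lc c c' n : ip (lc e c n) (lc e c' n) = \sum_(0 <= j < n) c j * c' j.
Proof.
rewrite ip_lcr//; last exact: lc_sqint.
rewrite [LHS]big_nat_cond [RHS]big_nat_cond.
by apply: eq_bigr => j /andP[/andP[_ jn] _]; rewrite ip_lc_e jn mulrC.
Qed.

Lemma ip_lc_sub c m n : (m <= n)%N ->
  nrm (fun x => lc e c n x - lc e c m x) ^+ 2 = \sum_(m <= j < n) c j ^+ 2.
Proof.
move=> mn; rewrite nrm_sq ipBl ?ipBr//; try exact: lc_sqint; last first.
  by apply: sqintB; exact: lc_sqint.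
have h k : (m <= k)%N -> ip (lc e c m) (lc e c k) = \sum_(0 <= j < m) c j ^+ 2.
  move=> mk; rewrite ip_lcl//; last exact: lc_sqint.
  rewrite [LHS]big_nat_cond [RHS]big_nat_cond; apply: eq_bigr => j /andP[/andP[_ jm] _].
  by rewrite ipC ip_lc_e (leq_trans jm mk) expr2.
rewrite (ipC (lc e c n) (lc e c m)) !h// ip_lc_lc.
rewrite (eq_bigr (fun j => c j ^+ 2)); last by move=> j _; rewrite expr2.
by rewrite (big_cat_nat (leq0n m) mn)//=; ring.
Qed.

Lemma bessel u n : sqint u -> \sum_(0 <= j < n) ip u (e j) ^+ 2 <= ip u u.
Proof.
move=> su; pose c j := ip u (e j).
have sl : sqint (lc e c n) by exact: lc_sqint.
have := ip_ge0 mu (fun x => u x - lc e c n x).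
rewrite ipBl ?ipBr//; last exact: sqintB.
rewrite (ipC (lc e c n) u) ip_lcr// ip_lc_lc.
by rewrite -/c (eq_bigr (fun j => c j ^+ 2)) => [|j _]; [lra|rewrite expr2].
Qed.

(** Riesz-Fischer: the partial sums are Cauchy by [ip_lc_sub], and each coefficient of the limit is
    the limit of an eventually constant sequence. *)
Lemma exists_coords c M : (forall n, \sum_(0 <= j < n) c j ^+ 2 <= M) ->
  exists w, [/\ sqint w, forall j, ip w (e j) = c j, nlim (lc e c) w & ip w w <= M].
Proof.
move=> hM.
have sl n : sqint (lc e c n) by exact: lc_sqint.
have hC : forall ep, 0 < ep -> exists N, forall m n, (N <= m)%N -> (N <= n)%N ->
     nrm (fun x => lc e c m x - lc e c n x) < ep.
  move=> ep ep0.
  have [N hN] := summable_cauchy (fun j => sqr_ge0 (c j)) hM (exprn_gt0 2 ep0).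
  exists N => m n; wlog mn : m n / (m <= n)%N => [hw Nm Nn|Nm Nn].
    by have [/hw|/ltnW/hw] := leqP m n; rewrite nrm_subC; [rewrite nrm_subC|]; exact.
  rewrite nrm_subC -(@ltr_pXn2r _ 2)// ?nnegrE ?nrm_ge0 ?(ltW ep0)//.
  by rewrite ip_lc_sub// hN.
have [w sw hw] := riesz_fischer sl hC.
have wc j : ip w (e j) = c j.
  have h1 := nlim_ip sl sw (se j) hw.
  apply: (@cvg_unique _ (@Rhausdorff R) _ _ _ _ h1).
  apply: (@cvg_near_cst _ _ (c j)).
  by exists j.+1 => // n /= jn; rewrite ip_lc_e jn.
exists w; split=> //.
rewrite -nrm_sq.
have h1 := nlim_nrm sl sw hw.
have h2 : nrm (lc e c n) ^+ 2 @[n --> \oo] --> nrm w ^+ 2 by rewrite !expr2; exact: cvgM.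
rewrite -(cvg_lim _ h2)//; apply: limr_le; first by apply/cvg_ex; exists (nrm w ^+ 2).
near=> n; rewrite nrm_sq ip_lc_lc.
by rewrite (eq_bigr (fun j => c j ^+ 2)) => [//|j _]; rewrite expr2.
Unshelve. all: by end_near. Qed.

Hypothesis ec : forall u, sqint u -> (forall j, ip u (e j) = 0) -> nrm u = 0.

Lemma expansion u : sqint u -> nlim (lc e (fun j => ip u (e j))) u.
Proof.
move=> su.
have [w [sw wc hw _]] := exists_coords (fun n => bessel n su).
have h0 : nrm (fun x => w x - u x) = 0.
  by apply: ec => [|j]; [exact: sqintB|rewrite ipBl// wc subrr].
apply/nlimP => ep ep0; have /nlimP/(_ ep ep0)[N hN] := hw.
exists N => n Nn; apply: le_lt_trans (hN n Nn).
have sl := lc_sqint se (fun j => ip u (e j)) n.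
by apply: le_trans (nrm_tri sl sw su) _; rewrite h0 addr0.
Qed.

(** Norm bounds are later read off coefficients in this way. The function rebuilt from the
    coefficients of [u] differs from [u] by a function orthogonal to the whole family, hence of norm
    zero. *)
Lemma parseval_le u M : sqint u -> (forall n, \sum_(0 <= j < n) ip u (e j) ^+ 2 <= M) ->
  ip u u <= M.
Proof.
move=> su hM; have [w [sw wc hw wM]] := exists_coords hM.
have h0 : nrm (fun x => u x - w x) = 0.
  by apply: ec => [|j]; [exact: sqintB|rewrite ipBl// wc subrr].
have h1 : nrm u <= nrm w by apply: le_trans (nrm_le_sub su sw) _; rewrite h0 addr0.
apply: le_trans wM; rewrite -!nrm_sq lerXn2r// nnegrE; exact: nrm_ge0.
Qed.

(** Every term of the expanded product vanishes. This case of Parseval's identity serves to compare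
    two eigenbases. *)
Lemma ip_eq0_disjoint u v : sqint u -> sqint v ->
  (forall j, ip u (e j) = 0 \/ ip v (e j) = 0) -> ip u v = 0.
Proof.
move=> su sv h.
have h1 := nlim_ip (fun n => lc_sqint se _ n) su sv (expansion su).
apply: (@cvg_unique _ (@Rhausdorff R) _ _ _ _ h1).
apply: (@cvg_near_cst _ _ (0 : R)).
exists 0%N => // n _ /=; rewrite ip_lcl// big1// => j _.
by case: (h j) => [->|hv]; rewrite ?mul0r// (ipC _ v) hv mulr0.
Qed.

End orthonormal_basis.

(** * Test functions *)

Section smooth_functions.
Context {R : realType}.
Implicit Types (f g psi : R3 R -> R) (i : 'I_3).

Lemma Ck_continuous k f : Ck k f -> continuous f.
Proof. by case: k => [|k] []. Qed.

Lemma Ck_derivable k f i x : Ck k.+1 f -> derivable f x (basis3 i).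
Proof. by move=> [_ /(_ i)[]]. Qed.

Lemma Ck_partial k f i : Ck k.+1 f -> Ck k (partial i f).
Proof. by move=> [_ /(_ i)[]]. Qed.

Lemma CkW k f : Ck k.+1 f -> Ck k f.
Proof.
elim: k f => [|k ih] f hf; first by split => //; exact: Ck_continuous hf.
split; first exact: Ck_continuous hf.
move=> i; split; first by move=> x; exact: Ck_derivable hf.
by apply: ih; exact: Ck_partial hf.
Qed.

Lemma Ck_cst k (a : R) : Ck k (cst a : R3 R -> R).
Proof.
elim: k a => [|k ih] a; first by split => // x; exact: cvg_cst.
split; first by move=> x; exact: cvg_cst.
move=> i; split; first by move=> x; exact: derivable_cst.
rewrite (_ : partial i (cst a) = cst 0); first exact: ih.
by apply/funext => x; rewrite /partial derive_cst.
Qed.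

Lemma CkD k f g : Ck k f -> Ck k g -> Ck k (fun x => f x + g x).
Proof.
elim: k f g => [|k ih] f g hf hg.
  by split => // x; apply: cvgD; [exact: (Ck_continuous hf)|exact: (Ck_continuous hg)].
split; first by move=> x; apply: cvgD; [exact: (Ck_continuous hf)|exact: (Ck_continuous hg)].
move=> i; split.
  by move=> x; apply: derivableD; [exact: Ck_derivable hf|exact: Ck_derivable hg].
rewrite (_ : partial i _ = fun x => partial i f x + partial i g x).
  by apply: ih; [exact: Ck_partial hf|exact: Ck_partial hg].
apply/funext => x; rewrite /partial.
by rewrite -deriveD//; [exact: Ck_derivable hf|exact: Ck_derivable hg].
Qed.

Lemma CkM k f g : Ck k f -> Ck k g -> Ck k (fun x => f x * g x).
Proof.
elim: k f g => [|k ih] f g hf hg.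
  by split => // x; apply: cvgM; [exact: (Ck_continuous hf)|exact: (Ck_continuous hg)].
split; first by move=> x; apply: cvgM; [exact: (Ck_continuous hf)|exact: (Ck_continuous hg)].
move=> i; split.
  by move=> x; apply: derivableM; [exact: Ck_derivable hf|exact: Ck_derivable hg].
rewrite (_ : partial i _ = fun x => f x * partial i g x + g x * partial i f x).
  by apply: CkD; apply: ih; [exact: CkW|exact: Ck_partial hg|exact: CkW|exact: Ck_partial hf].
apply/funext => x; rewrite /partial.
by apply: deriveM; [exact: Ck_derivable hf|exact: Ck_derivable hg].
Qed.

Lemma CkV k f : (forall x, f x != 0) -> Ck k f -> Ck k (fun x => (f x)^-1).
Proof.
move=> f0; elim: k => [|k ih] hf.
  by split => // x; apply: cvgV => //; exact: (Ck_continuous hf).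
split; first by move=> x; apply: cvgV => //; exact: (Ck_continuous hf).
move=> i; split.
  by move=> x; apply: derivableV => //; exact: Ck_derivable hf.
have hV := ih (CkW hf).
rewrite (_ : partial i _ = fun x => (-1 * ((f x)^-1 * (f x)^-1)) * partial i f x).
  apply: CkM; last exact: Ck_partial hf.
  by apply: CkM; [exact: Ck_cst|exact: CkM].
apply/funext => x; rewrite /partial.
rewrite deriveV//; last exact: Ck_derivable hf.
by rewrite /GRing.scale/= mulN1r expr2 invfM.
Qed.

Lemma smooth_continuous f : smooth f -> continuous f.
Proof. by move=> h; exact: (Ck_continuous (h 0%N)). Qed.

Lemma smooth_derivable f i x : smooth f -> derivable f x (basis3 i).
Proof. by move=> h; exact: (@Ck_derivable 0%N f i x (h 1%N)). Qed.

Lemma smooth_partial f i : smooth f -> smooth (partial i f).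
Proof. by move=> h k; exact: (Ck_partial i (h k.+1)). Qed.

Lemma continuous3_measurable f : continuous f -> measurable_fun setT f.
Proof.
move=> cf.
apply: (measurability _ (RGenOInfty.measurableE R)).
move=> _ [_ [a ->] <-]; rewrite setTI; apply: open_measurable3.
apply: open_comp; first by move=> x _; exact: cf.
by rewrite set_itvoy; exact: open_gt.
Qed.

Lemma partial_near0 f i x : (\forall y \near x, f y = 0) -> partial i f x = 0.
Proof.
move=> hf; rewrite /partial (@near_eq_derive _ _ _ f (cst 0))//.
by rewrite derive_cst.
Qed.

Lemma closure_support_near0 f x : ~ closure [set x | f x != 0] x ->
  \forall y \near x, f y = 0.
Proof.
move=> /(@existsNP _ _)[B] /not_implyP[nB hB].
move: nB; apply: filterS => y By; apply/eqP/negPn/negP => fy; apply: hB.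
by exists y.
Qed.

Variable Omega : smooth_bounded_domain R.

Lemma test_smooth psi : test_function Omega psi -> smooth psi. Proof. by case. Qed.

Lemma partial_support psi i x : partial i psi x != 0 ->
  closure [set x | psi x != 0] x.
Proof.
move=> px; apply: contrapT => /closure_support_near0/(partial_near0 i)/eqP.
by rewrite (negbTE px).
Qed.

Lemma test_partial psi i : test_function Omega psi -> test_function Omega (partial i psi).
Proof.
move=> [sp cp hp].
have sub : closure [set x | partial i psi x != 0] `<=` closure [set x | psi x != 0].
  rewrite ((closure_id _).1 (@closed_closure _ [set x | psi x != 0])).
  by apply: closureS => x; exact: partial_support.
split; first exact: smooth_partial.
  by apply: subclosed_compact cp sub; exact: closed_closure.
exact: subset_trans sub hp.
Qed.

Lemma test_le psi f : smooth f -> (forall x, psi x = 0 -> f x = 0) ->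
  test_function Omega psi -> test_function Omega f.
Proof.
move=> sf h [sp cp hp].
have sub : closure [set x | f x != 0] `<=` closure [set x | psi x != 0].
  by apply: closureS => x /= px; apply: contra_neq px; exact: h.
split => //; first by apply: subclosed_compact cp sub; exact: closed_closure.
exact: subset_trans sub hp.
Qed.

Lemma test_bounded psi : test_function Omega psi -> exists2 M, 0 <= M & forall x, `|psi x| <= M.
Proof.
move=> [sp cp hp].
have /compact_bounded[M [_ hM]] : compact (psi @` closure [set x | psi x != 0]).
  apply: continuous_compact => //.
  by apply: continuous_subspaceT => x; exact: smooth_continuous.
exists (`|M| + 1); first by rewrite addr_ge0.
move=> x; have [->|px] := eqVneq (psi x) 0; first by rewrite normr0 addr_ge0.
apply: hM; first by rewrite (le_lt_trans (ler_norm M))// ltrDl.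
by exists x => //; apply: subset_closure.
Qed.

Lemma test_support_bounded psi : test_function Omega psi ->
  exists2 B, 0 < B & forall x, closure [set x | psi x != 0] x ->
    [/\ `|x.1.1| < B, `|x.1.2| < B & `|x.2| < B].
Proof.
move=> [sp cp hp].
have /compact_bounded[M [_ hM]] := cp.
exists (`|M| + 2); first by rewrite ltr_wpDl.
move=> x px.
have : `|x| <= `|M| + 1.
  by apply: hM => //; rewrite (le_lt_trans (ler_norm M))// ltrDl.
have h : `|M| + 1 < `|M| + 2 by rewrite ltrD2l ltr1n.
rewrite [`|x|]prod_normE /= ge_max => /andP[]; rewrite prod_normE ge_max => /andP[h1 h2] h3.
by split; apply: le_lt_trans h.
Qed.

Local Notation mu := (lebesgue_on Omega).

(** The domain lies in a cube. Finite measure makes constants square integrable, as the term [phi 0]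
    requires. *)
Lemma domain_measure_fin : (mu setT < +oo)%E.
Proof.
have [M [_ hM]] := domain_bounded Omega.
pose B := `|M| + 2; pose I := `[- B, B]%classic : set R.
have sub : Omega `<=` ((I `*` I) `*` I : set (R3 R)).
  move=> x Ox; have h : `|x| <= B.
    by apply: hM => //; rewrite /B (le_lt_trans (ler_norm M))// ltrDl.
  move: h; rewrite [`|x|]prod_normE /= ge_max => /andP[]; rewrite prod_normE ge_max.
  move=> /andP[h1 h2] h3; rewrite /I /= !in_itv/=.
  by split; [split|]; rewrite -ler_norml.
have mI : measurable (I : set (measurableTypeR R)) by exact: measurable_itv.
have mb : measurable ((I `*` I) `*` I : set (R3 R)).
  by apply: measurableX => //; exact: measurableX.
rewrite /lebesgue_on /= /mrestr setTI.
apply: (@le_lt_trans _ _ (lebesgue3 ((I `*` I) `*` I))).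
  by apply: le_measure; rewrite ?inE//; apply: open_measurable3; exact: domain_open.
have -> : lebesgue3 ((I `*` I) `*` I) =
    ((lebesgue_measure I * lebesgue_measure I) * lebesgue_measure I)%E.
  rewrite -(@product_measure1E _ _ _ _ R lebesgue_measure lebesgue_measure I I mI mI).
  by apply: product_measure1E => //; exact: measurableX.
have hI : (lebesgue_measure I < +oo :> \bar R)%E.
  by rewrite lebesgue_measure_itv; case: ifP => _; rewrite ltry.
have hIf : lebesgue_measure I \is a @fin_num R by rewrite ge0_fin_numE.
by rewrite ltey_eq !fin_numM.
Qed.

Lemma bounded_ig f M : measurable_fun setT f -> (forall x, `|f x| <= M) -> ig mu f.
Proof.
move=> mf hM; apply: measurable_bounded_integrable => //.
  exact: domain_measure_fin.
exists M; split; first exact: num_real.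
by move=> N MN x _ /=; rewrite (le_trans (hM x))// ltW.
Qed.

Lemma test_measurable psi : test_function Omega psi -> measurable_fun setT psi.
Proof. by move=> /test_smooth/smooth_continuous; exact: continuous3_measurable. Qed.

Lemma test_sqint psi : test_function Omega psi -> sqint mu psi.
Proof.
move=> h; split; first exact: test_measurable.
have [M M0 hM] := test_bounded h.
apply: (@bounded_ig _ (M ^+ 2)); first by apply: measurable_funX; exact: test_measurable.
by move=> x; rewrite normrX lerXn2r// nnegrE.
Qed.

Lemma test_ig_pow psi n : test_function Omega psi -> ig mu (fun x => psi x ^+ n).
Proof.
move=> h; have [M M0 hM] := test_bounded h.
apply: (@bounded_ig _ (M ^+ n)); first by apply: measurable_funX; exact: test_measurable.
by move=> x; rewrite normrX lerXn2r// nnegrE.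
Qed.

(* Truncations of [s ^+ 3] and [s ^+ 4]: for [dl > 0] the derivative [dPsiF] is
   bounded, so [PsiF dl] acts on [H^1], and [dHF ^+ 2 <= 16 * HF * dPsiF]. *)
Definition PsiF (dl s : R) := s ^+ 3 / (1 + dl * s ^+ 2).
Definition HF (dl s : R) := s ^+ 4 / (1 + dl * s ^+ 2).
Definition dPsiF (dl s : R) := s ^+ 2 * (3 + dl * s ^+ 2) / (1 + dl * s ^+ 2) ^+ 2.
Definition dHF (dl s : R) := s ^+ 3 * (4 + 2 * dl * s ^+ 2) / (1 + dl * s ^+ 2) ^+ 2.

Variables (dl : R).
Hypothesis dl0 : 0 <= dl.

Let den_gt0 (s : R) : 0 < 1 + dl * s ^+ 2.
Proof. by rewrite ltr_pwDl// mulr_ge0 ?sqr_ge0. Qed.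

Let den_neq0 (s : R) : 1 + dl * s ^+ 2 != 0.
Proof. by rewrite gt_eqF. Qed.

Lemma Ck_X k n f : Ck k f -> Ck k (fun x => f x ^+ n).
Proof.
move=> hf; elim: n => [|n ih].
  by rewrite (_ : (fun x => _) = cst 1)//; exact: Ck_cst.
rewrite (_ : (fun x => _) = fun x => f x * f x ^+ n); first exact: CkM.
by apply/funext => x; rewrite exprS.
Qed.

Lemma smooth_Psi f : smooth f -> smooth (fun x => PsiF dl (f x)).
Proof.
move=> sf k; rewrite /PsiF; apply: CkM; first exact: Ck_X.
apply: CkV => //; apply: CkD; first exact: Ck_cst.
by apply: CkM; [exact: Ck_cst|exact: Ck_X].
Qed.

Lemma smooth_H f : smooth f -> smooth (fun x => HF dl (f x)).
Proof.
move=> sf k; rewrite /HF; apply: CkM; first exact: Ck_X.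
apply: CkV => //; apply: CkD; first exact: Ck_cst.
by apply: CkM; [exact: Ck_cst|exact: Ck_X].
Qed.

Lemma smooth_dH f : smooth f -> smooth (fun x => dHF dl (f x)).
Proof.
move=> sf k; rewrite /dHF.
have sq : Ck k (fun x => f x ^+ 2) by exact: Ck_X.
apply: CkM.
  apply: CkM; first exact: Ck_X.
  by apply: CkD; [exact: Ck_cst|apply: CkM => //; exact: Ck_cst].
apply: CkV; first by move=> x; rewrite expf_neq0.
apply: Ck_X; apply: CkD; first exact: Ck_cst.
by apply: CkM => //; exact: Ck_cst.
Qed.

Lemma smooth_dPsi f : smooth f -> smooth (fun x => dPsiF dl (f x)).
Proof.
move=> sf k; rewrite /dPsiF.
have sq : Ck k (fun x => f x ^+ 2) by exact: Ck_X.
apply: CkM.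
  apply: CkM; first exact: Ck_X.
  by apply: CkD; [exact: Ck_cst|apply: CkM => //; exact: Ck_cst].
apply: CkV; first by move=> x; rewrite expf_neq0.
apply: Ck_X; apply: CkD; first exact: Ck_cst.
by apply: CkM => //; exact: Ck_cst.
Qed.

Lemma HF_ge0 s : 0 <= HF dl s.
Proof. by apply: divr_ge0; [exact: exprn_even_ge0|exact: ltW]. Qed.

Lemma dPsiF_ge0 s : 0 <= dPsiF dl s.
Proof.
apply: divr_ge0; last by rewrite exprn_ge0// ltW.
by rewrite mulr_ge0 ?sqr_ge0// addr_ge0// mulr_ge0 ?sqr_ge0.
Qed.

(** In terms of [x = dl * s ^+ 2] the two sides differ by a nonnegative multiple of [16 * (3 + x) *
    (1 + x) - (4 + 2 * x) ^+ 2], which expands with positive coefficients. The constant 16 is the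
    one that [sobolev_test_comp] asks for. *)
Lemma dHF_sq_le s : dHF dl s ^+ 2 <= 16 * HF dl s * dPsiF dl s.
Proof.
have q0 := den_gt0 s; have qn := den_neq0 s.
set x := dl * s ^+ 2 in q0 qn.
have x0 : 0 <= x by rewrite mulr_ge0 ?sqr_ge0.
have -> : 16 * HF dl s * dPsiF dl s =
   dHF dl s ^+ 2 + s ^+ 6 * ((16 * (3 + x) * (1 + x)) - (4 + 2 * x) ^+ 2) / (1 + x) ^+ 4.
  by rewrite /HF /dPsiF /dHF; rewrite /x in qn *; field.
rewrite lerDl divr_ge0//; last by rewrite exprn_ge0// ltW.
rewrite mulr_ge0//; first exact: exprn_even_ge0.
by rewrite subr_ge0; nra.
Qed.

(** With [x = dl * s ^+ 2] this is [x * (3 + x) <= 3 * (1 + x) ^+ 2]. The bound degenerates as [dl]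
    tends to 0, which is the origin of the quotient [h ^+ 2 / dl] in [L12_step]. *)
Lemma dPsiF_le s : 0 < dl -> dPsiF dl s <= 3 / dl.
Proof.
move=> d0; rewrite ler_pdivlMr// /dPsiF mulrAC ler_pdivrMr ?exprn_gt0//.
have := mulr_ge0 dl0 (sqr_ge0 s); set x := dl * s ^+ 2 => x0.
rewrite (_ : _ * dl = x * (3 + x)); last by rewrite /x; ring.
by nra.
Qed.

Lemma test_Psi psi : test_function Omega psi -> test_function Omega (fun x => PsiF dl (psi x)).
Proof.
move=> h; apply: test_le (h); first exact/smooth_Psi/(test_smooth h).
by move=> x ->; rewrite /PsiF expr0n mul0r.
Qed.

Lemma test_H psi : test_function Omega psi -> test_function Omega (fun x => HF dl (psi x)).
Proof.
move=> h; apply: test_le (h); first exact/smooth_H/(test_smooth h).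
by move=> x ->; rewrite /HF expr0n mul0r.
Qed.

(** The exponent is left general so that [PsiF] and [HF] are the cases [m = 2] and [m = 3]. *)
Lemma is_derive_ratio (m : nat) f (x v : R3 R) (df : R) : is_derive x v f df ->
  is_derive x v (fun y => f y ^+ m.+1 / (1 + dl * f y ^+ 2))
   ((m.+1%:R * f x ^+ m / (1 + dl * f x ^+ 2)
     - f x ^+ m.+1 * (2 * dl * f x) / (1 + dl * f x ^+ 2) ^+ 2) * df).
Proof.
move=> hf.
have h1 : is_derive x v (fun y => f y ^+ m.+1) ((m.+1%:R * f x ^+ m) *: df).
  by have := is_deriveX m.+1 hf; rewrite exprfctE.
have h2 : is_derive x v (fun y => 1 + dl * f y ^+ 2) (dl * (2 * f x * df)).
  have := is_deriveD (is_derive_cst (1 : R) x v) (is_deriveZ dl (is_deriveX 2 hf)).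
  by rewrite add0r expr1 /GRing.scale /=; apply.
have h3 : is_derive x v (fun y => (1 + dl * f y ^+ 2)^-1)
   (- (1 + dl * f x ^+ 2) ^- 2 * (dl * (2 * f x * df))).
  apply: DeriveDef; first by apply: derivableV => //; exact: ex_derive.
  by rewrite deriveV// derive_val.
have h4 := is_deriveM h1 h3.
apply: (is_derive_eq h4).
rewrite /GRing.scale/=; set q := 1 + _.
have q0 : q != 0 by exact: den_neq0.
by field.
Qed.

Lemma is_derive_Psi f (x v : R3 R) (df : R) : is_derive x v f df ->
  is_derive x v (fun y => PsiF dl (f y)) (dPsiF dl (f x) * df).
Proof.
move=> hf; apply: (is_derive_eq (is_derive_ratio 2 hf)); congr (_ * _).
have q0 := den_neq0 (f x).
by rewrite /dPsiF; field.
Qed.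

Lemma is_derive_H f (x v : R3 R) (df : R) : is_derive x v f df ->
  is_derive x v (fun y => HF dl (f y)) (dHF dl (f x) * df).
Proof.
move=> hf; apply: (is_derive_eq (is_derive_ratio 3 hf)); congr (_ * _).
have q0 := den_neq0 (f x).
by rewrite /dHF; field.
Qed.

Lemma partial_Psi psi i x : test_function Omega psi ->
  partial i (fun y => PsiF dl (psi y)) x = dPsiF dl (psi x) * partial i psi x.
Proof.
move=> h; have hd : is_derive x (basis3 i) psi (partial i psi x).
  by apply: DeriveDef => //; exact: smooth_derivable (test_smooth h).
by have := is_derive_Psi hd => hP; rewrite /partial derive_val.
Qed.

End smooth_functions.

(** * The Sobolev inequality *)

Section bounded_support.
Context d (T : measurableType d) (R : realType).
Implicit Types (K : set T) (f g : T -> R).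

(** A class closed under products, square roots and, for nonnegative members, partial integration.
    Over a set of finite measure its members are integrable, so iterated integrals can be handled as
    real numbers without separate finiteness conditions. *)
Definition bs K f := [/\ measurable_fun setT f, exists M, forall x, `|f x| <= M &
  forall x, ~ K x -> f x = 0].

Lemma bs_bound K f : bs K f -> exists2 M, 0 <= M & forall x, `|f x| <= M.
Proof.
move=> [_ [M hM] _]; exists `|M| => // x.
by apply: le_trans (hM x) _; exact: ler_norm.
Qed.

Lemma bsM K f g : bs K f -> bs K g -> bs K (fun x => f x * g x).
Proof.
move=> hf hg; have [M M0 hM] := bs_bound hf; have [N N0 hN] := bs_bound hg.
case: hf hg => [mf _ f0] [mg _ g0]; split; first exact: measurable_funM.
  by exists (M * N) => x; rewrite normrM ler_pM.
by move=> x Kx; rewrite f0// mul0r.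
Qed.

Lemma bs_comp K f (Th : R -> R) : continuous Th -> Th 0 = 0 ->
  (exists B, forall M s, 0 <= M -> `|s| <= M -> `|Th s| <= B M) ->
  bs K f -> bs K (fun x => Th (f x)).
Proof.
move=> cT T0 [B hB] hf; have [M M0 hM] := bs_bound hf.
case: hf => [mf _ f0]; split.
- by apply: (measurableT_comp _ mf); exact: continuous_measurable_fun.
- by exists (B M) => x; exact: hB.
- by move=> x Kx; rewrite f0.
Qed.

Lemma bs_abs K f : bs K f -> bs K (fun x => `|f x|).
Proof.
by apply: bs_comp; [exact: norm_continuous|exact: normr0|exists id => M s _; rewrite normr_id].
Qed.

Lemma bs_sqrt K f : bs K f -> bs K (fun x => Num.sqrt (f x)).
Proof.
apply: bs_comp; [exact: sqrt_continuous|exact: sqrtr0|].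
exists (fun M => Num.sqrt M) => M s M0 sM; rewrite ger0_norm ?sqrtr_ge0//.
by rewrite ler_sqrt// (le_trans (ler_norm s)).
Qed.

Variables (mu : {measure set T -> \bar R}) (K : set T).
Hypotheses (mK : measurable K) (fK : (mu K < +oo)%E).

Lemma bs_ig f : bs K f -> ig mu f.
Proof.
move=> [mf [M hM] f0].
have h : mu.-integrable K (EFin \o f).
  apply: measurable_bounded_integrable => //; first exact: measurable_funTS.
  exists M; split; first exact: num_real.
  by move=> N MN x _ /=; rewrite (le_trans (hM x))// ltW.
have := (integrable_mkcond (EFin \o f) mK).1 h.
apply: eq_integrable => // x _; rewrite patchE; case: ifPn => //.
by rewrite notin_setE => /f0 /= ->.
Qed.

Lemma bs_sqint f : bs K f -> sqint mu f.
Proof.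
move=> hf; split; first by case: hf.
by apply: eq_ig (bs_ig (bsM hf hf)) => x; rewrite expr2.
Qed.

Lemma bs_J_le f (M : R) : bs K f -> 0 <= M -> (forall x, `|f x| <= M) ->
  `|J mu f| <= M * fine (mu K).
Proof.
move=> hf M0 hM; have hi := bs_ig hf.
apply: le_trans (J_abs hi) _.
have hK : ig mu (fun x => M * \1_K x).
  apply: bs_ig; split.
  - by apply: measurable_funM => //; exact: measurable_indic.
  - exists M => x; rewrite indicE; case: (x \in K); first by rewrite mulr1 ger0_norm.
    by rewrite mulr0 normr0.
  - by move=> x Kx; rewrite indicE memNset// mulr0.
apply: le_trans (J_le (ig_abs hi) hK _) _.
  move=> x; rewrite indicE; have [xK|] := boolP (x \in K); first by rewrite mulr1.
  by rewrite notin_setE => Kx; rewrite mulr0; case: hf => _ _ ->//; rewrite normr0.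
have -> : J mu (fun x => M * \1_K x) = fine (M%:E * mu K)%E.
  rewrite /J /Rintegral; congr fine.
  under eq_integral do rewrite EFinM.
  rewrite ge0_integralZl//.
    by rewrite integral_indic// setIT.
  by apply/measurable_EFinP; exact: measurable_indic.
by rewrite fineM// ge0_fin_numE.
Qed.

End bounded_support.

Section tonelli.
Context d1 d2 (T1 : measurableType d1) (T2 : measurableType d2) (R : realType).
Variables (m1 : {sigma_finite_measure set T1 -> \bar R}).
Variables (m2 : {sigma_finite_measure set T2 -> \bar R}).
Variables (K1 : set T1) (K2 : set T2).
Hypotheses (mK1 : measurable K1) (fK1 : (m1 K1 < +oo)%E).
Hypotheses (mK2 : measurable K2) (fK2 : (m2 K2 < +oo)%E).

Lemma prodK_fin : ((m1 \x m2) (K1 `*` K2) < +oo)%E.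
Proof.
rewrite product_measure1E// ltey_eq fin_numM// ge0_fin_numE//.
Qed.

Variable f : T1 * T2 -> R.
Hypotheses (f0 : forall x, 0 <= f x) (bf : bs (K1 `*` K2) f).

Lemma bs_sec1 x : bs K2 (fun y => f (x, y)).
Proof.
case: bf => mf [M hM] fK; split; first exact: measurableT_comp.
  by exists M.
by move=> y Ky; apply: fK => -[].
Qed.

Lemma bs_sec2 y : bs K1 (fun x => f (x, y)).
Proof.
case: bf => mf [M hM] fK; split; first exact: measurableT_comp.
  by exists M.
by move=> x Kx; apply: fK => -[].
Qed.

(* Picked up by [//] in the side conditions of Fubini's theorem. *)
Let mfE : measurable_fun setT (fun z => (f z)%:E).
Proof. by apply/measurable_EFinP; case: bf. Qed.
Let f0E z : (0 <= (f z)%:E)%E. Proof. by rewrite lee_fin. Qed.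

Let F1 x : (\int[m2]_y (f (x, y))%:E)%E = (J m2 (fun y => f (x, y)))%:E.
Proof. by rewrite EFin_J//; apply: bs_ig (bs_sec1 x). Qed.

Let F2 y : (\int[m1]_x (f (x, y))%:E)%E = (J m1 (fun x => f (x, y)))%:E.
Proof. by rewrite EFin_J//; apply: bs_ig (bs_sec2 y). Qed.

(** Partial integration stays in the class, so that Tonelli's theorem can be iterated. *)
Lemma bs_J1 : bs K1 (fun x => J m2 (fun y => f (x, y))).
Proof.
split.
- apply/measurable_EFinP; rewrite (_ : EFin \o _ = fubini_F m2 (EFin \o f)).
    exact: measurable_fun_fubini_tonelli_F.
  by apply/funext => x; rewrite /= -F1.
- have [M M0 hM] := bs_bound bf; exists (M * fine (m2 K2)) => x.
  by apply: bs_J_le => //; exact: bs_sec1.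
- move=> x Kx; rewrite (@eq_J _ _ _ _ _ (fun=> 0)) ?J0// => y.
  by case: bf => _ _ ->// -[].
Qed.

Lemma bs_J2 : bs K2 (fun y => J m1 (fun x => f (x, y))).
Proof.
split.
- apply/measurable_EFinP; rewrite (_ : EFin \o _ = fubini_G m1 (EFin \o f)).
    exact: measurable_fun_fubini_tonelli_G.
  by apply/funext => x; rewrite /= -F2.
- have [M M0 hM] := bs_bound bf; exists (M * fine (m1 K1)) => x.
  by apply: bs_J_le => //; exact: bs_sec2.
- move=> y Ky; rewrite (@eq_J _ _ _ _ _ (fun=> 0)) ?J0// => x.
  by case: bf => _ _ ->// -[].
Qed.

Lemma J_prod : J (m1 \x m2)%E f = J m1 (fun x => J m2 (fun y => f (x, y))).
Proof.
apply: EFin_inj; rewrite -EFin_J; last first.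
  by apply: bs_ig bf; [exact: measurableX|exact: prodK_fin].
rewrite -EFin_J; last exact: bs_ig bs_J1.
rewrite (fubini_tonelli1 (EFin \o f))//.
by apply: eq_integral => x _; rewrite -F1.
Qed.

Lemma J_swap : J m1 (fun x => J m2 (fun y => f (x, y))) =
  J m2 (fun y => J m1 (fun x => f (x, y))).
Proof.
apply: EFin_inj; rewrite -EFin_J; last exact: bs_ig bs_J1.
rewrite -EFin_J; last exact: bs_ig bs_J2.
rewrite -(eq_integral _ _ (fun x _ => F1 x)) -(eq_integral _ _ (fun x _ => F2 x)).
exact: (fubini_tonelli (EFin \o f)).
Qed.

End tonelli.

Section loomis_whitney.
Context (R : realType).
Local Notation Rm := (measurableTypeR R).
Definition lam : {sigma_finite_measure set Rm -> \bar R} := @lebesgue_measure R.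

(* The library's sigma-finite instance for [\x] is shadowed by its
   subprobability instance, hence this named copy. *)
Definition lam2 : set (Rm * Rm)%type -> \bar R := (lam \x lam)%E.

HB.instance Definition _ := Measure.on lam2.

Implicit Types (a b c : Rm * Rm -> R).

Definition itvB (B : R) : set Rm := `[- B, B]%classic.

Lemma itvB_meas B : measurable (itvB B). Proof. exact: measurable_itv. Qed.

Lemma itvB_fin B : (lam (itvB B) < +oo)%E.
Proof.
by rewrite /itvB /lam /= lebesgue_measure_itv; case: ifP => _; rewrite ltry.
Qed.

Let mK := itvB_meas.
Let fK := itvB_fin.
Let mK2 B : measurable (itvB B `*` itvB B). Proof. exact: measurableX. Qed.
Let fK2 B : ((lam \x lam)%E (itvB B `*` itvB B) < +oo)%E.
Proof. exact: (prodK_fin (m1 := lam) (m2 := lam) (mK B) (fK B) (mK B) (fK B)). Qed.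

Let lam2_sigma_finite : sigma_finite setT lam2.
Proof.
exists (fun n => itvB n%:R `*` itvB n%:R); last by move=> n; split => //; exact: fK2.
apply/seteqP; split => // -[x y] _.
have m0 : 0 <= Num.max `|x| `|y| by rewrite le_max normr_ge0.
exists (Num.bound (Num.max `|x| `|y|)) => //=.
have := ltW (archi_boundP m0); rewrite ge_max => /andP[hx hy].
by split; rewrite /itvB /= in_itv/= -ler_norml.
Qed.

HB.instance Definition _ :=
  @Measure_isSigmaFinite.Build _ _ _ lam2 lam2_sigma_finite.

Lemma J_lebesgue3 (f : R3 R -> R) : J lebesgue3 f = J (lam2 \x lam)%E f.
Proof. by []. Qed.

Lemma box_meas B : measurable ((itvB B `*` itvB B) `*` itvB B).
Proof. exact: measurableX. Qed.

Lemma box_fin B : ((lam2 \x lam)%E ((itvB B `*` itvB B) `*` itvB B) < +oo)%E.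
Proof. exact: (prodK_fin (m1 := lam2) (m2 := lam) (mK2 B) (fK2 B) (mK B) (fK B)). Qed.

Lemma sqr_nrm_sqrt d (T : measurableType d) (mu : {measure set T -> \bar R})
    (f : T -> R) : (forall x, 0 <= f x) ->
  ip mu (fun x => Num.sqrt (f x)) (fun x => Num.sqrt (f x)) = J mu f.
Proof. by move=> f0; apply: eq_J => x; rewrite -expr2 sqr_sqrtr. Qed.

(** Cauchy-Schwarz in the last variable for fixed first two, where the factor with [c] is constant,
    then Cauchy-Schwarz in the first two variables. *)
Lemma loomis_whitney (B : R) a b c (h : R3 R -> R) :
  bs (itvB B `*` itvB B) a -> bs (itvB B `*` itvB B) b -> bs (itvB B `*` itvB B) c ->
  (forall p, 0 <= a p) -> (forall p, 0 <= b p) -> (forall p, 0 <= c p) ->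
  bs ((itvB B `*` itvB B) `*` itvB B) h -> (forall p, 0 <= h p) ->
  (forall x y z, h (x, y, z) <=
     Num.sqrt (a (y, z)) * Num.sqrt (b (x, z)) * Num.sqrt (c (x, y))) ->
  J lebesgue3 h <= Num.sqrt (J lam2 a) * Num.sqrt (J lam2 b) * Num.sqrt (J lam2 c).
Proof.
move=> ba bb bc a0 b0 c0 bh h0 hh.
have -> : J lebesgue3 h = J lam2 (fun p => J lam (fun z => h (p, z))).
  rewrite J_lebesgue3; exact: (J_prod (m1 := lam2) (m2 := lam) (mK2 B) (fK2 B) (mK B) (fK B) h0 bh).
pose al y := J lam (fun z => a (y, z)); pose be x := J lam (fun z => b (x, z)).
have al0 y : 0 <= al y by apply: J_ge0.
have be0 x : 0 <= be x by apply: J_ge0.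
have bal : bs (itvB B) al by apply: (bs_J1 (m2 := lam) (mK B) (fK B)).
have bbe : bs (itvB B) be by apply: (bs_J1 (m2 := lam) (mK B) (fK B)).
have step1 p : J lam (fun z => h (p, z)) <=
    Num.sqrt (c p) * Num.sqrt (al p.2 * be p.1).
  case: p => x y /=.
  have sa : sqint lam (fun z => Num.sqrt (a (y, z))).
    by apply: (bs_sqint (mK B) (fK B)); apply: bs_sqrt; exact: bs_sec1 ba y.
  have sb : sqint lam (fun z => Num.sqrt (b (x, z))).
    by apply: (bs_sqint (mK B) (fK B)); apply: bs_sqrt; exact: bs_sec1 bb x.
  apply: (@le_trans _ _ (Num.sqrt (c (x, y)) * ip lam (fun z => Num.sqrt (a (y, z)))
      (fun z => Num.sqrt (b (x, z))))); last first.
    apply: ler_wpM2l; first exact: sqrtr_ge0.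
    apply: le_trans (ip_le sa sb) _.
    by rewrite /nrm !sqr_nrm_sqrt// -sqrtrM ?J_ge0.
  rewrite -JZ; last exact: igM.
  apply: J_le; first by apply: (bs_ig (mK B) (fK B)); exact: (bs_sec1 bh (x, y)).
    by apply: igZ; exact: igM.
  by move=> z; rewrite mulrC; exact: hh.
have bab : bs (itvB B `*` itvB B) (fun p : Rm * Rm => al p.2 * be p.1).
  have [M M0 hM] := bs_bound bal; have [N N0 hN] := bs_bound bbe.
  case: bal bbe => [ma _ al'] [mb _ be']; split.
  - by apply: measurable_funM; apply: measurableT_comp.
  - by exists (M * N) => p; rewrite normrM ler_pM.
  - move=> [x y] /= /not_andP[hx|hy]; first by rewrite be'// mulr0.
    by rewrite al'// mul0r.
have ab0 p : 0 <= al p.2 * be p.1 by rewrite mulr_ge0.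
have sc : sqint lam2 (fun p => Num.sqrt (c p)).
  by apply: (bs_sqint (mK2 B) (fK2 B)); exact: bs_sqrt.
have sab : sqint lam2 (fun p => Num.sqrt (al p.2 * be p.1)).
  by apply: (bs_sqint (mK2 B) (fK2 B)); exact: bs_sqrt.
apply: (@le_trans _ _ (ip lam2 (fun p => Num.sqrt (c p)) (fun p => Num.sqrt (al p.2 * be p.1)))).
  apply: J_le => //; last exact: igM.
  apply: (bs_ig (mK2 B) (fK2 B)).
  exact: (bs_J1 (m2 := lam) (mK B) (fK B) h0 bh).
apply: le_trans (ip_le sc sab) _.
rewrite /nrm !sqr_nrm_sqrt// mulrC ler_wpM2r ?sqrtr_ge0// -sqrtrM; last exact: J_ge0.
(* [al] depends only on [y] and [be] only on [x], so the double integral factors. *)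
have -> : J lam2 (fun p : Rm * Rm => al p.2 * be p.1) = J lam2 a * J lam2 b; last by [].
rewrite (J_prod (m1 := lam) (m2 := lam) (mK B) (fK B) (mK B) (fK B) ab0 bab).
rewrite (J_prod (m1 := lam) (m2 := lam) (mK B) (fK B) (mK B) (fK B) a0 ba).
rewrite (J_prod (m1 := lam) (m2 := lam) (mK B) (fK B) (mK B) (fK B) b0 bb).
rewrite -JZ; last exact: (bs_ig (mK B) (fK B) bbe).
apply: eq_J => x /=.
by under eq_J do rewrite mulrC; rewrite JZ 1?mulrC//; exact: (bs_ig (mK B) (fK B) bal).
Qed.

(** Fundamental theorem of calculus from [- B], where [g] vanishes; the interval of integration is
    then enlarged to the whole line. *)
Lemma abs_le_J_derive (g dg : R -> R) (B : R) :
  (forall s : R, is_derive s (1 : R) g (dg s)) -> continuous dg ->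
  (forall s, B <= `|s| -> g s = 0) -> bs (itvB B) dg ->
  forall s, `|g s| <= J lam (fun r => `|dg r|).
Proof.
move=> hd cd g0 bd s.
have [sB|sB] := leP B `|s|; first by rewrite g0// normr0; apply: J_ge0.
have [Bs sB'] : - B < s /\ s < B by move: sB; rewrite ltr_norml => /andP[].
have B0 : 0 <= B by apply: le_trans (ltW sB).
have gB : g (- B) = 0 by apply: g0; rewrite normrN ger0_norm.
have cg : continuous g.
  by move=> t; apply/differentiable_continuous/derivable1_diffP; case: (hd t).
pose I : set Rm := `[- B, s]%classic.
have mI : measurable I by exact: measurable_itv.
have ftc : (\int[lebesgue_measure]_(r in I) (dg r)%:E)%E = ((g s)%:E - (g (- B))%:E)%E.
  apply: continuous_FTC2 => //.
  - by apply: continuous_subspaceT => t; exact: cd.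
  - split.
    + by move=> t _; case: (hd t).
    + by apply: cvg_at_right_filter; exact: cg.
    + by apply: cvg_at_left_filter; exact: cg.
  - by move=> t _; rewrite derive1E; case: (hd t).
rewrite -lee_fin -EFin_J; last by apply: (bs_ig (mK B) (fK B)); exact: bs_abs.
have mdg : measurable_fun setT (fun r : Rm => (dg r)%:E).
  by apply/measurable_EFinP; case: bd.
have -> : (`|g s|)%:E = `|(\int[lam]_(r in I) (dg r)%:E)|%E.
  by rewrite [(\int[_]_(r in _) _)%E]ftc gB sube0.
apply: le_trans (le_abse_integral _ _ _) _ => //; first exact: measurable_funTS.
apply: (@le_trans _ _ (\int[lam]_(r in setT) `|(dg r)%:E|)%E) => //.
by apply: ge0_subset_integral => //; exact: measurableT_comp.
Qed.

Lemma permute_bs (B : R) (f : R3 R -> R) (m : R3 R -> R3 R) :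
  measurable_fun setT m ->
  (forall p, ((itvB B `*` itvB B) `*` itvB B) (m p) -> ((itvB B `*` itvB B) `*` itvB B) p) ->
  bs ((itvB B `*` itvB B) `*` itvB B) f -> bs ((itvB B `*` itvB B) `*` itvB B) (f \o m).
Proof.
move=> mm hm [mf [M hM] f0]; split; first exact: measurableT_comp.
  by exists M => x /=.
by move=> x Kx /=; apply: f0 => /hm.
Qed.

(** Two exchanges of variables move the first coordinate to the innermost integral. Composition with
    the permutation [m] puts it in last place, the form that the lemmas on sections accept. *)
Lemma J_first (B : R) (f : R3 R -> R) : (forall p, 0 <= f p) ->
  bs ((itvB B `*` itvB B) `*` itvB B) f ->
  bs (itvB B `*` itvB B) (fun p : Rm * Rm => J lam (fun s => f (s, p.1, p.2))) /\
  J lam2 (fun p : Rm * Rm => J lam (fun s => f (s, p.1, p.2))) = J lebesgue3 f.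
Proof.
move=> f0 bf.
pose m (p : R3 R) : R3 R := ((p.2, p.1.1), p.1.2).
have mm : measurable_fun setT m.
  apply: measurable_fun_pair; last exact: measurableT_comp.
  by apply: measurable_fun_pair => //; exact: measurableT_comp.
have bm : bs ((itvB B `*` itvB B) `*` itvB B) (f \o m).
  by apply: permute_bs => // -[[x y] z] /= [[]].
have fm0 p : 0 <= (f \o m) p by exact: f0.
have b1 := bs_J1 (m2 := lam) (mK B) (fK B) fm0 bm.
split; first by exact: b1.
rewrite [LHS](J_prod (m1 := lam) (m2 := lam) (mK B) (fK B) (mK B) (fK B) _ b1); last first.
  by move=> p; apply: J_ge0.
rewrite J_lebesgue3 (J_prod (m1 := lam2) (m2 := lam) (mK2 B) (fK2 B) (mK B) (fK B) f0 bf).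
have b2 := bs_J1 (m2 := lam) (mK B) (fK B) f0 bf.
have p2 p : 0 <= J lam (fun y => f (p, y)) by apply: J_ge0.
rewrite [RHS](J_prod (m1 := lam) (m2 := lam) (mK B) (fK B) (mK B) (fK B) p2 b2).
rewrite [RHS](J_swap (m1 := lam) (m2 := lam) (mK B) (fK B) (mK B) (fK B) p2 b2).
apply: eq_J => y.
have b3 : bs (itvB B `*` itvB B) (fun q : Rm * Rm => f (q.2, y, q.1)).
  case: bf => mf [M hM] fK'; split.
  - apply: (measurableT_comp mf); apply: measurable_fun_pair => //.
    exact: measurable_fun_pair.
  - by exists M.
  - by move=> [z s] /= hq; apply: fK' => -[[/= hs hy] hz]; apply: hq.
exact: (J_swap (m1 := lam) (m2 := lam) (mK B) (fK B) (mK B) (fK B) _ b3).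
Qed.

Lemma J_second (B : R) (f : R3 R -> R) : (forall p, 0 <= f p) ->
  bs ((itvB B `*` itvB B) `*` itvB B) f ->
  bs (itvB B `*` itvB B) (fun p : Rm * Rm => J lam (fun s => f (p.1, s, p.2))) /\
  J lam2 (fun p : Rm * Rm => J lam (fun s => f (p.1, s, p.2))) = J lebesgue3 f.
Proof.
move=> f0 bf.
pose m (p : R3 R) : R3 R := ((p.1.1, p.2), p.1.2).
have mm : measurable_fun setT m.
  apply: measurable_fun_pair; last exact: measurableT_comp.
  by apply: measurable_fun_pair => //; exact: measurableT_comp.
have bm : bs ((itvB B `*` itvB B) `*` itvB B) (f \o m).
  by apply: permute_bs => // -[[x y] z] /= [[]].
have fm0 p : 0 <= (f \o m) p by exact: f0.
have b1 := bs_J1 (m2 := lam) (mK B) (fK B) fm0 bm.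
split; first by exact: b1.
rewrite [LHS](J_prod (m1 := lam) (m2 := lam) (mK B) (fK B) (mK B) (fK B) _ b1); last first.
  by move=> p; apply: J_ge0.
rewrite J_lebesgue3 (J_prod (m1 := lam2) (m2 := lam) (mK2 B) (fK2 B) (mK B) (fK B) f0 bf).
have b2 := bs_J1 (m2 := lam) (mK B) (fK B) f0 bf.
have p2 p : 0 <= J lam (fun y => f (p, y)) by apply: J_ge0.
rewrite [RHS](J_prod (m1 := lam) (m2 := lam) (mK B) (fK B) (mK B) (fK B) p2 b2).
apply: eq_J => x.
have b3 : bs (itvB B `*` itvB B) (fun q : Rm * Rm => f (x, q.2, q.1)).
  case: bf => mf [M hM] fK'; split.
  - apply: (measurableT_comp mf); apply: measurable_fun_pair => //.
    exact: measurable_fun_pair.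
  - by exists M.
  - by move=> [z s] /= hq; apply: fK' => -[[/= hs hy] hz]; apply: hq.
exact: (J_swap (m1 := lam) (m2 := lam) (mK B) (fK B) (mK B) (fK B) _ b3).
Qed.

Lemma J_third (B : R) (f : R3 R -> R) : (forall p, 0 <= f p) ->
  bs ((itvB B `*` itvB B) `*` itvB B) f ->
  bs (itvB B `*` itvB B) (fun p : Rm * Rm => J lam (fun s => f (p, s))) /\
  J lam2 (fun p : Rm * Rm => J lam (fun s => f (p, s))) = J lebesgue3 f.
Proof.
move=> f0 bf; split; first exact: (bs_J1 (m2 := lam) (mK B) (fK B) f0 bf).
by rewrite J_lebesgue3 (J_prod (m1 := lam2) (m2 := lam) (mK2 B) (fK2 B) (mK B) (fK B) f0 bf).
Qed.

End loomis_whitney.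

Lemma continuous_pair_for (U V W : topologicalType) (f : U -> V) (g : U -> W) (s : U) :
  {for s, continuous f} -> {for s, continuous g} ->
  {for s, continuous (fun r => (f r, g r))}.
Proof. by rewrite /prop_for /continuous_at => cf cg; exact: cvg_pair. Qed.

Section sobolev.
Context (R : realType).
Local Notation Rm := (measurableTypeR R).
Local Notation lam := (lam R).
Local Notation lam2 := (lam2 R).
Local Notation box B := ((itvB B `*` itvB B) `*` itvB B).

(** [partial] is a directional derivative in the product space; along a coordinate line its
    difference quotients are those of the restriction to one variable. *)
Lemma is_derive_line (F : R3 R -> R) (p v : R3 R) (l : R -> R3 R) (s d : R) :
  (forall h, l (h + s) = h *: v + p) -> is_derive p v F d ->
  is_derive s (1 : R) (fun r => F (l r)) d.
Proof.
move=> hl [hd hD].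
have E : (fun h : R => h^-1 *: ((fun r => F (l r)) (h *: (1 : R) + s) - (fun r => F (l r)) s))
    = (fun h : R => h^-1 *: (F (h *: v + p) - F p)).
  apply/funext => h; rewrite /= [h *: 1]mulr1 hl.
  by have := hl 0; rewrite add0r scale0r add0r => ->.
by split; [move: hd|move: hD]; rewrite /derivable /derive /= -E.
Qed.

Lemma vanish_bs (B : R) (g : R3 R -> R) : continuous g -> (exists M, forall x, `|g x| <= M) ->
  (forall x, g x != 0 -> [/\ `|x.1.1| < B, `|x.1.2| < B & `|x.2| < B]) ->
  bs (box B) g.
Proof.
move=> cg hM g0; split => //; first exact: continuous3_measurable.
move=> x Kx; apply/eqP/negPn/negP => /g0[h1 h2 h3]; apply: Kx.
by split; [split|]; rewrite /itvB /= in_itv/= -ler_norml ltW.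
Qed.

(** The embedding of W^{1,1} into L^{3/2}. [F] is bounded by the integral of each [|D i|] along its
    own axis, so [h ^+ 3] is at most a product of three square roots, each free of one variable, as
    Loomis-Whitney requires. *)
Lemma gagliardo_nirenberg (F : R3 R -> R) (D : 'I_3 -> R3 R -> R) (h : R3 R -> R) (B : R) :
  continuous F -> (forall i, continuous (D i)) ->
  (forall i x, is_derive x (basis3 i) F (D i x)) ->
  (forall x, F x != 0 -> [/\ `|x.1.1| < B, `|x.1.2| < B & `|x.2| < B]) ->
  (forall i, bs (box B) (D i)) -> bs (box B) h -> (forall x, 0 <= h x) ->
  (forall x, h x ^+ 2 <= `|F x|) ->
  J lebesgue3 (fun x => h x ^+ 3) <=
  \prod_(i < 3) Num.sqrt (J lebesgue3 (fun x => `|D i x|)).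
Proof.
move=> cF cD hD F0 bD bh h0 hF.
have bA i : bs (box B) (fun x => `|D i x|) by exact: bs_abs.
have [b0 e0] := J_first (fun p => normr_ge0 (D 0 p)) (bA 0).
have [b1 e1] := J_second (fun p => normr_ge0 (D 1 p)) (bA 1).
have [b2 e2] := J_third (fun p => normr_ge0 (D 2 p)) (bA 2).
rewrite 3!big_ord_recl big_ord0 mulr1 mulrA.
rewrite (_ : ord0 = 0)// (_ : lift 0 0 = 1)//; last exact: val_inj.
rewrite (_ : lift 0 _ = 2)//; last exact: val_inj.
rewrite -e0 -e1 -e2.
apply: (@loomis_whitney _ B) => //.
- by move=> p; apply: J_ge0.
- by move=> p; apply: J_ge0.
- by move=> p; apply: J_ge0.
- by have := bsM bh (bsM bh bh); congr (bs _ _).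
- by move=> x; rewrite exprn_ge0.
move=> x y z /=.
have Fz (u v w : R) : B <= `|u| \/ B <= `|v| \/ B <= `|w| -> F (u, v, w) = 0.
  move=> hB; apply/eqP/negPn/negP => /F0[/= h1 h2 h3].
  by move: hB; rewrite !leNgt h1 h2 h3 => -[|[]].
have k0 : `|F (x, y, z)| <= J lam (fun s => `|D 0 (s, y, z)|).
  apply: (@abs_le_J_derive _ (fun s => F (s, y, z)) (fun s => D 0 (s, y, z)) B).
  - move=> s; apply: (@is_derive_line F (s, y, z) (basis3 0) (fun r => (r, y, z))) => // t.
    rewrite /basis3 /=; congr (_, _, _); rewrite /GRing.scale /=.
    + by rewrite [t *: _]mulr1.
    + by rewrite [t *: _]mulr0 add0r.
    + by rewrite [t *: _]mulr0 add0r.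
  - move=> s; apply: (@continuous_comp _ _ _ (fun r : R => (r, y, z) : R3 R)); last exact: cD.
    by do 2?[apply: continuous_pair_for]; do ?[exact: cvg_cst|exact: cvg_id].
  - by move=> s sB; apply: Fz; left.
  - exact: (bs_sec2 (bs_sec2 (bD 0) z) y).
have k1 : `|F (x, y, z)| <= J lam (fun s => `|D 1 (x, s, z)|).
  apply: (@abs_le_J_derive _ (fun s => F (x, s, z)) (fun s => D 1 (x, s, z)) B).
  - move=> s; apply: (@is_derive_line F (x, s, z) (basis3 1) (fun r => (x, r, z))) => // t.
    rewrite /basis3 /=; congr (_, _, _); rewrite /GRing.scale /=.
    + by rewrite [t *: _]mulr0 add0r.
    + by rewrite [t *: _]mulr1.
    + by rewrite [t *: _]mulr0 add0r.
  - move=> s; apply: (@continuous_comp _ _ _ (fun r : R => (x, r, z) : R3 R)); last exact: cD.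
    by do 2?[apply: continuous_pair_for]; do ?[exact: cvg_cst|exact: cvg_id].
  - by move=> s sB; apply: Fz; right; left.
  - exact: (bs_sec1 (bs_sec2 (bD 1) z) x).
have k2 : `|F (x, y, z)| <= J lam (fun s => `|D 2 (x, y, s)|).
  apply: (@abs_le_J_derive _ (fun s => F (x, y, s)) (fun s => D 2 (x, y, s)) B).
  - move=> s; apply: (@is_derive_line F (x, y, s) (basis3 2) (fun r => (x, y, r))) => // t.
    rewrite /basis3 /=; congr (_, _, _); rewrite /GRing.scale /=.
    + by rewrite [t *: _]mulr0 add0r.
    + by rewrite [t *: _]mulr0 add0r.
    + by rewrite [t *: _]mulr1.
  - move=> s; apply: (@continuous_comp _ _ _ (fun r : R => (x, y, r) : R3 R)); last exact: cD.
    by do 2?[apply: continuous_pair_for]; do ?[exact: cvg_cst|exact: cvg_id].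
  - by move=> s sB; apply: Fz; right; right.
  - exact: (bs_sec1 (bD 2) (x, y)).
have hle i (A : R) : `|F (x, y, z)| <= A -> h (x, y, z) <= Num.sqrt A.
  move=> hA; rewrite -(ger0_norm (h0 (x, y, z))) -sqrtr_sqr ler_sqrt.
    exact: le_trans (hF _) hA.
  exact: le_trans (normr_ge0 _) hA.
rewrite exprSr expr2; apply: ler_pM => //; last exact: hle k2.
  by rewrite mulr_ge0.
by apply: ler_pM => //; [exact: hle k0|exact: hle k1].
Qed.

(** With [X] the integral of [h ^+ 3] and [E] the sum on the right, Cauchy-Schwarz bounds each
    integral of [|D i|] by 8 times the root of [X * E]. Hence [X] is at most the power 3/4 of
    [64 * X * E], and [X ^+ 3] cancels after taking fourth powers. *)
Lemma sobolev_bound (F : R3 R -> R) (D g : 'I_3 -> R3 R -> R) (h : R3 R -> R) (B : R) :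
  continuous F -> (forall i, continuous (D i)) ->
  (forall i x, is_derive x (basis3 i) F (D i x)) ->
  (forall x, F x != 0 -> [/\ `|x.1.1| < B, `|x.1.2| < B & `|x.2| < B]) ->
  (forall i, bs (box B) (D i)) -> bs (box B) h -> (forall x, 0 <= h x) ->
  (forall x, h x ^+ 2 <= `|F x|) ->
  (forall i, bs (box B) (g i)) -> (forall i x, 0 <= g i x) ->
  (forall i x, `|D i x| <= 8 * Num.sqrt (h x ^+ 3) * g i x) ->
  J lebesgue3 (fun x => h x ^+ 3) <=
  (64 * \sum_(i < 3) J lebesgue3 (fun x => g i x ^+ 2)) ^+ 3.
Proof.
move=> cF cD hD F0 bD bh h0 hF bg g0 hDg.
have bh3 : bs (box B) (fun x => h x ^+ 3) by have := bsM bh (bsM bh bh); congr (bs _ _).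
have mb := box_meas B; have fb : (lebesgue3 (box B) < +oo)%E := box_fin B.
have h30 x : 0 <= h x ^+ 3 by rewrite exprn_ge0.
set X := J lebesgue3 (fun x => h x ^+ 3).
set E := \sum_(i < 3) _.
have X0 : 0 <= X by apply: J_ge0.
have E0i i : 0 <= J lebesgue3 (fun x => g i x ^+ 2) by apply: J_ge0 => x; exact: sqr_ge0.
have Ei i : J lebesgue3 (fun x => g i x ^+ 2) <= E.
  by rewrite /E (bigD1 i)//= lerDl sumr_ge0.
have E0 : 0 <= E by rewrite /E sumr_ge0.
have ss : sqint lebesgue3 (fun x => Num.sqrt (h x ^+ 3)).
  by apply: (bs_sqint mb fb); exact: bs_sqrt.
have sg i : sqint lebesgue3 (g i) by exact: (bs_sqint mb fb).
have JD i : J lebesgue3 (fun x => `|D i x|) <= 8 * (Num.sqrt X * Num.sqrt E).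
  have hI := igM ss (sg i).
  apply: (@le_trans _ _ (8 * ip lebesgue3 (fun x => Num.sqrt (h x ^+ 3)) (g i))).
    rewrite -JZ//; apply: J_le.
    - by apply: (bs_ig mb fb); exact: bs_abs.
    - exact: igZ.
    - by move=> x; rewrite mulrA.
  apply: ler_wpM2l => //; apply: le_trans (ip_le ss (sg i)) _.
  rewrite /nrm sqr_nrm_sqrt// -/X; apply: ler_wpM2l; first exact: sqrtr_ge0.
  by rewrite ler_sqrt// ipE.
have Q0 : 0 <= 8 * (Num.sqrt X * Num.sqrt E) by rewrite !mulr_ge0 ?sqrtr_ge0.
have XQ : X <= Num.sqrt (8 * (Num.sqrt X * Num.sqrt E)) ^+ 3.
  apply: le_trans (gagliardo_nirenberg cF cD hD F0 bD bh h0 hF) _.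
  have -> (a : R) : a ^+ 3 = \prod_(i < 3) a by rewrite prodr_const card_ord.
  apply: ler_prod => i _.
  by rewrite sqrtr_ge0 /= ler_sqrt// JD.
have [X00|X00] := eqVneq X 0.
  by rewrite X00 exprn_ge0// mulr_ge0.
have Xp : 0 < X by rewrite lt_neqAle eq_sym X00.
(* The fourth power removes the nested roots, and 8^6 = 64^3. *)
have h4 : X ^+ 4 <= (64 * E) ^+ 3 * X ^+ 3.
  have := lerXn2r 4 _ _ XQ; rewrite !nnegrE X0 exprn_ge0 ?sqrtr_ge0// => /(_ isT isT).
  move=> /le_trans; apply; apply/le_of_eq.
  rewrite -exprM (_ : (3 * 4 = 2 * 6)%N)// exprM sqr_sqrtr//.
  rewrite !exprMn (_ : 6%N = (2 * 3)%N)// !exprM !sqr_sqrtr//.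
  by rewrite (_ : 8 ^+ 2 = 64) 1?mulrC -?natrX//; ring.
by move: h4; rewrite exprS ler_pM2r// exprn_gt0.
Qed.

End sobolev.

Section sobolev_test.
Context {R : realType} (Omega : smooth_bounded_domain R).
Local Notation mu := (lebesgue_on Omega).

Lemma J_domain (f : R3 R -> R) : (forall x, ~ domain Omega x -> f x = 0) ->
  J mu f = J lebesgue3 f.
Proof.
move=> fO; apply: (congr1 fine).
have fE : (EFin \o f) = ((EFin \o f) \_ (domain Omega)).
  apply/funext => x; rewrite patchE; case: ifPn => //.
  by rewrite notin_setE => /fO /= ->.
rewrite (_ : (fun x => (f x)%:E) = ((EFin \o f) \_ (domain Omega))); last exact: fE.
rewrite -!integral_mkcond; apply: eq_measure_integral => A mA AO.
by rewrite /lebesgue_on /= /mrestr setIidl.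
Qed.

Lemma test_out psi x : test_function Omega psi -> ~ domain Omega x -> psi x = 0.
Proof.
move=> [_ _ hp] xO; apply/eqP/negPn/negP => px; apply: xO; apply: hp.
exact: subset_closure.
Qed.

Lemma smooth_bs (B : R) (psi g : R3 R -> R) : test_function Omega psi ->
  (forall x, closure [set x | psi x != 0] x -> [/\ `|x.1.1| < B, `|x.1.2| < B & `|x.2| < B]) ->
  continuous g -> (forall x, ~ closure [set x | psi x != 0] x -> g x = 0) ->
  bs ((itvB B `*` itvB B) `*` itvB B) g.
Proof.
move=> [sp cp hp] hB cg g0; apply: vanish_bs => //; last first.
  move=> x gx; apply: hB; apply: contrapT => /g0/eqP.
  by rewrite (negbTE gx).
have /compact_bounded[M [_ hM]] : compact (g @` closure [set x | psi x != 0]).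
  by apply: continuous_compact => //; apply: continuous_subspaceT => x; exact: cg.
exists (`|M| + 1) => x.
have [px|px] := pselect (closure [set x | psi x != 0] x); last first.
  by rewrite g0// normr0 addr_ge0.
apply: hM; first by rewrite (le_lt_trans (ler_norm M))// ltrDl.
by exists x.
Qed.

(** [sobolev_bound] is applied to [F = Hf(psi)^2]. The last hypothesis bounds [dH] by 4 times the
    root of [Hf * dP], so the derivative of [F] is at most [8 * Hf^(3/2) * dP^(1/2)] times that of
    [psi]. The abstract triple covers [s ^+ 2], which gives Sobolev's inequality, and the truncated
    power [HF]. *)
Lemma sobolev_test_comp (Hf dH dP : R -> R) psi :
  test_function Omega psi ->
  (forall s, 0 <= Hf s) -> Hf 0 = 0 -> (forall s, 0 <= dP s) ->
  continuous (Hf \o psi) -> continuous (dH \o psi) -> continuous (dP \o psi) ->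
  (forall i x, is_derive x (basis3 i) (Hf \o psi) (dH (psi x) * partial i psi x)) ->
  (forall s, dH s ^+ 2 <= 16 * Hf s * dP s) ->
  J mu (fun x => Hf (psi x) ^+ 3) <=
  (64 * \sum_(i < 3) J mu (fun x => dP (psi x) * partial i psi x ^+ 2)) ^+ 3.
Proof.
move=> tp H0 H00 P0 cH cdH cdP hD hle.
have [B B0 hB] := test_support_bounded tp.
have sp := test_smooth tp.
have cpi i : continuous (partial i psi) by apply/smooth_continuous/smooth_partial.
have psi0 x : ~ closure [set x | psi x != 0] x -> psi x = 0.
  by move=> hx; apply/eqP/negPn/negP => px; apply: hx; exact: subset_closure.
have p0 i x : ~ closure [set x | psi x != 0] x -> partial i psi x = 0.
  by move=> hx; apply/eqP/negPn/negP => px; apply: hx; exact: partial_support px.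
rewrite (J_domain (f := fun x => Hf (psi x) ^+ 3)); last first.
  by move=> x xO; rewrite (test_out tp xO) H00 expr0n.
have -> : \sum_(i < 3) J mu (fun x => dP (psi x) * partial i psi x ^+ 2) =
   \sum_(i < 3) J lebesgue3 (fun x => (Num.sqrt (dP (psi x)) * `|partial i psi x|) ^+ 2).
  apply: eq_bigr => i _; rewrite J_domain; last first.
    by move=> x xO; rewrite (test_out (test_partial i tp) xO) expr0n mulr0.
  by apply: eq_J => x; rewrite exprMn sqr_sqrtr// real_normK ?num_real.
pose F x := Hf (psi x) ^+ 2.
pose D i x := 2 * Hf (psi x) * dH (psi x) * partial i psi x.
have cHp x : {for x, continuous (fun x => Hf (psi x))} by exact: cH.
apply: (@sobolev_bound _ F D (fun i x => Num.sqrt (dP (psi x)) * `|partial i psi x|)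
   (fun x => Hf (psi x)) B).
- move=> x; rewrite /F /continuous_at expr2.
  by under eq_fun do rewrite expr2; apply: cvgM; exact: cHp.
- move=> i x; apply: cvgM; last exact: cpi.
  by apply: cvgM; [apply: cvgM; [exact: cvg_cst|exact: cHp]|exact: cdH].
- move=> i x; apply: (is_derive_eq (is_deriveX 2 (hD i x))).
  by rewrite /D /GRing.scale /= expr1; ring.
- move=> x Fx; apply: hB; apply: contrapT => /psi0 px.
  by move: Fx; rewrite /F px H00 expr0n eqxx.
- move=> i; apply: smooth_bs tp hB _ _.
    move=> x; apply: cvgM; last exact: cpi.
    by apply: cvgM; [apply: cvgM; [exact: cvg_cst|exact: cHp]|exact: cdH].
  by move=> x /(p0 i) px; rewrite /D px mulr0.
- by apply: smooth_bs tp hB _ _ => // x /psi0 ->.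
- by [].
- by move=> x; rewrite /F ger0_norm// exprn_ge0.
- move=> i; apply: smooth_bs tp hB _ _.
    move=> x; apply: cvgM; last by apply: cvg_norm; exact: cpi.
    by apply: (@continuous_comp _ _ _ (dP \o psi) Num.sqrt); [exact: cdP|exact: sqrt_continuous].
  by move=> x /(p0 i) ->; rewrite normr0 mulr0.
- by move=> i x; rewrite mulr_ge0 ?sqrtr_ge0.
- move=> i x; rewrite /D; have h0 := H0 (psi x).
  rewrite normrM [leRHS]mulrA ler_wpM2r// -[leRHS]mulrA -sqrtrM ?exprn_ge0//.
  have nn : 0 <= 8 * Num.sqrt (Hf (psi x) ^+ 3 * dP (psi x)) by rewrite mulr_ge0 ?sqrtr_ge0.
  rewrite -(@ler_pXn2r _ 2)// ?nnegrE//.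
  rewrite real_normK ?num_real// [leRHS]exprMn sqr_sqrtr; last by rewrite mulr_ge0 ?exprn_ge0.
  have := ler_wpM2l (mulr_ge0 (ler0n R 4) (sqr_ge0 (Hf (psi x)))) (hle (psi x)).
  set a := Hf _; set b := dH _; set e := dP _ => hh.
  rewrite (_ : (2 * a * b) ^+ 2 = 4 * a ^+ 2 * b ^+ 2); last by ring.
  by rewrite (_ : 8 ^+ 2 * (a ^+ 3 * e) = 4 * a ^+ 2 * (16 * a * e)) //; ring.
Qed.

Lemma sobolev_test psi : test_function Omega psi ->
  J mu (fun x => psi x ^+ 6) <=
  (64 * \sum_(i < 3) J mu (fun x => partial i psi x ^+ 2)) ^+ 3.
Proof.
move=> tp; have sp := test_smooth tp; have cp := smooth_continuous sp.
have := @sobolev_test_comp (fun s => s ^+ 2) (fun s => 2 * s) (fun=> 1) psi tp.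
under eq_J do rewrite -exprM.
under [in X in _ -> _ -> _ -> _ -> _ -> _ -> _ -> _ -> X]eq_bigr do under eq_J do rewrite mul1r.
apply.
- by move=> s; exact: sqr_ge0.
- by rewrite expr0n.
- by [].
- move=> x; apply: (@continuous_comp _ _ _ psi (fun s : R => s ^+ 2)); first exact: cp.
  exact: exprn_continuous.
- by move=> x; apply: cvgM; [exact: cvg_cst|exact: cp].
- by move=> x; exact: cvg_cst.
- move=> i x; have hd : is_derive x (basis3 i) psi (partial i psi x).
    by apply: DeriveDef => //; exact: smooth_derivable.
  by apply: (is_derive_eq (is_deriveX 2 hd)); rewrite /GRing.scale /= expr1.
- by move=> s; have := sqr_ge0 s; nra.
Qed.

(** The sum on the right is the product of the gradients of [psi] and of [PsiF dl psi], that is, the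
    energy which an elliptic equation controls when tested with [PsiF dl psi]. *)
Lemma sobolev_test_H (dl : R) psi : 0 <= dl -> test_function Omega psi ->
  J mu (fun x => HF dl (psi x) ^+ 3) <=
  (64 * \sum_(i < 3) J mu (fun x => dPsiF dl (psi x) * partial i psi x ^+ 2)) ^+ 3.
Proof.
move=> d0 tp; have sp := test_smooth tp.
apply: (@sobolev_test_comp (HF dl) (dHF dl) (dPsiF dl)) => //.
- by move=> s; exact: HF_ge0.
- by rewrite /HF expr0n mul0r.
- by move=> s; exact: dPsiF_ge0.
- exact: (smooth_continuous (smooth_H d0 sp)).
- exact: (smooth_continuous (smooth_dH d0 sp)).
- exact: (smooth_continuous (smooth_dPsi d0 sp)).
- move=> i x; apply: is_derive_H => //.
  by apply: DeriveDef => //; exact: smooth_derivable.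
- by move=> s; exact: dHF_sq_le.
Qed.

End sobolev_test.

Section nlim_arithmetic.
Context d (T : measurableType d) (R : realType) (mu : {measure set T -> \bar R}).
Local Notation sqint := (sqint mu).
Local Notation nrm := (nrm mu).
Local Notation nlim := (nlim mu).
Implicit Types (f g : nat -> T -> R) (u v : T -> R).

Lemma nlim_squeeze f u (a : nat -> R) : a @ \oo --> (0 : R) ->
  (forall n, nrm (fun x => f n x - u x) <= a n) -> nlim f u.
Proof.
move=> a0 h; apply: (@squeeze_cvgr _ _ _ _ (fun=> 0) a) => //.
  by near=> n; rewrite nrm_ge0 h.
exact: cvg_cst.
Unshelve. all: by end_near. Qed.

Lemma nlimD f g u v : (forall n, sqint (f n)) -> (forall n, sqint (g n)) ->
  sqint u -> sqint v -> nlim f u -> nlim g v ->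
  nlim (fun n x => f n x + g n x) (fun x => u x + v x).
Proof.
move=> sf sg su sv fu gv.
apply: (@nlim_squeeze _ _ (fun n => nrm (fun x => f n x - u x) + nrm (fun x => g n x - v x))).
  by rewrite -[X in _ --> X](addr0 (0 : R)); exact: cvgD.
move=> n; apply: le_trans (nrmD (sqintB (sf n) su) (sqintB (sg n) sv)).
by apply/le_of_eq/eq_nrm => x; rewrite opprD addrACA.
Qed.

Lemma nlimZ k f u : (forall n, sqint (f n)) -> sqint u -> nlim f u ->
  nlim (fun n x => k * f n x) (fun x => k * u x).
Proof.
move=> sf su fu.
apply: (@nlim_squeeze _ _ (fun n => `|k| * nrm (fun x => f n x - u x))).
  by rewrite -[X in _ --> X](mulr0 `|k|); exact: cvgMr.
move=> n; rewrite -nrmZ; last exact: sqintB.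
by apply/le_of_eq/eq_nrm => x; rewrite mulrBr.
Qed.

Lemma nlim_cst u : nlim (fun=> u) u.
Proof.
rewrite /nlim (_ : (fun n => _) = fun=> 0); first exact: cvg_cst.
apply/funext => n; rewrite /nrm (_ : ip _ _ _ = 0) ?sqrtr0//.
by rewrite ipE (eq_J _ (g := fun=> 0)) ?J0// => x; rewrite subrr expr0n.
Qed.

Lemma nlim_ip2 f g u v : (forall n, sqint (f n)) -> (forall n, sqint (g n)) ->
  sqint u -> sqint v -> nlim f u -> nlim g v ->
  ip mu (f n) (g n) @[n --> \oo] --> ip mu u v.
Proof.
move=> sf sg su sv fu gv.
apply/cvgrPdist_le => e e0.
have h1 := nlim_nrm sf su fu.
have h2 : nrm (f n) * nrm (fun x => g n x - v x) + nrm (fun x => f n x - u x) * nrm v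
   @[n --> \oo] --> nrm u * 0 + 0 * nrm v.
  by apply: cvgD; [exact: cvgM|apply: cvgM => //; exact: cvg_cst].
move: h2; rewrite mulr0 mul0r addr0 => /cvgr0_norm_le/(_ e e0) [N _ hN].
exists N => // n Nn; apply: le_trans (hN n Nn); apply: le_trans (ler_norm _).
rewrite distrC.
have -> : ip mu (f n) (g n) - ip mu u v =
    ip mu (f n) (fun x => g n x - v x) + ip mu (fun x => f n x - u x) v.
  by rewrite ipBr// ipBl//; ring.
apply: le_trans (ler_normD _ _) _; apply: lerD; apply: cauchy_schwarz => //.
  exact: sqintB.
exact: sqintB.
Qed.

End nlim_arithmetic.

(** * Sobolev functions vanishing on the boundary *)

Section h10.
Context {R : realType} (Omega : smooth_bounded_domain R).
Local Notation mu := (lebesgue_on Omega).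
Local Notation sqint := (sqint mu).
Local Notation ip := (ip mu).
Local Notation nrm := (nrm mu).
Local Notation nlim := (nlim mu).
Local Notation test := (test_function Omega).
Implicit Types (u v psi : R3 R -> R) (g h : 'I_3 -> R3 R -> R) (i : 'I_3).

Lemma ig_cst (k : R) : ig mu (fun=> k).
Proof. by apply: (@bounded_ig _ _ _ `|k|). Qed.

Lemma sqint_cst (k : R) : sqint (fun=> k).
Proof. by split => //; exact: (ig_cst (k ^+ 2)). Qed.

Definition gip g h := \sum_(i < 3) ip (g i) (h i).
Definition gnrm g := Num.sqrt (gip g g).
Definition gsq g := forall i, sqint (g i).

Lemma gipC g h : gip g h = gip h g.
Proof. by apply: eq_bigr => i _; exact: ipC. Qed.

Lemma gip_ge0 g : 0 <= gip g g.
Proof. by apply: sumr_ge0 => i _; exact: ip_ge0. Qed.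

Lemma gnrm_ge0 g : 0 <= gnrm g. Proof. exact: sqrtr_ge0. Qed.

Lemma gnrm_sq g : gnrm g ^+ 2 = gip g g.
Proof. by rewrite sqr_sqrtr// gip_ge0. Qed.

Lemma gsqD g h : gsq g -> gsq h -> gsq (fun i x => g i x + h i x).
Proof. by move=> sg sh i; exact: sqintD. Qed.

Lemma gsqB g h : gsq g -> gsq h -> gsq (fun i x => g i x - h i x).
Proof. by move=> sg sh i; exact: sqintB. Qed.

Lemma gsqZ k g : gsq g -> gsq (fun i x => k * g i x).
Proof. by move=> sg i; exact: sqintZ. Qed.

Lemma gipDl g h k : gsq g -> gsq h -> gsq k ->
  gip (fun i x => g i x + h i x) k = gip g k + gip h k.
Proof.
by move=> *; rewrite /gip -big_split; apply: eq_bigr => i _; rewrite ipDl.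
Qed.

Lemma gipZl a g k : gsq g -> gsq k -> gip (fun i x => a * g i x) k = a * gip g k.
Proof.
by move=> *; rewrite /gip mulr_sumr; apply: eq_bigr => i _; rewrite ipZl.
Qed.

Lemma gipBl g h k : gsq g -> gsq h -> gsq k ->
  gip (fun i x => g i x - h i x) k = gip g k - gip h k.
Proof.
by move=> *; rewrite /gip -sumrB; apply: eq_bigr => i _; rewrite ipBl.
Qed.

Lemma gipBr g h k : gsq g -> gsq h -> gsq k ->
  gip k (fun i x => g i x - h i x) = gip k g - gip k h.
Proof. by move=> *; rewrite gipC gipBl// !(gipC k). Qed.

Lemma gipZr a g k : gsq g -> gsq k -> gip k (fun i x => a * g i x) = a * gip k g.
Proof. by move=> *; rewrite gipC gipZl// (gipC k). Qed.

Lemma gip_abs g h : gsq g -> gsq h -> `|gip g h| <= gnrm g * gnrm h.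
Proof.
move=> sg sh; apply: le_of_quadratic_ge0; [exact: gip_ge0|exact: gip_ge0|move=> t].
have th := gsqZ t sh.
have := gip_ge0 (fun i x => g i x - t * h i x).
rewrite gipBl//; last exact: gsqB.
rewrite !gipBr// !gipZl// !gipZr// (gipC h g) => /le_trans; apply.
by apply/le_of_eq; ring.
Qed.

Lemma gnrmD g h : gsq g -> gsq h -> gnrm (fun i x => g i x + h i x) <= gnrm g + gnrm h.
Proof.
move=> sg sh; rewrite -(@ler_pXn2r _ 2)// ?nnegrE ?addr_ge0 ?gnrm_ge0//.
have sD := gsqD sg sh.
rewrite gnrm_sq sqrrD !gnrm_sq gipDl// (gipC g) (gipC h) !gipDl// (gipC h g).
by have := le_trans (ler_norm _) (gip_abs sg sh); lra.
Qed.

Lemma gnrmZ k g : gsq g -> gnrm (fun i x => k * g i x) = `|k| * gnrm g.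
Proof.
move=> sg; rewrite /gnrm gipZl ?gipZr//; last exact: gsqZ.
by rewrite mulrA -expr2 sqrtrM ?sqr_ge0// sqrtr_sqr.
Qed.

Lemma eq_gnrm g h : (forall i x, g i x = h i x) -> gnrm g = gnrm h.
Proof.
by move=> gh; rewrite /gnrm /gip; congr Num.sqrt; apply: eq_bigr => i _; apply: eq_ip => x; exact: gh.
Qed.

Lemma gnrmB g h : gsq g -> gsq h -> gnrm (fun i x => g i x - h i x) <= gnrm g + gnrm h.
Proof.
move=> sg sh; rewrite (@eq_gnrm _ (fun i x => g i x + (-1) * h i x)); last first.
  by move=> i x; rewrite mulN1r.
apply: le_trans (gnrmD sg (gsqZ (-1) sh)) _.
by rewrite gnrmZ// normrN1 mul1r.
Qed.

Lemma nrm_le_gnrm g i : nrm (g i) <= gnrm g.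
Proof.
rewrite /nrm /gnrm ler_sqrt ?gip_ge0//.
by rewrite /gip (bigD1 i)//= lerDl sumr_ge0// => j _; exact: ip_ge0.
Qed.

Lemma nlim_gip (f k : nat -> 'I_3 -> R3 R -> R) g h :
  (forall n, gsq (f n)) -> (forall n, gsq (k n)) -> gsq g -> gsq h ->
  (forall i, nlim (fun n => f n i) (g i)) -> (forall i, nlim (fun n => k n i) (h i)) ->
  gip (f n) (k n) @[n --> \oo] --> gip g h.
Proof.
move=> sf sk sg sh fg kh; rewrite /gip.
have hi i : ip (f n i) (k n i) @[n --> \oo] --> ip (g i) (h i).
  by apply: nlim_ip2 => // n; [exact: sf|exact: sk].
rewrite !big_ord_recl big_ord0; under eq_fun do rewrite !big_ord_recl big_ord0.
by apply: cvgD => //; apply: cvgD => //; apply: cvgD => //; exact: cvg_cst.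
Qed.

Lemma nlim_gnrm (f : nat -> 'I_3 -> R3 R -> R) g :
  (forall n, gsq (f n)) -> gsq g -> (forall i, nlim (fun n => f n i) (g i)) ->
  gnrm (f n) @[n --> \oo] --> gnrm g.
Proof.
move=> sf sg fg; apply: (@cvg_comp _ _ _ (fun n => gip (f n) (f n)) Num.sqrt _ (nbhs (gip g g))).
  by apply: nlim_gip.
exact: sqrt_continuous.
Qed.

Lemma nlim_gnrm_sub (f : nat -> 'I_3 -> R3 R -> R) g :
  (forall n, gsq (f n)) -> gsq g -> (forall i, nlim (fun n => f n i) (g i)) ->
  gnrm (fun i x => f n i x - g i x) @[n --> \oo] --> (0 : R).
Proof.
move=> sf sg fg.
have <- : gnrm (fun i x => 0) = 0.
  rewrite /gnrm /gip big1 ?sqrtr0// => i _.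
  by rewrite ipE (eq_J mu (g := fun=> 0)) ?J0// => x; rewrite expr0n.
apply: nlim_gnrm; first by move=> n; exact: gsqB.
  by move=> i; exact: sqint0.
move=> i; rewrite /nlim (_ : (fun n => _) = fun n => nrm (fun x => f n i x - g i x)).
  exact: fg.
by apply/funext => n; apply: eq_nrm => x; rewrite subr0.
Qed.

(** The graph of the gradient on H^1_0, with the gradient carried along as data instead of being
    recovered from [u]. *)
Definition Hap u g := [/\ sqint u, gsq g & exists psi : nat -> R3 R -> R,
  [/\ forall n, test (psi n), nlim psi u & forall i, nlim (fun n => partial i (psi n)) (g i)]].

(** Kept apart from [Hap]: eigenfunctions have it by definition of the Dirichlet Laplacian, and
    [Grad_wk] passes it to limits of their combinations. *)
Definition wk u g := forall i psi, test psi -> ip u (partial i psi) = - ip (g i) psi.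

Lemma test_gsq psi : test psi -> gsq (fun i => partial i psi).
Proof. by move=> tp i; apply: test_sqint; exact: test_partial. Qed.

Lemma Hap_test psi : test psi -> Hap psi (fun i => partial i psi).
Proof.
move=> tp; split; [exact: test_sqint|exact: test_gsq|].
by exists (fun=> psi); split => // [|i]; exact: nlim_cst.
Qed.

Lemma testD psi psi' : test psi -> test psi' -> test (fun x => psi x + psi' x).
Proof.
move=> [s c h] [s' c' h'].
have sub : closure [set x | psi x + psi' x != 0] `<=`
    closure [set x | psi x != 0] `|` closure [set x | psi' x != 0].
  rewrite -closureU; apply: closureS => x /= pp; apply: contrapT.
  move=> /not_orP[/negP/negPn/eqP a /negP/negPn/eqP b].
  by move: pp; rewrite a b addr0 eqxx.
split.
- by move=> k; exact: CkD.
- by apply: subclosed_compact (compactU c c') sub; exact: closed_closure.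
- by move=> x /sub[/h|/h'].
Qed.

Lemma testZ k psi : test psi -> test (fun x => k * psi x).
Proof.
move=> tp; apply: test_le (tp); last by move=> x ->; rewrite mulr0.
by move=> n; apply: CkM; [exact: Ck_cst|exact: (test_smooth tp)].
Qed.

Lemma partialD psi psi' i x : test psi -> test psi' ->
  partial i (fun x => psi x + psi' x) x = partial i psi x + partial i psi' x.
Proof.
move=> tp tp'; rewrite /partial -deriveD//; apply: smooth_derivable.
  exact: (test_smooth tp).
exact: (test_smooth tp').
Qed.

Lemma partialZ k psi i x : test psi ->
  partial i (fun x => k * psi x) x = k * partial i psi x.
Proof.
move=> tp; rewrite /partial.
have := @deriveZ _ _ _ psi k x (basis3 i); rewrite /GRing.scale /=; apply.
by apply: smooth_derivable; exact: (test_smooth tp).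
Qed.

Lemma HapD u v g h : Hap u g -> Hap v h ->
  Hap (fun x => u x + v x) (fun i x => g i x + h i x).
Proof.
move=> [su sg [p [tp pu pg]]] [sv sh [q [tq qv qh]]]; split.
- exact: sqintD.
- exact: gsqD.
- exists (fun n x => p n x + q n x); split.
  + by move=> n; exact: testD.
  + by apply: nlimD => // n; exact: test_sqint.
  + move=> i; rewrite (_ : (fun n => _) = fun n x => partial i (p n) x + partial i (q n) x).
      by apply: nlimD => // n; apply: test_sqint; exact: test_partial.
    by apply/funext => n; apply/funext => x; exact: partialD.
Qed.

Lemma HapZ k u g : Hap u g -> Hap (fun x => k * u x) (fun i x => k * g i x).
Proof.
move=> [su sg [p [tp pu pg]]]; split.
- exact: sqintZ.
- exact: gsqZ.
- exists (fun n x => k * p n x); split.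
  + by move=> n; exact: testZ.
  + by apply: nlimZ => // n; exact: test_sqint.
  + move=> i; rewrite (_ : (fun n => _) = fun n x => k * partial i (p n) x).
      by apply: nlimZ => // n; apply: test_sqint; exact: test_partial.
    by apply/funext => n; apply/funext => x; exact: partialZ.
Qed.

Lemma eq_Hap u v g h : u =1 v -> (forall i, g i =1 h i) -> Hap u g -> Hap v h.
Proof.
move=> uv gh; have -> : u = v by apply/funext.
by have -> : g = h by apply/funext => i; apply/funext.
Qed.

Lemma HapB u v g h : Hap u g -> Hap v h ->
  Hap (fun x => u x - v x) (fun i x => g i x - h i x).
Proof.
move=> hu /(HapZ (-1)) hv; apply: eq_Hap (HapD hu hv) => [x|i x]; by rewrite mulN1r.
Qed.

Lemma Hap_approx u g : sqint u -> gsq g ->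
  (forall e, 0 < e -> exists psi, [/\ test psi, nrm (fun x => u x - psi x) < e &
     forall i, nrm (fun x => g i x - partial i psi x) < e]) -> Hap u g.
Proof.
move=> su sg h; split => //.
have hn (n : nat) : exists psi, [/\ test psi, nrm (fun x => u x - psi x) < n.+1%:R^-1 &
     forall i, nrm (fun x => g i x - partial i psi x) < n.+1%:R^-1].
  by apply: h; rewrite invr_gt0.
have [p hp] := choice hn; exists p; split.
- by move=> n; case: (hp n).
- apply: (nlim_squeeze (@cvg_harmonic R)) => n; rewrite nrm_subC.
  by case: (hp n) => _ /ltW.
- move=> i; apply: (nlim_squeeze (@cvg_harmonic R)) => n; rewrite nrm_subC.
  by case: (hp n) => _ _ /(_ i)/ltW.
Qed.

(** H^1_0 is closed: take a term of the sequence close to the limit, then a test function close to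
    that term. *)
Lemma Hap_lim (f : nat -> R3 R -> R) (k : nat -> 'I_3 -> R3 R -> R) u g :
  (forall n, Hap (f n) (k n)) -> sqint u -> gsq g -> nlim f u ->
  (forall i, nlim (fun n => k n i) (g i)) -> Hap u g.
Proof.
move=> hf su sg fu kg; apply: Hap_approx => // e e0.
have e20 : 0 < e / 2 by rewrite divr_gt0.
have h1 : \forall n \near \oo, nrm (fun x => f n x - u x) < e / 2.
  by have /nlimP/(_ _ e20)[N hN] := fu; exists N => // n /= /hN.
have h2 : \forall n \near \oo, forall i, nrm (fun x => k n i x - g i x) < e / 2.
  have hi i : \forall n \near \oo, nrm (fun x => k n i x - g i x) < e / 2.
    by have /nlimP/(_ _ e20)[N hN] := kg i; exists N => // n /= /hN.
  exact: filter_forall hi.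
have [n [hn1 hn2]] : exists n, nrm (fun x => f n x - u x) < e / 2 /\
    forall i, nrm (fun x => k n i x - g i x) < e / 2.
  have [N _ hN] : \forall n \near \oo, nrm (fun x => f n x - u x) < e / 2 /\
    forall i, nrm (fun x => k n i x - g i x) < e / 2 by near=> n; split; near: n.
  by exists N; apply: hN => /=.
have [sf sk [p [tp pf pk]]] := hf n.
have h3 : \forall m \near \oo, nrm (fun x => p m x - f n x) < e / 2.
  by have /nlimP/(_ _ e20)[N hN] := pf; exists N => // m /= /hN.
have h4 : \forall m \near \oo, forall i, nrm (fun x => partial i (p m) x - k n i x) < e / 2.
  have hi i : \forall m \near \oo, nrm (fun x => partial i (p m) x - k n i x) < e / 2.
    by have /nlimP/(_ _ e20)[N hN] := pk i; exists N => // m /= /hN.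
  exact: filter_forall hi.
have [N _ hN] : \forall m \near \oo, nrm (fun x => p m x - f n x) < e / 2 /\
  forall i, nrm (fun x => partial i (p m) x - k n i x) < e / 2 by near=> m; split; near: m.
have [a b] := hN N (leqnn N).
exists (p N); split => // [|i].
  apply: le_lt_trans (nrm_tri su sf (test_sqint (tp N))) _.
  by rewrite (splitr e) ltrD// nrm_subC.
apply: le_lt_trans (nrm_tri (sg i) (sk i) (test_gsq (tp N) i)) _.
by rewrite (splitr e) ltrD// nrm_subC.
Unshelve. all: by end_near. Qed.

(** Sobolev's inequality for test functions, carried to the limit by Fatou. The factor 8 comes from
    (64 g^2)^3 = (8 g)^6. The slack [e] is there because the bounds of the approximants only
    converge to the right-hand side. *)
Lemma Hap_L6 u g : Hap u g -> L6 mu (8 * gnrm g) u.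
Proof.
move=> [su sg [p [tp pu pg]]].
have h (e : R) : 0 < e -> ig mu ((fun s : R => s ^+ 6) \o u) /\
    J mu ((fun s : R => s ^+ 6) \o u) <= (8 * gnrm g) ^+ 6 + e.
  move=> e0; apply: (fatou_nlim (f := p)) => //.
  - by move=> n; exact: test_sqint.
  - exact: exprn_continuous.
  - by move=> s; exact: exprn_even_ge0.
  - by move=> n; exact: (test_ig_pow 6 (tp n)).
  - have hc : (8 * gnrm (fun i => partial i (p n))) ^+ 6 @[n --> \oo] --> (8 * gnrm g) ^+ 6.
      apply: (@continuous_cvg _ _ _ _ _ _ (fun s : R => s ^+ 6)); first exact: exprn_continuous.
      apply: cvgMr; apply: nlim_gnrm => // n; exact: test_gsq.
    have := cvgr_le _ hc ((8 * gnrm g) ^+ 6 + e); rewrite ltrDl => /(_ _ e0).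
    apply: filterS => n; apply: le_trans.
    apply: le_trans (sobolev_test (tp n)) _.
    rewrite (_ : \sum_(i < 3) _ = gnrm (fun i => partial i (p n)) ^+ 2); last first.
      by rewrite gnrm_sq; apply: eq_bigr => i _; rewrite ipE.
    by apply/le_of_eq; ring.
split; [exact: (sqint_meas su)|by case: (h 1 ltr01)|].
by apply/ler_addgt0Pr => e e0; case: (h e e0).
Qed.

(** * Gradients through eigenfunction expansions *)

Section spectral.
Variables (e : nat -> R3 R -> R) (de : nat -> 'I_3 -> R3 R -> R) (lamb : nat -> R).
Hypothesis se : forall j, sqint (e j).
Hypothesis eo : forall i j : nat, ip (e i) (e j) = (i == j)%:R.
Hypothesis ec : forall u, sqint u -> (forall j, ip u (e j) = 0) -> nrm u = 0.
Hypothesis eH : forall j, Hap (e j) (de j).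
Hypothesis ew : forall j, wk (e j) (de j).
Hypothesis eeq : forall j psi, test psi ->
  lamb j * ip (e j) psi = gip (de j) (fun i => partial i psi).
Hypothesis lamb0 : forall j, 0 <= lamb j.

Lemma de_gsq j : gsq (de j). Proof. by case: (eH j). Qed.

(** The eigenvalue equation is given against test functions; density extends it to all of H^1_0. *)
Lemma eig_weak j u g : Hap u g -> lamb j * ip u (e j) = gip g (de j).
Proof.
move=> [su sg [p [tp pu pg]]].
have h1 : lamb j * ip (p n) (e j) @[n --> \oo] --> lamb j * ip u (e j).
  by apply: cvgMr; apply: nlim_ip => // n; exact: test_sqint.
have h2 : gip (fun i => partial i (p n)) (de j) @[n --> \oo] --> gip g (de j).
  apply: nlim_gip => //; first by move=> n; exact: test_gsq.
  - by move=> n; exact: de_gsq.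
  - exact: de_gsq.
  - by move=> i; exact: nlim_cst.
apply: (@cvg_unique _ (@Rhausdorff R) _ _ _ _ h1).
rewrite (_ : (fun n => _) = fun n => gip (fun i => partial i (p n)) (de j))//.
by apply/funext => n; rewrite ipC eeq// gipC.
Qed.

Definition glc (c : nat -> R) n i := lc (fun j => de j i) c n.

Lemma glc_gsq c n : gsq (glc c n).
Proof. by move=> i; apply: lc_sqint => j; exact: de_gsq. Qed.

Lemma Hap_lc c n : Hap (lc e c n) (glc c n).
Proof.
elim: n => [|n ih].
  have h0 := HapZ 0 (eH 0).
  by apply: eq_Hap h0 => [x|i x]; rewrite mul0r /glc /lc big_geq.
apply: eq_Hap (HapD ih (HapZ (c n) (eH n))) => [x|i x];
  by rewrite /glc /lc big_nat_recr.
Qed.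

Lemma gip_glc_de c n j : gip (glc c n) (de j) = if (j < n)%N then lamb j * c j else 0.
Proof.
rewrite -(eig_weak j (Hap_lc c n)) ip_lc_e//.
by case: ifP; rewrite ?mulr0.
Qed.

Lemma gip_glc g c n : gsq g -> gip g (glc c n) = \sum_(0 <= j < n) c j * gip g (de j).
Proof.
move=> sg; rewrite /gip.
transitivity (\sum_(i < 3) \sum_(0 <= j < n) c j * ip (g i) (de j i)).
  by apply: eq_bigr => i _; rewrite /glc ip_lcr// => j; exact: de_gsq.
rewrite exchange_big /=; apply: eq_bigr => j _.
by rewrite mulr_sumr.
Qed.

Lemma gip_glc_glc c c' m n : (m <= n)%N ->
  gip (glc c m) (glc c' n) = \sum_(0 <= j < m) lamb j * c j * c' j.
Proof.
move=> mn; rewrite gipC gip_glc; last exact: glc_gsq.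
rewrite [LHS]big_nat_cond [RHS]big_nat_cond; apply: eq_bigr => j /andP[/andP[_ jm] _].
by rewrite gip_glc_de (leq_trans jm mn); ring.
Qed.

Lemma gnrm_glc_sub c m n : (m <= n)%N ->
  gnrm (fun i x => glc c n i x - glc c m i x) ^+ 2 = \sum_(m <= j < n) lamb j * c j ^+ 2.
Proof.
move=> mn; have s := glc_gsq c.
rewrite gnrm_sq gipBl//; last exact: gsqB.
rewrite !gipBr// (gipC (glc c n) (glc c m)) !gip_glc_glc//.
rewrite (big_cat_nat (leq0n m) mn)/= subrr subr0.
rewrite [LHS]addrAC subrr add0r; apply: eq_bigr => j _; ring.
Qed.

(** The gradient of [u] obtained term by term from its expansion. It makes the gradient norm a
    weighted sum of squared coefficients, and so links the spectral definition of the spaces to L^6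
    estimates. *)
Definition Grad u g := [/\ sqint u, gsq g &
  forall i, nlim (fun n => glc (fun j => ip u (e j)) n i) (g i)].

(** The gradients of the [e j] are orthogonal with squared norms [lamb j], so a bound on the
    weighted sums makes the gradients of the partial sums Cauchy. *)
Lemma Grad_exists u M : sqint u ->
  (forall n, \sum_(0 <= j < n) lamb j * ip u (e j) ^+ 2 <= M) -> exists g, Grad u g.
Proof.
move=> su hM; pose c j := ip u (e j).
have a0 j : 0 <= lamb j * c j ^+ 2 by rewrite mulr_ge0 ?sqr_ge0.
have hC i : exists2 gi, sqint gi & nlim (fun n => glc c n i) gi.
  apply: riesz_fischer; first by move=> n; exact: glc_gsq.
  move=> ep ep0; have [N hN] := summable_cauchy a0 hM (exprn_gt0 2 ep0).
  exists N => m n; wlog mn : m n / (m <= n)%N => [hw Nm Nn|Nm Nn].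
    by have [/hw|/ltnW/hw] := leqP m n; rewrite nrm_subC; [rewrite nrm_subC|]; exact.
  rewrite nrm_subC.
  apply: le_lt_trans (nrm_le_gnrm (fun i x => glc c n i x - glc c m i x) i) _.
  rewrite -(@ltr_pXn2r _ 2)// ?nnegrE ?gnrm_ge0 ?(ltW ep0)//.
  by rewrite gnrm_glc_sub// hN.
have [g hg] : exists g : 'I_3 -> R3 R -> R, forall i, sqint (g i) /\ nlim (fun n => glc c n i) (g i).
  have hC' i : exists gi, sqint gi /\ nlim (fun n => glc c n i) gi by have [gi] := hC i; exists gi.
  by exists (fun i => sval (cid (hC' i))) => i; exact: (svalP (cid (hC' i))).
by exists g; split => // i; case: (hg i).
Qed.

Lemma Grad_Hap u g : Grad u g -> Hap u g.
Proof.
move=> [su sg hg]; apply: (Hap_lim (f := lc e (fun j => ip u (e j))) _ su sg) hg.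
  by move=> n; exact: Hap_lc.
exact: expansion.
Qed.

Lemma wk_lc c n : wk (lc e c n) (glc c n).
Proof.
move=> i psi tp.
have sp := test_sqint tp; have spi := test_gsq tp i.
rewrite ip_lcl// /glc ip_lcl//; last by move=> j; exact: de_gsq.
by rewrite -sumrN; apply: eq_bigr => j _; rewrite ew// mulrN.
Qed.

Lemma Grad_wk u g : Grad u g -> wk u g.
Proof.
move=> [su sg hg] i psi tp.
have sp := test_sqint tp; have spi := test_gsq tp i.
have sl n := lc_sqint se (fun j => ip u (e j)) n.
have h1 := nlim_ip sl su spi (expansion se eo ec su).
apply: (@cvg_unique _ (@Rhausdorff R) _ _ _ _ h1).
rewrite (_ : (fun n => _) = fun n => - ip (glc (fun j => ip u (e j)) n i) psi); last first.
  by apply/funext => n; rewrite wk_lc.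
by apply: cvgN; apply: nlim_ip => // n; exact: glc_gsq.
Qed.

Lemma Grad_gip_de u g j : Grad u g -> gip g (de j) = lamb j * ip u (e j).
Proof. by move=> /Grad_Hap/eig_weak. Qed.

(** Gradient norm and weighted sums bound each other: here by projecting [g] on the gradients of the
    [e j], in [Grad_le] by passing to the limit. *)
Lemma Grad_bessel u g n : Grad u g ->
  \sum_(0 <= j < n) lamb j * ip u (e j) ^+ 2 <= gnrm g ^+ 2.
Proof.
move=> hg; have [su sg _] := hg; pose c j := ip u (e j).
have sl := glc_gsq c n.
have := gip_ge0 (fun i x => g i x - glc c n i x).
rewrite gipBl//; last exact: gsqB.
rewrite !gipBr// (gipC (glc c n) g) gip_glc// gip_glc_glc// gnrm_sq.
rewrite (eq_bigr (fun j => lamb j * c j ^+ 2)); last first.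
  by move=> j _; rewrite (Grad_gip_de j hg) -/(c j); ring.
rewrite [X in _ - (_ - X)](eq_bigr (fun j => lamb j * c j ^+ 2)); last first.
  by move=> j _; ring.
by lra.
Qed.

Lemma Grad_le u g M : Grad u g -> 0 <= M ->
  (forall n, \sum_(0 <= j < n) lamb j * ip u (e j) ^+ 2 <= M ^+ 2) -> gnrm g <= M.
Proof.
move=> [su sg hg] M0 hM.
have h1 := nlim_gnrm (glc_gsq (fun j => ip u (e j))) sg hg.
rewrite -(cvg_lim _ h1)//; apply: limr_le; first by apply/cvg_ex; exists (gnrm g).
near=> n; rewrite -(@ler_pXn2r _ 2)// ?nnegrE ?gnrm_ge0//.
rewrite gnrm_sq gip_glc_glc//.
by apply: le_trans (hM n); apply/le_of_eq/eq_bigr => j _; ring.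
Unshelve. all: by end_near. Qed.

Lemma lc_lin (ee : nat -> R3 R -> R) (a b : R) c c' n x :
  lc ee (fun j => a * c j + b * c' j) n x = a * lc ee c n x + b * lc ee c' n x.
Proof. by rewrite /lc !mulr_sumr -big_split; apply: eq_bigr => j _ /=; ring. Qed.

Lemma Grad_lin (a b : R) u v g h : Grad u g -> Grad v h ->
  Grad (fun x => a * u x + b * v x) (fun i x => a * g i x + b * h i x).
Proof.
move=> [su sg hg] [sv sh hh]; split.
- by apply: sqintD; exact: sqintZ.
- by apply: gsqD; exact: gsqZ.
- move=> i; have sgl c n := glc_gsq c n i.
  rewrite (_ : (fun n => _) = fun n x => a * glc (fun j => ip u (e j)) n i x
     + b * glc (fun j => ip v (e j)) n i x); last first.
    apply/funext => n; apply/funext => x; rewrite -lc_lin /glc /lc.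
    by apply: eq_bigr => j _; rewrite ipDl ?ipZl//; exact: sqintZ.
  apply: nlimD.
  + by move=> n; exact: sqintZ.
  + by move=> n; exact: sqintZ.
  + exact: sqintZ.
  + exact: sqintZ.
  + by apply: nlimZ.
  + by apply: nlimZ.
Qed.

End spectral.

End h10.

(** * Fractional powers of the Laplacian *)

Section L2_elements.
Context {R : realType} (Omega : smooth_bounded_domain R).
Local Notation mu := (lebesgue_on Omega).
Local Notation sqint := (sqint mu).
Local Notation ip := (ip mu).
Local Notation nrm := (nrm mu).
Local Notation nlim := (nlim mu).
Local Notation test := (test_function Omega).
Implicit Types (u v w : L2 Omega).

Lemma L2_meas u : measurable_fun setT (u : R3 R -> R).
Proof.
rewrite /L2_fun /aqEqMfun_to_fun; case: (repr _) => f [[fP]] /=; exact: fP.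
Qed.

Lemma L2_sqint u : sqint u.
Proof.
apply/(finite_norm_sqint _ (L2_meas u)).
exact: (@Lebesgue_finite _ _ _ _ _ _ (u : LspaceType _ _)).
Qed.

Lemma norm2E (f : R3 R -> R) : sqint f -> norm2 Omega f = nrm f.
Proof. by move=> sf; rewrite /norm2 Lnorm2E. Qed.

Lemma innerE (f g : R3 R -> R) : inner Omega f g = ip f g.
Proof. by []. Qed.

(** Completeness of the eigenbasis and the spaces [Hs] speak of classes, whereas limits are built as
    functions; this is the way back. *)
Lemma exists_L2 (f : R3 R -> R) : sqint f ->
  exists u : L2 Omega, (u : R3 R -> R) = f %[ae mu].
Proof.
move=> sf; have mf : @measurable_fun _ _ (R3 R) (measurableTypeR R) setT f by case: sf.
pose F : {mfun R3 R >-> measurableTypeR R} :=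
  HB.pack f (@isMeasurableFun.Build _ _ (R3 R) (measurableTypeR R) f mf).
pose q : {mfun_ mu, R3 R >-> measurableTypeR R} := \pi_({mfun_ mu, R3 R >-> measurableTypeR R})%qT F.
have qF : (q : R3 R -> R) = f %[ae mu].
  have : repr q == F %[mod {mfun_ mu, R3 R >-> measurableTypeR R}]%qT by rewrite reprK.
  by rewrite eqmodE => /asboolP.
have fq : finite_norm mu 2%:E (q : R3 R -> R).
  have mq : measurable_fun setT (q : R3 R -> R).
    by rewrite /aqEqMfun_to_fun; case: (repr _) => g [[gP]].
  apply/(finite_norm_sqint _ mq); apply: ae_eq_sqint sf => //.
  by apply: filterS qF => x /= hx; rewrite hx.
pose U : L2 Omega := HB.pack q (@isFinLebesgue.Build _ _ _ mu 2%:E (lee1n 2) q fq).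
by exists U.
Qed.

Lemma ae_ip u (f g : R3 R -> R) : (u : R3 R -> R) = f %[ae mu] -> sqint f -> sqint g ->
  ip u g = ip f g.
Proof.
move=> uf sf sg; apply: ae_eq_ip => //; [exact: L2_meas|exact: (sqint_meas sf)|exact: (sqint_meas sg)].
Qed.

Lemma ae_nrm u (f g : R3 R -> R) : (u : R3 R -> R) = f %[ae mu] -> sqint f -> sqint g ->
  nrm (fun x => u x - g x) = nrm (fun x => f x - g x).
Proof.
move=> uf sf sg; rewrite /nrm; congr Num.sqrt; rewrite !ipE.
apply: ae_eq_J.
- by apply: measurable_funX; apply: measurable_funB; [exact: L2_meas|exact: (sqint_meas sg)].
- by apply: measurable_funX; apply: measurable_funB; [exact: (sqint_meas sf)|exact: (sqint_meas sg)].
- by apply: filterS uf => x /= ->.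
Qed.

Lemma wk_laplacian u g psi : gsq Omega g -> wk Omega u g -> test psi ->
  ip u (laplacian psi) = - gip Omega g (fun i => partial i psi).
Proof.
move=> sg wu tp; rewrite (eq_ip mu (f' := u) (g' := fun x => \sum_(i < 3) partial i (partial i psi) x))//.
rewrite ip_sumr; last 2 first.
- by move=> i; apply: test_sqint; do 2 apply: test_partial.
- exact: L2_sqint.
rewrite /gip -sumrN; apply: eq_bigr => i _.
by rewrite wu//; exact: test_partial.
Qed.

(** [H10] and the second clause of [dirichlet_laplacian] each supply a weak gradient of [u]. The two
    are compared only against derivatives of test functions, which suffices for the weak eigenvalue
    equation. *)
Lemma eigenpair_grad l u : eigenpair l u -> exists g,
  [/\ Hap Omega u g, wk Omega u g & forall psi, test psi ->
     l * ip u psi = gip Omega g (fun i => partial i psi)].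
Proof.
move=> [w [[g1 wg1 hg1] [g [h [wg wh wE]]]] wl].
have su := L2_sqint u; have sg1 i := L2_sqint (g1 i).
exists (fun i => g1 i); split.
- apply: Hap_approx => // e e0; have [psi [tp h1 h2]] := hg1 e e0.
  exists psi; split => //.
    rewrite -norm2E; first exact: h1.
    by apply: sqintB => //; exact: test_sqint.
  move=> i; rewrite -norm2E; first exact: h2.
  by apply: sqintB => //; apply: test_sqint; exact: test_partial.
- by move=> i psi tp; exact: wg1.
- move=> psi tp; have sp := test_sqint tp.
  have sh i j := L2_sqint (h i j).
  transitivity (ip w psi).
    by rewrite (ae_ip wl)// ?ipZl//; exact: sqintZ.
  rewrite (ae_ip wE)//; last by apply: sqintN; apply: sqint_sum.
  rewrite ipNl//; last exact: sqint_sum.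
  rewrite ip_suml// /gip -sumrN; apply: eq_bigr => i _.
  rewrite -innerE -(wh i i psi tp).
  have tpi := test_partial i tp.
  have := wg i (partial i psi) tpi; have := wg1 i (partial i psi) tpi.
  by rewrite !innerE => -> /oppr_inj ->.
Qed.

Section eigenbasis.
Variables (e : nat -> L2 Omega) (lamb : nat -> R).
Hypothesis eb : eigenbasis e lamb.

Lemma eb_ortho (i j : nat) : ip (e i) (e j) = (i == j)%:R.
Proof. by case: eb => _ h _; exact: (h i j). Qed.

Lemma eb_sq j : sqint (e j). Proof. exact: L2_sqint. Qed.

Lemma eb_complete (f : R3 R -> R) : sqint f -> (forall j, ip f (e j) = 0) -> nrm f = 0.
Proof.
move=> sf h; have [u uf] := exists_L2 sf.
have u0 : norm2 Omega u = 0.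
  case: eb => _ _; apply => j; rewrite innerE (ae_ip uf)//; exact: L2_sqint.
rewrite norm2E in u0; last exact: L2_sqint.
have s0 := sqint0 mu.
have := ae_nrm uf sf s0.
rewrite (eq_nrm mu (g := u)); last by move=> x; rewrite subr0.
by rewrite u0 (eq_nrm mu (g := f)) // => x; rewrite subr0.
Qed.

Lemma eb_grad : exists de : nat -> 'I_3 -> R3 R -> R,
  [/\ forall j, Hap Omega (e j) (de j), forall j, wk Omega (e j) (de j) &
   forall j psi, test psi -> lamb j * ip (e j) psi = gip Omega (de j) (fun i => partial i psi)].
Proof.
have h j : exists g, [/\ Hap Omega (e j) g, wk Omega (e j) g & forall psi, test psi ->
     lamb j * ip (e j) psi = gip Omega g (fun i => partial i psi)].
  by apply: eigenpair_grad; case: eb.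
have [de hde] := choice h; exists de.
by split => j; case: (hde j).
Qed.

Lemma eb_ge l1 j : first_eigenvalue Omega l1 -> l1 <= lamb j.
Proof.
move=> [_]; apply; exists (e j); first by case: eb.
have n1 : nrm (e j) = 1 by rewrite /nrm eb_ortho eqxx sqrtr1.
by rewrite norm2E; [rewrite n1 oner_eq0|exact: L2_sqint].
Qed.

End eigenbasis.

(** The product of the two gradients equals both [l j] times and [l' k] times the inner product. *)
Lemma eigenvectors_ortho (e e' : nat -> L2 Omega) (l l' : nat -> R) (j k : nat) : eigenbasis e l -> eigenbasis e' l' ->
  l j != l' k -> ip (e j) (e' k) = 0.
Proof.
move=> eb eb' ll.
have [de [eH ew eeq]] := eb_grad eb; have [de' [eH' ew' eeq']] := eb_grad eb'.
have h1 := eig_weak (eb_sq e') eH' eeq' k (eH j).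
have h2 := eig_weak (eb_sq e) eH eeq j (eH' k).
have : (l j - l' k) * ip (e j) (e' k) = 0.
  by rewrite mulrBl h1 ipC h2 gipC subrr.
by move=> /eqP; rewrite mulf_eq0 subr_eq0 (negbTE ll)/= => /eqP.
Qed.

(** [Apow_graph] lets the basis vary with [u]; this makes the coefficient rule available in one
    fixed basis. Either [e' k] has the same eigenvalue as [e j], and then [w] minus the expected
    multiple of [u] has no coefficient along it, or [e' k] is orthogonal to [e j]. *)
Lemma Apow_basis (e e' : nat -> L2 Omega) (l l' : nat -> R) (s : R) u w : eigenbasis e l -> eigenbasis e' l' ->
  (forall k, ip w (e' k) = l' k `^ s * ip u (e' k)) ->
  forall j, ip w (e j) = l j `^ s * ip u (e j).
Proof.
move=> eb eb' hw j.
have su := L2_sqint u; have sw := L2_sqint w; have sej := L2_sqint (e j).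
pose a := l j `^ s.
have sd : sqint (fun x => w x - a * u x) by apply: sqintB => //; exact: sqintZ.
suff : ip (fun x => w x - a * u x) (e j) = 0.
  by rewrite ipBl ?ipZl//; [move/eqP; rewrite subr_eq0 => /eqP|exact: sqintZ].
apply: (ip_eq0_disjoint (eb_sq e') (eb_ortho eb') (eb_complete eb')) => // k.
have sek := L2_sqint (e' k).
have [ll|ll] := eqVneq (l j) (l' k).
  left; rewrite ipBl ?ipZl//; last exact: sqintZ.
  by rewrite hw /a ll subrr.
by right; exact: eigenvectors_ortho ll.
Qed.

Lemma Apow_coef (e : nat -> L2 Omega) (l : nat -> R) (r : R) (U : Hs Omega r) j : eigenbasis e l ->
  ip (@Apow _ Omega (r / 2) U) (e j) = l j `^ (r / 2) * ip (Hs_val U) (e j).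
Proof.
move=> eb; rewrite /Apow /Hs_val; case: cid => w [e' [l' [eb' hw]]] /=.
by apply: (Apow_basis eb eb') => k; have := hw k; rewrite !innerE.
Qed.

(** How regularity is finally produced: square-summable weighted coefficients yield the function
    that plays the role of [A^(r/2) u], and with it membership of [u] in the space. *)
Lemma Hs_exists (e : nat -> L2 Omega) (l : nat -> R) (r : R) u M : eigenbasis e l -> (forall n,
   \sum_(0 <= j < n) (l j `^ (r / 2) * ip u (e j)) ^+ 2 <= M) ->
  exists U : Hs Omega r, Hs_val U = u /\ Hs_norm U ^+ 2 <= M.
Proof.
move=> eb hM.
have [w [sw wc _ wM]] := exists_coords (eb_sq e) (eb_ortho eb) hM.
have [W Ww] := exists_L2 sw.
have Wc j : ip W (e j) = l j `^ (r / 2) * ip u (e j).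
  by rewrite (ae_ip Ww)// ?wc//; exact: L2_sqint.
have dU : u \in (@Apow_dom R Omega (r / 2)).
  by apply/mem_set; exists W, e, l; split => // j; rewrite !innerE.
pose U : Hs Omega r := exist _ u dU.
exists U; split => //.
rewrite /Hs_norm norm2E; last exact: L2_sqint.
rewrite nrm_sq; apply: (parseval_le (eb_sq e) (eb_ortho eb) (eb_complete eb)).
  exact: L2_sqint.
move=> n; apply: le_trans (hM n); apply/le_of_eq.
by apply: eq_bigr => j _; rewrite (Apow_coef _ _ eb).
Qed.

Lemma Hs_ballE r (U V : Hs Omega r) (d : R) : ball U d V <-> Hs_dist U V < d.
Proof. by []. Qed.

Lemma Hs_distE (e : nat -> L2 Omega) (l : nat -> R) (r : R) (U V : Hs Omega r) n : eigenbasis e l ->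
  \sum_(0 <= j < n) (l j `^ (r / 2) * ip (fun x => Hs_val U x - Hs_val V x) (e j)) ^+ 2
  <= Hs_dist U V ^+ 2.
Proof.
move=> eb; have s W : sqint (@Apow _ Omega (r / 2) W) by exact: L2_sqint.
rewrite /Hs_dist norm2E; last exact: sqintB.
rewrite nrm_sq.
apply: le_trans (bessel (eb_sq e) (eb_ortho eb) n (sqintB (s U) (s V))).
apply/le_of_eq; apply: eq_bigr => j _; congr (_ ^+ 2).
rewrite ipBl//; [|exact: L2_sqint|exact: L2_sqint|exact: L2_sqint].
rewrite (ipBl (s U) (s V) (L2_sqint (e j))).
by rewrite !(Apow_coef _ _ eb) mulrBr.
Qed.

Lemma Hs_normE (e : nat -> L2 Omega) (l : nat -> R) (r : R) (U : Hs Omega r) n : eigenbasis e l ->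
  \sum_(0 <= j < n) (l j `^ (r / 2) * ip (Hs_val U) (e j)) ^+ 2 <= Hs_norm U ^+ 2.
Proof.
move=> eb; rewrite /Hs_norm norm2E; last exact: L2_sqint.
rewrite nrm_sq.
apply: le_trans (bessel (eb_sq e) (eb_ortho eb) n (L2_sqint _)).
by apply/le_of_eq; apply: eq_bigr => j _; rewrite (Apow_coef _ _ eb).
Qed.

End L2_elements.

(* [lra] compares its atoms up to conversion, which diverges on integrals. *)
Ltac abstract_integrals :=
  repeat match goal with H : is_true _ |- _ => revert H end;
  repeat match goal with
    | |- context [@nrm ?d ?T ?R ?m ?f] => generalize (@nrm d T R m f)
    | |- context [@ip ?d ?T ?R ?m ?f ?g] => generalize (@ip d T R m f g)
    | |- context [@gnrm ?R ?O ?f] => generalize (@gnrm R O f)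
    | |- context [@gip ?R ?O ?f ?g] => generalize (@gip R O f g)
    | |- context [@J ?d ?T ?R ?m ?f] => generalize (@J d T R m f)
  end; intros.
Ltac nlra := abstract_integrals; lra.
Ltac nring := abstract_integrals; ring.

(** * Compact sets in the phase space *)

Section phase.
Context {R : realType} (Omega : smooth_bounded_domain R).
Local Notation mu := (lebesgue_on Omega).
Local Notation sqint := (sqint mu).
Local Notation ip := (ip mu).
Local Notation nrm := (nrm mu).
Local Notation nlim := (nlim mu).
Local Notation test := (test_function Omega).
Local Notation X := (calH Omega 0).
Implicit Types (z : X).

Definition pos z : R3 R -> R := Hs_val z.1.
Definition vel z : R3 R -> R := Hs_val z.2.

Lemma pos_sqint z : sqint (pos z). Proof. exact: L2_sqint. Qed.
Lemma vel_sqint z : sqint (vel z). Proof. exact: L2_sqint. Qed.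

(** The exponent is kept as [(0 + 1) / 2], the literal shape in which the first component of
    [calH Omega 0] produces it. *)
Lemma sqr_powR_half (a b : R) : 0 <= a -> (a `^ ((0 + 1) / 2) * b) ^+ 2 = a * b ^+ 2.
Proof.
move=> a0; rewrite exprMn add0r -(powR_mulrn 2 (powR_ge0 a _)) -powRrM.
by rewrite mul1r mulVf ?pnatr_eq0// powRr1.
Qed.

Lemma sqr_powR0 (a b : R) : (a `^ (0 / 2) * b) ^+ 2 = b ^+ 2.
Proof. by rewrite mul0r powRr0 mul1r. Qed.

(** The form in which compactness enters: [compact_bound] and [compact_split] are local statements
    made uniform by it. *)
Lemma compact_uniform (A : set X) (P : nat -> X -> Prop) : compact A ->
  (forall m n z, (m <= n)%N -> P m z -> P n z) ->
  (forall z, A z -> exists n, \forall y \near z, P n y) ->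
  exists n, forall z, A z -> P n z.
Proof.
move=> /compact_near_coveringP cA mono loc.
have [N _ hN] : \forall n \near \oo, A `<=` P n.
  apply: cA => z Az; have [n hn] := loc z Az.
  exists ([set y | P n y], [set m | (n <= m)%N]) => /=.
    by split => //; exists n.
  by move=> [y m] /= [Py nm]; exact: mono Py.
by exists N => z Az; exact: hN (leqnn N) z Az.
Qed.

Lemma near_dist z (d : R) : 0 < d ->
  \forall y \near z, Hs_dist y.1 z.1 < d /\ Hs_dist y.2 z.2 < d.
Proof.
move=> d0; apply/nbhs_ballP; exists d => //= y [h1 h2].
by split; [exact: (proj1 (Hs_ballE _ _ _) (ball_sym h1))|exact: (proj1 (Hs_ballE _ _ _) (ball_sym h2))].
Qed.

Lemma Hs_dist_ge0 r (U V : Hs Omega r) : 0 <= Hs_dist U V.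
Proof.
rewrite /Hs_dist norm2E ?nrm_ge0//; apply: sqintB; exact: L2_sqint.
Qed.

Section eigen.
Variables (e : nat -> L2 Omega) (lamb : nat -> R) (de : nat -> 'I_3 -> R3 R -> R) (l1 : R).
Hypothesis eb : eigenbasis e lamb.
Hypothesis eH : forall j, Hap Omega (e j) (de j).
Hypothesis ew : forall j, wk Omega (e j) (de j).
Hypothesis eeq : forall j psi, test psi ->
  lamb j * ip (e j) psi = gip Omega (de j) (fun i => partial i psi).
Hypothesis l10 : 0 < l1.
Hypothesis l1le : forall j, l1 <= lamb j.
Local Notation Grad := (Grad Omega e de).
Local Notation gnrm := (gnrm Omega).
Local Notation gip := (gip Omega).
Let se := eb_sq e.
Let eo := eb_ortho eb.
Let ec := eb_complete eb.

Lemma lamb_gt0 j : 0 < lamb j. Proof. exact: lt_le_trans l10 (l1le j). Qed.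

Lemma lamb_ge0 j : 0 <= lamb j. Proof. exact/ltW/lamb_gt0. Qed.

Lemma pos_grad z : exists g, Grad (pos z) g.
Proof.
apply: (Grad_exists se eo eH eeq lamb_ge0 (pos_sqint z) (M := Hs_norm z.1 ^+ 2)) => n.
apply: le_trans (Hs_normE z.1 n eb).
by apply/le_of_eq/eq_bigr => j _; rewrite sqr_powR_half ?lamb_ge0.
Qed.

(** A comparison of coefficients, each eigenvalue being at least [l1]. *)
Lemma poincare u g : Grad u g -> l1 * nrm u ^+ 2 <= gnrm g ^+ 2.
Proof.
move=> hg; have [su _ _] := hg; rewrite nrm_sq mulrC -ler_pdivlMr//.
apply: (parseval_le se eo ec su) => n; rewrite ler_pdivlMr// mulr_suml.
apply: le_trans (Grad_bessel se eo ec eH eeq n hg).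
by apply: ler_sum => j _; rewrite mulrC ler_wpM2r ?sqr_ge0.
Qed.

Variable grd : X -> 'I_3 -> R3 R -> R.
Hypothesis grdP : forall z, Grad (pos z) (grd z).

Lemma grd_sq z : gsq Omega (grd z). Proof. by case: (grdP z). Qed.

Lemma pos_Hap z : Hap Omega (pos z) (grd z).
Proof. exact: (Grad_Hap se eo ec eH (grdP z)). Qed.

Lemma posB_Grad y z : Grad (fun x => pos y x - pos z x) (fun i x => grd y i x - grd z i x).
Proof.
have := Grad_lin se eH 1 (-1) (grdP y) (grdP z).
congr (Grad _ _); first by apply/funext => x; rewrite mul1r mulN1r.
by apply/funext => i; apply/funext => x; rewrite mul1r mulN1r.
Qed.

Lemma grd_dist y z : gnrm (fun i x => grd y i x - grd z i x) <= Hs_dist y.1 z.1.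
Proof.
apply: (Grad_le se eo eH eeq (posB_Grad y z)); first exact: Hs_dist_ge0.
move=> n; apply: le_trans (Hs_distE y.1 z.1 n eb).
by apply/le_of_eq/eq_bigr => j _; rewrite sqr_powR_half ?lamb_ge0.
Qed.

Lemma vel_dist y z : nrm (fun x => vel y x - vel z x) <= Hs_dist y.2 z.2.
Proof.
rewrite -(@ler_pXn2r _ 2)// ?nnegrE ?nrm_ge0 ?Hs_dist_ge0// nrm_sq.
apply: (parseval_le se eo ec); first by apply: sqintB; exact: vel_sqint.
move=> n; apply: le_trans (Hs_distE y.2 z.2 n eb).
by apply/le_of_eq/eq_bigr => j _; rewrite sqr_powR0.
Qed.

Lemma pos_dist y z : Num.sqrt l1 * nrm (fun x => pos y x - pos z x) <=
  gnrm (fun i x => grd y i x - grd z i x).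
Proof.
rewrite -(@ler_pXn2r _ 2)// ?nnegrE ?mulr_ge0 ?sqrtr_ge0 ?nrm_ge0 ?gnrm_ge0//.
by rewrite exprMn sqr_sqrtr ?(ltW l10)//; exact: (poincare (posB_Grad y z)).
Qed.

Lemma compact_bound (A : set X) : compact A -> exists2 M, 0 < M &
  forall z, A z -> [/\ gnrm (grd z) <= M, nrm (vel z) <= M & nrm (pos z) <= M].
Proof.
move=> cA.
have [n hn] : exists n, forall z, A z -> gnrm (grd z) + nrm (vel z) <= n%:R.
  apply: compact_uniform => //.
    by move=> m n z mn /le_trans; apply; rewrite ler_nat.
  move=> z Az.
  have [n hn] : exists n, gnrm (grd z) + nrm (vel z) + 2 <= n%:R.
    exists (Num.truncn (gnrm (grd z) + nrm (vel z) + 2)).+1.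
    by apply/ltW; exact: truncnS_gt.
  exists n; apply: filterS (near_dist z ltr01) => y [h1 h2].
  apply: le_trans hn.
  have a1 := le_trans (grd_dist y z) (ltW h1).
  have a2 := le_trans (vel_dist y z) (ltW h2).
  have b1 : gnrm (grd y) <= gnrm (grd z) + gnrm (fun i x => grd y i x - grd z i x).
    apply: le_trans (gnrmD (grd_sq z) (gsqB (grd_sq y) (grd_sq z))).
    by apply/le_of_eq; apply: eq_gnrm => i x; rewrite addrC subrK.
  have b2 := nrm_le_sub (vel_sqint y) (vel_sqint z).
  apply: le_trans (lerD b1 b2) _.
  by rewrite addrACA lerD2l (_ : 2 = 1 + 1)// lerD.
pose s := (Num.sqrt l1)^-1.
exists (n%:R + 1 + s * n%:R); first by rewrite ltr_wpDr ?mulr_ge0 ?invr_ge0 ?sqrtr_ge0// ltr_wpDl.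
have s0 : 0 <= s by rewrite invr_ge0 sqrtr_ge0.
move=> z Az; have h := hn z Az.
have g0 := gnrm_ge0 Omega (grd z); have v0 := nrm_ge0 mu (vel z).
have n0 : 0 <= s * n%:R by rewrite mulr_ge0.
split; [nlra|nlra|].
have h3 : nrm (pos z) <= s * gnrm (grd z).
  rewrite ler_pdivlMl ?sqrtr_gt0//.
  rewrite -(@ler_pXn2r _ 2)// ?nnegrE ?mulr_ge0 ?sqrtr_ge0 ?nrm_ge0 ?gnrm_ge0//.
  by rewrite exprMn sqr_sqrtr ?(ltW l10)//; exact: (poincare (grdP z)).
apply: le_trans h3 _; rewrite ler_wpDl ?addr_ge0// ler_wpM2l//.
by apply: le_trans h; rewrite lerDl.
Qed.

(** A test function close to one point in H^1_0 serves as the bounded part on a whole neighbourhood,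
    and Sobolev's inequality makes the remainder small in L^6. *)
Lemma compact_split (A : set X) (rho : R) : compact A -> 0 < rho ->
  exists2 K, 0 <= K & forall z, A z -> split6 mu K rho (pos z).
Proof.
move=> cA rho0.
have [n hn] : exists n, forall z, A z -> split6 mu n%:R rho (pos z).
  apply: compact_uniform => //.
    move=> m n z mn [r [h1 h2]]; exists r; split => // x.
    by apply: le_trans (h2 x) _; rewrite ler_nat.
  move=> z Az; have [sz gz [p [tp pz pg]]] := pos_Hap z.
  (* Two errors of size [rho / 16], one from the approximation and one from moving [z] to [y], times
     the Sobolev factor 8 give [rho]. *)
  have rho16 : 0 < rho / 16 by rewrite divr_gt0.
  have hc := nlim_gnrm_sub (fun k => test_gsq (tp k)) gz pg.
  have [k hk] : exists k, gnrm (fun i x => partial i (p k) x - grd z i x) < rho / 16.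
    have := cvgr_lt _ hc _ rho16 => -[N _ hN]; by exists N; apply: hN => /=.
  have [K0 _ hK0] := test_bounded (tp k).
  exists (Num.truncn K0).+1; apply: filterS (near_dist z rho16) => y [h1 _].
  exists (fun x => pos y x - p k x); split; last first.
    move=> x; rewrite opprB addrC subrK.
    by apply: le_trans (hK0 x) _; apply/ltW; exact: truncnS_gt.
  have hy := HapB (pos_Hap y) (Hap_test (tp k)).
  apply: L6_le (Hap_L6 hy); first by rewrite mulr_ge0 ?gnrm_ge0.
  have a1 := le_lt_trans (grd_dist y z) h1.
  have b : gnrm (fun i x => grd y i x - partial i (p k) x) <=
     gnrm (fun i x => grd y i x - grd z i x) + gnrm (fun i x => partial i (p k) x - grd z i x).
    apply: le_trans (gnrmB (gsqB (grd_sq y) (grd_sq z)) (gsqB (test_gsq (tp k)) (grd_sq z))).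
    by apply/le_of_eq/eq_gnrm => i x; ring.
  nlra.
by exists n%:R.
Qed.

End eigen.
End phase.

Lemma small_pow4 (R : realType) (k ep : R) : 0 < k -> 0 < ep ->
  exists2 rho, 0 < rho & k * rho ^+ 4 <= ep.
Proof.
move=> k0 ep0; pose rho := Num.min 1 (ep / k).
have rho0 : 0 < rho by rewrite lt_min ltr01 divr_gt0.
have rho1 : rho <= 1 by rewrite ge_min lexx.
exists rho => //; rewrite mulrC -ler_pdivlMr//.
apply: le_trans (_ : rho <= _); last by rewrite ge_min lexx orbT.
by rewrite exprS ler_piMr ?(ltW rho0)// exprn_ile1// ltW.
Qed.

Section phi_estimates.
Context d (T : measurableType d) (R : realType) (mu : {measure set T -> \bar R}).
Local Notation sqint := (sqint mu).
Local Notation nrm := (nrm mu).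
Local Notation ig := (ig mu).
Local Notation J := (J mu).
Local Notation L6 := (L6 mu).
Implicit Types (u v r eta : T -> R).

(** Enlarging [b] and [c] by [dl] restores the positivity that [holder6] needs for its
    normalisation; then [dl] tends to 0. *)
Lemma holder6_ge0 (a b c : R) u v eta : 0 < a -> 0 <= b -> 0 <= c ->
  L6 a u -> L6 b v -> L6 c eta ->
  ig (fun x => u x ^+ 4 * `|v x| * `|eta x|) /\
  J (fun x => u x ^+ 4 * `|v x| * `|eta x|) <= a ^+ 4 * b * c.
Proof.
move=> a0 b0 c0 hu hv he.
have key (dl : R) : 0 < dl -> ig (fun x => u x ^+ 4 * `|v x| * `|eta x|) /\
    J (fun x => u x ^+ 4 * `|v x| * `|eta x|) <= a ^+ 4 * (b + dl) * (c + dl).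
  move=> d0; apply: holder6 => //; rewrite ?ltr_wpDl//.
    by apply: L6_le hv => //; rewrite lerDl ltW.
  by apply: L6_le he => //; rewrite lerDl ltW.
split; first by case: (key 1).
apply/ler_addgt0Pr => ep ep0.
pose k := a ^+ 4 * (b + c + 1).
have k0 : 0 < k by rewrite mulr_gt0 ?exprn_gt0// ltr_wpDl ?addr_ge0.
pose dl := Num.min 1 (ep / k).
have dl0 : 0 < dl by rewrite lt_min ltr01 divr_gt0.
have dl1 : dl <= 1 by rewrite ge_min lexx.
have dlk : k * dl <= ep by rewrite mulrC -ler_pdivlMr// ge_min lexx orbT.
apply: le_trans (key dl dl0).2 _.
rewrite -subr_ge0; apply: le_trans (_ : 0 <= ep - k * dl + a ^+ 4 * dl * (1 - dl)) _.
  by rewrite addr_ge0 ?subr_ge0// !mulr_ge0 ?exprn_ge0 ?subr_ge0// ltW.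
by rewrite /k; apply/le_of_eq; ring.
Qed.

Lemma pow4_add_le (s a b : R) : 0 <= a -> `|s| <= a + `|b| -> `|s| ^+ 4 <= 8 * a ^+ 4 + 8 * b ^+ 4.
Proof.
move=> a0 h; have -> : b ^+ 4 = `|b| ^+ 4 by rewrite -(even_pow 2).
set t := `|b| in h *; have t0 : 0 <= t by exact: normr_ge0.
have h4 : `|s| ^+ 4 <= (a + t) ^+ 4 by rewrite lerXn2r// nnegrE// addr_ge0.
apply: le_trans h4 _; rewrite -subr_ge0.
have -> : 8 * a ^+ 4 + 8 * t ^+ 4 - (a + t) ^+ 4 =
    (a - t) ^+ 2 * (7 * a ^+ 2 + 10 * (a * t) + 7 * t ^+ 2) by ring.
by rewrite mulr_ge0 ?sqr_ge0// !addr_ge0 ?mulr_ge0 ?sqr_ge0.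
Qed.

Variables (phi : R -> R) (c : R).
Hypothesis cphi : continuous phi.
Hypothesis c0 : 0 < c.
Hypothesis hphi : forall s t, `|phi s - phi t| <= c * `|s - t| * (1 + `|s| ^+ 4 + `|t| ^+ 4).

Lemma phi_meas u : measurable_fun setT u -> measurable_fun setT (phi \o u).
Proof.
by move=> mu'; apply: measurableT_comp => //; exact: continuous_measurable_fun.
Qed.

(** Since [|u| <= K + |r|], the weight [|u|^4] is at most [8 * K^4 + 8 * r^4], and likewise for [v].
    The constant part pairs in L^2; the part with the fourth power of a remainder pairs by Holder
    with exponents 4/6 + 1/6 + 1/6 and carries the factor [rho ^+ 4]. *)
Lemma phi_diff (K rho m n : R) u v eta : 0 <= K -> 0 < rho -> 0 <= m -> 0 <= n ->
  sqint u -> sqint v -> sqint eta -> split6 mu K rho u -> split6 mu K rho v ->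
  L6 m (fun x => u x - v x) -> L6 n eta ->
  ig (fun x => (phi (u x) - phi (v x)) * eta x) /\
  `|J (fun x => (phi (u x) - phi (v x)) * eta x)| <=
    c * (1 + 16 * K ^+ 4) * (nrm (fun x => u x - v x) * nrm eta) + 16 * c * rho ^+ 4 * (m * n).
Proof.
move=> K0 rho0 m0 n0 su sv se [r [hr ur]] [s [hs vs]] hw he.
have sw := sqintB su sv.
pose w x := u x - v x.
have [i1 j1] := holder6_ge0 rho0 m0 n0 hr hw he.
have [i2 j2] := holder6_ge0 rho0 m0 n0 hs hw he.
have i0 := igM (sqint_abs sw) (sqint_abs se).
pose k := c * (1 + 16 * K ^+ 4).
have k0 : 0 <= k by rewrite mulr_ge0 ?(ltW c0)// addr_ge0 ?mulr_ge0 ?exprn_ge0.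
pose dom x := k * (`|w x| * `|eta x|) +
  (8 * c) * (r x ^+ 4 * `|w x| * `|eta x| + s x ^+ 4 * `|w x| * `|eta x|).
have id : ig dom by apply: igD; [exact: igZ|apply: igZ; exact: igD].
have le x : `|(phi (u x) - phi (v x)) * eta x| <= dom x.
  rewrite normrM; apply: le_trans (ler_wpM2r (normr_ge0 _) (hphi _ _)) _.
  have hu : `|u x| ^+ 4 <= 8 * K ^+ 4 + 8 * r x ^+ 4.
    apply: pow4_add_le => //; rewrite -lerBlDr; apply: le_trans (ur x).
    exact: lerB_dist.
  have hv : `|v x| ^+ 4 <= 8 * K ^+ 4 + 8 * s x ^+ 4.
    apply: pow4_add_le => //; rewrite -lerBlDr; apply: le_trans (vs x).
    exact: lerB_dist.
  have -> : dom x = c * `|w x| * (1 + (8 * K ^+ 4 + 8 * r x ^+ 4) + (8 * K ^+ 4 + 8 * s x ^+ 4)) * `|eta x|.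
    by rewrite /dom /k; ring.
  rewrite ler_wpM2r// ler_wpM2l ?mulr_ge0 ?(ltW c0)//.
  by apply: lerD => //; rewrite lerD2l.
have mf : measurable_fun setT (fun x => (phi (u x) - phi (v x)) * eta x).
  apply: measurable_funM; last exact: (sqint_meas se).
  by apply: measurable_funB; apply: phi_meas; [exact: (sqint_meas su)|exact: (sqint_meas sv)].
have ii := ig_le mf le id; split => //.
apply: le_trans (J_abs ii) _; apply: le_trans (J_le (ig_abs ii) id le) _.
rewrite JD; [|exact: igZ|by apply: igZ; exact: igD].
rewrite JZ// JZ; last exact: igD.
rewrite JD//; apply: lerD.
  rewrite ler_wpM2l//.
  have := ip_le (sqint_abs sw) (sqint_abs se).
  by rewrite !nrm_abs.
have -> : 16 * c * rho ^+ 4 * (m * n) = 8 * c * (rho ^+ 4 * m * n + rho ^+ 4 * m * n) by ring.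
by rewrite ler_wpM2l ?mulr_ge0 ?(ltW c0)// lerD.
Qed.

End phi_estimates.

(** * The nonlinear term *)

Section phi_phase.
Context {R : realType} (Omega : smooth_bounded_domain R).
Local Notation mu := (lebesgue_on Omega).
Local Notation sqint := (sqint mu).
Local Notation ip := (ip mu).
Local Notation nrm := (nrm mu).
Local Notation ig := (ig mu).
Local Notation X := (calH Omega 0).
Local Notation gnrm := (gnrm Omega).
Local Notation Hap := (Hap Omega).
Variables (phi : R -> R) (c : R).
Hypothesis cphi : continuous phi.
Hypothesis c0 : 0 < c.
Hypothesis hphi : forall s t, `|phi s - phi t| <= c * `|s - t| * (1 + `|s| ^+ 4 + `|t| ^+ 4).

(** [phi_diff] against the zero function, with [K = 0] and [u] as its own remainder, so without any
    smallness. It makes [ip (phi \o u)] a bounded functional on H^1_0, and its integrability part is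
    what justifies linearity in [eta] later. *)
Lemma phi_pair u g : Hap u g -> exists2 C, 0 <= C & forall eta deta, Hap eta deta ->
  ig (fun x => phi (u x) * eta x) /\ `|ip (phi \o u) eta| <= C * (nrm eta + gnrm deta).
Proof.
move=> hu; have [su sg _] := hu; have lu := Hap_L6 hu.
(* The added 1 keeps [rho] positive even if the gradient vanishes. *)
pose rho := 8 * gnrm g + 1.
have rho0 : 0 < rho by rewrite ltr_wpDl// mulr_ge0 ?gnrm_ge0.
have u0 : L6 mu rho u by apply: L6_le lu; rewrite ?mulr_ge0 ?gnrm_ge0 ?lerDl.
have z0 : L6 mu rho (fun=> 0 : R).
  have := L6Z 0 u0; rewrite normr0 mul0r (_ : (fun x => 0 * u x) = fun=> 0).
    by apply: L6_le => //; exact: ltW.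
  by apply/funext => x; rewrite mul0r.
have s0 := sqint0 mu.
pose C1 := c * nrm u + `|phi 0| * nrm (cst 1 : R3 R -> R).
pose C2 := 16 * c * rho ^+ 4 * (rho * 8).
have C10 : 0 <= C1 by rewrite addr_ge0 ?mulr_ge0 ?nrm_ge0 ?(ltW c0).
have C20 : 0 <= C2 by rewrite !mulr_ge0 ?exprn_ge0 ?(ltW c0) ?(ltW rho0).
exists (C1 + C2); first exact: addr_ge0.
move=> eta deta he; have [se sd _] := he.
have s1 : sqint (cst 1) := sqint_cst Omega 1.
have sp : split6 mu 0 rho u by exists u; split => // x; rewrite subrr normr0.
have sz : split6 mu 0 rho (fun=> 0) by exists (fun=> 0); split => // x; rewrite subrr normr0.
have le := Hap_L6 he.
have uL : L6 mu rho (fun x => u x - 0).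
  by rewrite (_ : (fun x => _) = u)//; apply/funext => x; rewrite subr0.
have [i1 j1] := phi_diff cphi c0 hphi (lexx 0) rho0 (ltW rho0) (mulr_ge0 (ler0n _ 8) (gnrm_ge0 Omega deta))
   su s0 se sp sz uL le.
have i2 := igM s1 se.
have eqf x : phi (u x) * eta x = (phi (u x) - phi 0) * eta x + phi 0 * (cst 1 x * eta x).
  by rewrite /=; ring.
split; first by apply: (eq_ig (f := fun x => (phi (u x) - phi 0) * eta x + phi 0 * (cst 1 x * eta x))) => //; apply: igD => //; exact: igZ.
rewrite [ip _ _](eq_J mu eqf) JD//; last exact: igZ.
rewrite JZ//; apply: le_trans (ler_normD _ _) _.
have b2 : `|phi 0 * J mu (fun x => cst 1 x * eta x)| <= `|phi 0| * (nrm (cst 1) * nrm eta).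
  by rewrite normrM ler_wpM2l//; exact: cauchy_schwarz.
have en : nrm (fun x => u x - 0) = nrm u by apply: eq_nrm => x; rewrite subr0.
rewrite en in j1.
apply: le_trans (lerD j1 b2) _.
have n0 := nrm_ge0 mu eta; have g0 := gnrm_ge0 Omega deta.
rewrite -subr_ge0; apply: le_trans (_ : 0 <= C1 * gnrm deta + C2 * nrm eta) _.
  by apply: addr_ge0; exact: mulr_ge0.
by rewrite /C1 /C2; apply/le_of_eq; ring.
Qed.

Lemma phi_pairB u g eta deta eta' deta' : Hap u g -> Hap eta deta -> Hap eta' deta' ->
  ip (phi \o u) (fun x => eta x - eta' x) = ip (phi \o u) eta - ip (phi \o u) eta'.
Proof.
move=> hu he he'; have [C _ hC] := phi_pair hu.
rewrite -JB; [|exact: (hC _ _ he).1|exact: (hC _ _ he').1].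
by apply: eq_J => x; rewrite mulrBr.
Qed.

Section attractor_phi.
Variables (A : set X) (grd : X -> 'I_3 -> R3 R -> R).
Hypothesis posH : forall z, Hap (pos z) (grd z).
Hypothesis spl : forall rho, 0 < rho -> exists2 K, 0 <= K & forall z, A z -> split6 mu K rho (pos z).

Lemma phi_small ep : 0 < ep -> exists2 C, 0 <= C & forall y z eta deta, A y -> A z -> Hap eta deta ->
  `|ip (phi \o pos y) eta - ip (phi \o pos z) eta| <=
   C * (nrm (fun x => pos y x - pos z x) * nrm eta) +
   ep * (gnrm (fun i x => grd y i x - grd z i x) * gnrm deta).
Proof.
(* The 16 comes from [phi_diff], and each 8 from Sobolev's inequality, applied once to the
   displacement and once to [eta]. *)
move=> ep0; have k0 : 0 < 16 * 8 * 8 * c by rewrite mulr_gt0// !mulr_gt0.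
have [rho rho0 rhoe] := small_pow4 k0 ep0.
have [K K0 hK] := spl rho0.
exists (c * (1 + 16 * K ^+ 4)); first by rewrite mulr_ge0 ?(ltW c0)// addr_ge0 ?mulr_ge0 ?exprn_ge0.
move=> y z eta deta Ay Az he; have [se sd _] := he.
have hd := HapB (posH y) (posH z).
have [C _ hC] := phi_pair (posH y); have [C' _ hC'] := phi_pair (posH z).
have [i1 j1] := phi_diff cphi c0 hphi K0 rho0 (mulr_ge0 (ler0n _ 8) (gnrm_ge0 Omega _))
  (mulr_ge0 (ler0n _ 8) (gnrm_ge0 Omega deta))
  (pos_sqint y) (pos_sqint z) se (hK y Ay) (hK z Az) (Hap_L6 hd) (Hap_L6 he).
rewrite -JB; [|exact: (hC _ _ he).1|exact: (hC' _ _ he).1].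
rewrite (eq_J mu (g := fun x => (phi (pos y x) - phi (pos z x)) * eta x)); last first.
  by move=> x; rewrite /= mulrBl.
apply: le_trans j1 _; rewrite lerD2l.
set p := gnrm _; set q := gnrm _.
have -> : 16 * c * rho ^+ 4 * (8 * p * (8 * q)) = 16 * 8 * 8 * c * rho ^+ 4 * (p * q) by ring.
by rewrite ler_wpM2r// mulr_ge0 ?gnrm_ge0.
Qed.

End attractor_phi.
End phi_phase.

(** * Growth and convexity of the truncated powers *)

Section truncated_powers.
Context {R : realType}.
Implicit Types (s t dl : R).

Lemma den_gt0 dl s : 0 <= dl -> 0 < 1 + dl * s ^+ 2.
Proof. by move=> d0; rewrite ltr_wpDr// mulr_ge0 ?sqr_ge0. Qed.

Lemma HF_continuous dl : 0 <= dl -> continuous (HF dl).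
Proof.
move=> d0 s; rewrite /HF; apply: cvgM; first exact: exprn_continuous.
apply: cvgV; first by rewrite gt_eqF// den_gt0.
by apply: cvgD; [exact: cvg_cst|apply: cvgMr; exact: exprn_continuous].
Qed.

(** Makes the integral of the cube of [HF dl] finite by the L^6 bound, with a constant that blows up
    as [dl] tends to 0. *)
Lemma HF_le_sqr dl s : 0 < dl -> HF dl s <= dl^-1 * s ^+ 2.
Proof.
move=> d0; rewrite /HF ler_pdivrMr; last exact: den_gt0 (ltW d0).
rewrite mulrDr mulr1.
rewrite (_ : dl^-1 * s ^+ 2 * (dl * s ^+ 2) = s ^+ 4); last by field; rewrite gt_eqF.
by rewrite lerDr; apply: mulr_ge0; [rewrite invr_ge0 ltW|exact: sqr_ge0].
Qed.

Lemma abs_PsiF dl s : 0 <= dl -> `|PsiF dl s| = `|s| ^+ 3 / (1 + dl * `|s| ^+ 2).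
Proof.
move=> d0; rewrite /PsiF normrM normrX normrV ?unitfE ?gt_eqF ?den_gt0//.
by rewrite (gtr0_norm (den_gt0 s d0)) real_normK ?num_real.
Qed.

Lemma abs_HF dl s : HF dl s = `|s| * (`|s| ^+ 3 / (1 + dl * `|s| ^+ 2)).
Proof. by rewrite /HF -(even_pow 2) mulrA -exprS real_normK ?num_real. Qed.

(** [|s|^3 / (1 + dl * s^2)] increases with [|s|], so replacing the smaller of [|s|] and [|t|] by
    the larger turns the product into a value of [HF]. *)
Lemma mul_PsiF_le dl s t : 0 <= dl -> `|s| * `|PsiF dl t| <= HF dl s + HF dl t.
Proof.
move=> d0; rewrite abs_PsiF//.
have [st|/ltW ts] := leP `|s| `|t|.
  apply: (@le_trans _ _ (HF dl t)); last by rewrite lerDr HF_ge0.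
  by rewrite abs_HF ler_wpM2r// divr_ge0 ?exprn_ge0// ltW// den_gt0.
apply: (@le_trans _ _ (HF dl s)); last by rewrite lerDl HF_ge0.
rewrite abs_HF ler_wpM2l//; move: ts; have := normr_ge0 t; have := normr_ge0 s.
move: `|s| `|t| => a b a0 b0 ba.
rewrite ler_pdivrMr ?den_gt0// mulrAC ler_pdivlMr ?den_gt0//.
rewrite -subr_ge0 (_ : _ - _ = (a - b) * ((a ^+ 2 + a * b + b ^+ 2) + dl * (a ^+ 2 * b ^+ 2))); last by ring.
by rewrite mulr_ge0 ?subr_ge0// !addr_ge0 ?mulr_ge0 ?exprn_ge0.
Qed.

(** A split at [|s| = L]: beyond it [HF] exceeds [L] times [|PsiF|], below it the cube is at most
    [L ^+ 3]. A large [L] makes the coefficient of [HF] small. *)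
Lemma PsiF_le dl s L : 0 <= dl -> 0 < L -> `|PsiF dl s| <= L^-1 * HF dl s + L ^+ 3.
Proof.
move=> d0 L0; rewrite abs_PsiF// abs_HF.
have q0 : 0 <= `|s| ^+ 3 / (1 + dl * `|s| ^+ 2) by rewrite divr_ge0 ?exprn_ge0// ltW// den_gt0.
have [sL|Ls] := leP `|s| L.
  apply: (@le_trans _ _ (L ^+ 3)); last by rewrite lerDr; apply: mulr_ge0; [rewrite invr_ge0 ltW|exact: mulr_ge0].
  apply: (@le_trans _ _ (`|s| ^+ 3)); last by rewrite lerXn2r ?nnegrE// ltW.
  by rewrite ler_pdivrMr ?den_gt0// ler_peMr ?exprn_ge0// lerDl mulr_ge0 ?sqr_ge0.
apply: (@le_trans _ _ (L^-1 * (`|s| * (`|s| ^+ 3 / (1 + dl * `|s| ^+ 2))))); last by rewrite lerDl exprn_ge0// ltW.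
by rewrite [leRHS]mulrA ler_peMl// ler_pdivlMl// mulr1 ltW.
Qed.

(** [HF dl] is m^2 / (1 + dl m) at [m = s ^+ 2], a convex increasing function of a convex one.
    Convexity is what lets a bound on the quotient [p] pass to the position at the later time. *)
Lemma HF_convex dl h s t : 0 <= dl -> 0 <= h <= 1 ->
  HF dl ((1 - h) * s + h * t) <= (1 - h) * HF dl s + h * HF dl t.
Proof.
move=> d0 /andP[h0 h1]; have k0 : 0 <= 1 - h by rewrite subr_ge0.
pose m := (1 - h) * s ^+ 2 + h * t ^+ 2.
have m0 : 0 <= m by apply: addr_ge0; apply: mulr_ge0 => //; exact: sqr_ge0.
have ms : ((1 - h) * s + h * t) ^+ 2 <= m.
  rewrite -subr_ge0 (_ : _ - _ = h * (1 - h) * (s - t) ^+ 2); last by rewrite /m; ring.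
  by apply: mulr_ge0; [exact: mulr_ge0|exact: sqr_ge0].
apply: (@le_trans _ _ (m ^+ 2 / (1 + dl * m))).
  rewrite /HF (_ : (_ + _) ^+ 4 = (((1 - h) * s + h * t) ^+ 2) ^+ 2); last by rewrite -exprM.
  move: ms; have := sqr_ge0 ((1 - h) * s + h * t); move: (_ ^+ 2) => a a0 am.
  have da : 0 < 1 + dl * a by rewrite ltr_wpDr// mulr_ge0.
  have dm : 0 < 1 + dl * m by rewrite ltr_wpDr// mulr_ge0.
  rewrite ler_pdivrMr// mulrAC ler_pdivlMr//.
  rewrite -subr_ge0 (_ : _ - _ = (m - a) * (m + a + dl * (m * a))); last by ring.
  apply: mulr_ge0; first by rewrite subr_ge0.
  apply: addr_ge0; first exact: addr_ge0.
  by apply: mulr_ge0 => //; exact: mulr_ge0.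
have p0 := den_gt0 s d0; have q0 := den_gt0 t d0.
have dm : 0 < 1 + dl * m by rewrite ltr_wpDr// mulr_ge0.
rewrite ler_pdivrMr// -subr_ge0 /HF.
rewrite (_ : _ - _ = (1 - h) * h * (s ^+ 2 - t ^+ 2) ^+ 2 / ((1 + dl * s ^+ 2) * (1 + dl * t ^+ 2))).
  apply: divr_ge0; last by apply: mulr_ge0; exact: ltW.
  by apply: mulr_ge0; [exact: mulr_ge0|exact: sqr_ge0].
by rewrite /m; field; rewrite !gt_eqF.
Qed.

Lemma HF3_convex dl h s t : 0 <= dl -> 0 <= h <= 1 ->
  HF dl ((1 - h) * s + h * t) ^+ 3 <= (1 - h) * HF dl s ^+ 3 + h * HF dl t ^+ 3.
Proof.
move=> d0 h01; have := HF_convex s t d0 h01; have := HF_ge0 d0 ((1 - h) * s + h * t).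
have := HF_ge0 d0 s; have := HF_ge0 d0 t; move: (HF _ _) (HF _ s) (HF _ t) => w a b b0 a0 w0 le.
move: h01 => /andP[h0 h1]; have k0 : 0 <= 1 - h by rewrite subr_ge0.
apply: (@le_trans _ _ (((1 - h) * a + h * b) ^+ 3)).
  by rewrite lerXn2r ?nnegrE// addr_ge0 ?mulr_ge0.
rewrite -subr_ge0 (_ : _ - _ = h * (1 - h) * (a - b) ^+ 2 * ((1 + (1 - h)) * a + (1 + h) * b)); last by ring.
apply: mulr_ge0; first by apply: mulr_ge0; [exact: mulr_ge0|exact: sqr_ge0].
by apply: addr_ge0; apply: mulr_ge0 => //; exact: addr_ge0.
Qed.

End truncated_powers.

(** * One step of the L^12 estimate *)

Section L12_step.
Context {R : realType} (Omega : smooth_bounded_domain R).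
Local Notation mu := (lebesgue_on Omega).
Local Notation sqint := (sqint mu).
Local Notation ip := (ip mu).
Local Notation nrm := (nrm mu).
Local Notation ig := (ig mu).
Local Notation J := (J mu).
Local Notation L6 := (L6 mu).
Local Notation gnrm := (gnrm Omega).
Local Notation gip := (gip Omega).
Local Notation Hap := (Hap Omega).
Local Notation test := (test_function Omega).
Variables (phi : R -> R) (c : R).
Hypothesis cphi : continuous phi.
Hypothesis c0 : 0 < c.
Hypothesis hphi : forall s t, `|phi s - phi t| <= c * `|s - t| * (1 + `|s| ^+ 4 + `|t| ^+ 4).

Lemma phi_growth s : `|phi s| <= `|phi 0| + c * `|s| * (1 + `|s| ^+ 4).
Proof.
have := hphi s 0; rewrite subr0 normr0 expr0n addr0 => h.
by rewrite -lerBlDl; apply: le_trans h; exact: lerB_dist.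
Qed.

(** Square roots turn L^3 bounds into L^6 bounds, so that [holder6_ge0] also covers the exponents
    2/3 + 1/3. *)
Lemma L6_sqrt (b : R) (v : R3 R -> R) : 0 <= b -> (forall x, 0 <= v x) -> measurable_fun setT v ->
  ig (fun x => v x ^+ 3) -> J (fun x => v x ^+ 3) <= b ^+ 3 ->
  L6 (Num.sqrt b) (fun x => Num.sqrt (v x)).
Proof.
move=> b0 v0 mv iv jv.
have E x : Num.sqrt (v x) ^+ 6 = v x ^+ 3 by rewrite (exprM _ 2 3) sqr_sqrtr.
split.
- apply: measurableT_comp mv; apply: continuous_measurable_fun; exact: sqrt_continuous.
- by apply: eq_ig iv => x; rewrite E.
- by rewrite (exprM _ 2 3) sqr_sqrtr// (eq_J mu E).
Qed.

Lemma pow4_mul_le (rho b : R) (r v : R3 R -> R) : 0 < rho -> 0 <= b -> (forall x, 0 <= v x) ->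
  measurable_fun setT v -> L6 rho r -> ig (fun x => v x ^+ 3) -> J (fun x => v x ^+ 3) <= b ^+ 3 ->
  ig (fun x => r x ^+ 4 * v x) /\ J (fun x => r x ^+ 4 * v x) <= rho ^+ 4 * b.
Proof.
move=> rho0 b0 v0 mv hr iv jv; have hs := L6_sqrt b0 v0 mv iv jv.
have E x : r x ^+ 4 * `|Num.sqrt (v x)| * `|Num.sqrt (v x)| = r x ^+ 4 * v x.
  by rewrite -mulrA -expr2 real_normK ?num_real// sqr_sqrtr.
have [h1 h2] := holder6_ge0 rho0 (sqrtr_ge0 b) (sqrtr_ge0 b) hr hs hs.
split; first exact: eq_ig h1.
by rewrite -(eq_J mu E); apply: le_trans h2 _; rewrite -mulrA -expr2 sqr_sqrtr.
Qed.

(* Holder on a domain of finite measure: [m ^+ 6] bounds the measure of the domain. *)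
Lemma nrm_le_cube : exists2 m : R, 0 <= m & forall (b : R) (v : R3 R -> R), 0 <= b -> (forall x, 0 <= v x) ->
  sqint v -> ig (fun x => v x ^+ 3) -> J (fun x => v x ^+ 3) <= b ^+ 3 -> nrm v <= m * b.
Proof.
pose m := J (cst 1) + 1.
have j1 : 0 <= J (cst 1) by exact: J_ge0.
have m1 : 1 <= m by rewrite lerDr.
have m0 : 0 <= m by exact: le_trans m1.
exists m => // b v b0 v0 sv iv jv.
have one : L6 m (cst 1).
  split => //; first exact: (eq_ig _ (ig_cst Omega (1 ^+ 6))).
  rewrite (eq_J mu (g := cst 1)); last by move=> x; rewrite /= expr1n.
  by apply: (@le_trans _ _ m); [rewrite lerDl|exact: ler_eXnr].
have hs (d : R) : 0 < d -> nrm v ^+ 2 <= (b + d) ^+ 2 * m * m.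
  move=> d0; have bd0 : 0 < b + d by rewrite ltr_wpDl.
  have jd : J (fun x => v x ^+ 3) <= (b + d) ^+ 3.
    by apply: le_trans jv _; rewrite lerXn2r ?nnegrE ?(ltW bd0)// lerDl ltW.
  have hs := L6_sqrt (ltW bd0) v0 (sqint_meas sv) iv jd.
  have sb0 : 0 < Num.sqrt (b + d) by rewrite sqrtr_gt0.
  have [_] := holder6_ge0 sb0 m0 m0 hs one one.
  rewrite (exprM _ 2 2) sqr_sqrtr ?(ltW bd0)// => h; rewrite nrm_sq ipE; apply: le_trans h.
  apply/le_of_eq; apply: eq_J => x.
  by rewrite (exprM _ 2 2) sqr_sqrtr//= normr1 !mulr1.
have hs' (d : R) : 0 < d -> nrm v <= m * (b + d).
  move=> d0; rewrite -(@ler_pXn2r _ 2)// ?nnegrE ?nrm_ge0 ?mulr_ge0 ?addr_ge0 ?(ltW d0)//.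
  by apply: le_trans (hs d d0) _; apply/le_of_eq; ring.
apply/ler_addgt0Pr => ep ep0.
have mp : 0 < m by exact: lt_le_trans m1.
apply: le_trans (hs' (ep / m) _) _; first exact: divr_gt0.
by rewrite mulrDr [m * (ep / m)]mulrC divfK ?gt_eqF.
Qed.

Variables (K rho R0 C1 C2 : R).
Hypothesis K0 : 0 <= K.
Hypothesis rho0 : 0 < rho.
Hypothesis rhoc : 1024 * c * rho ^+ 4 <= 4^-1.
Hypothesis R00 : 0 <= R0.
Hypothesis C10 : 0 <= C1.
Hypothesis C20 : 0 <= C2.

(** The quartic growth leaves [r ^+ 4 * |u| * |PsiF psi|]. By [mul_PsiF_le] it is dominated by
    [r ^+ 4] times the two values of [HF], whose L^3 norms are at most [M] and [64 * D]. The rest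
    pairs in L^2 with [PsiF psi]. *)
Lemma phi_PsiF_bound dl M D u psi : 0 < dl -> 0 <= M -> 0 <= D -> test psi ->
  sqint u -> nrm u <= R0 -> split6 mu K rho u ->
  ig (fun x => HF dl (u x) ^+ 3) -> J (fun x => HF dl (u x) ^+ 3) <= M ^+ 3 ->
  J (fun x => HF dl (psi x) ^+ 3) <= (64 * D) ^+ 3 ->
  `|ip (phi \o u) (fun x => PsiF dl (psi x))| <=
    (`|phi 0| * nrm (cst 1) + c * (1 + 8 * K ^+ 4) * R0) * nrm (fun x => PsiF dl (psi x))
    + 8 * c * rho ^+ 4 * (M + 64 * D).
Proof.
move=> d0 M0 D0 tp su hu [r [hr ur]] iu ju jp.
have tP := test_Psi (ltW d0) tp; have sP := test_sqint tP; have mP := test_measurable tP.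
have mu_ := sqint_meas su.
have tH := test_H (ltW d0) tp.
have mHu : measurable_fun setT (fun x => HF dl (u x)).
  by apply: measurableT_comp mu_; apply: continuous_measurable_fun; exact: HF_continuous (ltW d0).
have [i1 j1] := pow4_mul_le rho0 M0 (fun x => HF_ge0 (ltW d0) (u x)) mHu hr iu ju.
have [i2 j2] := pow4_mul_le rho0 (mulr_ge0 (ler0n _ 64) D0) (fun x => HF_ge0 (ltW d0) (psi x))
   (test_measurable tH) hr (test_ig_pow 3 tH) jp.
have s1 : sqint (cst 1) := sqint_cst Omega 1.
pose P x := PsiF dl (psi x).
have i3 := igM (sqint_abs s1) (sqint_abs sP); have i4 := igM (sqint_abs su) (sqint_abs sP).
pose k := c * (1 + 8 * K ^+ 4).
have k0 : 0 <= k by apply: mulr_ge0; [exact: ltW|rewrite addr_ge0 ?mulr_ge0 ?exprn_ge0].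
pose dom x := `|phi 0| * (`|cst 1 x| * `|P x|) + k * (`|u x| * `|P x|)
  + (8 * c) * (r x ^+ 4 * HF dl (u x) + r x ^+ 4 * HF dl (psi x)).
have ia : ig (fun x => `|phi 0| * (`|cst 1 x| * `|P x|)) by exact: igZ.
have ib : ig (fun x => k * (`|u x| * `|P x|)) by exact: igZ.
have iab := igD ia ib.
have ic : ig (fun x => (8 * c) * (r x ^+ 4 * HF dl (u x) + r x ^+ 4 * HF dl (psi x))).
  by apply: igZ; exact: igD.
have idom : ig dom by exact: igD iab ic.
have le x : `|phi (u x) * P x| <= dom x.
  rewrite normrM; apply: le_trans (ler_wpM2r (normr_ge0 _) (phi_growth _)) _.
  have h4 : `|u x| ^+ 4 <= 8 * K ^+ 4 + 8 * r x ^+ 4.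
    apply: pow4_add_le => //; rewrite -lerBlDr; apply: le_trans (ur x).
    exact: lerB_dist.
  have hY := mul_PsiF_le (u x) (psi x) (ltW d0).
  have r4 : 0 <= r x ^+ 4 by exact: exprn_even_ge0.
  have a1 : c * `|u x| * (1 + `|u x| ^+ 4) * `|P x| <=
      c * `|u x| * (1 + (8 * K ^+ 4 + 8 * r x ^+ 4)) * `|P x|.
    rewrite ler_wpM2r// ler_wpM2l ?lerD2l//; apply: mulr_ge0 => //; exact: ltW.
  have a2 : 8 * c * r x ^+ 4 * (`|u x| * `|P x|) <= 8 * c * r x ^+ 4 * (HF dl (u x) + HF dl (psi x)).
    apply: ler_wpM2l => //; apply: mulr_ge0 => //; apply: mulr_ge0 => //; exact: ltW.
  rewrite mulrDl; apply: le_trans (lerD (lexx _) a1) _.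
  apply: (@le_trans _ _ (`|phi 0| * `|P x| + k * (`|u x| * `|P x|) + 8 * c * r x ^+ 4 * (`|u x| * `|P x|))).
    by rewrite /k; apply/le_of_eq; ring.
  apply: le_trans (lerD (lexx _) a2) _.
  rewrite /dom /= normr1 mul1r; apply/le_of_eq; ring.
have iP : ig (fun x => phi (u x) * P x).
  by apply: ig_le le idom; apply: measurable_funM => //; exact: phi_meas.
apply: le_trans (J_abs iP) _; apply: le_trans (J_le (ig_abs iP) idom le) _.
rewrite (JD iab ic) (JD ia ib) (JZ _ i3) (JZ _ i4) (JZ _ (igD i1 i2)) (JD i1 i2).
have b1 : J (fun x => `|cst 1 x| * `|P x|) <= nrm (cst 1) * nrm P.
  by have := ip_le (sqint_abs s1) (sqint_abs sP); rewrite !nrm_abs.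
have b2 : J (fun x => `|u x| * `|P x|) <= R0 * nrm P.
  have := ip_le (sqint_abs su) (sqint_abs sP); rewrite !nrm_abs => h; apply: le_trans h _.
  by rewrite ler_wpM2r ?nrm_ge0.
apply: lerD.
  have e1 := ler_wpM2l (normr_ge0 (phi 0)) b1; have e2 := ler_wpM2l k0 b2.
  apply: (@le_trans _ _ ((`|phi 0| * nrm (cst 1) + k * R0) * nrm P)); last exact: lexx.
  apply: le_trans (lerD e1 e2) _.
  by apply/le_of_eq; nring.
rewrite -(mulrA (8 * c)); apply: ler_wpM2l; first by apply: mulr_ge0 => //; exact: ltW.
by rewrite mulrDr; apply: lerD.
Qed.

(** The weak inequality for [p] is tested with [PsiF dl psi], for test functions [psi] approaching
    [p]. The resulting energy [D] controls the L^3 norm of [HF dl psi] through [sobolev_test_H], and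
    Fatou returns to [p]. What matters is that the coefficient 1/4 of [M] and the constants [C6],
    [C7] depend neither on [dl] nor on [h]. *)
Lemma L12_step : exists C6 C7, [/\ 0 <= C6, 0 <= C7 &
  forall dl h M u p gp, 0 < dl -> 0 < h -> 0 <= M ->
  sqint u -> nrm u <= R0 -> split6 mu K rho u -> Hap p gp ->
  ig (fun x => HF dl (u x) ^+ 3) -> J (fun x => HF dl (u x) ^+ 3) <= M ^+ 3 ->
  (forall eta, test eta -> `|gip gp (fun i => partial i eta) + ip (phi \o u) eta| <=
      C1 * nrm eta + h * C2 * gnrm (fun i => partial i eta)) ->
  ig (fun x => HF dl (p x) ^+ 3) /\
  J (fun x => HF dl (p x) ^+ 3) <= (4^-1 * M + C6 + C7 * (h ^+ 2 / dl)) ^+ 3].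
Proof.
have [m m0 hm] := nrm_le_cube.
pose n1 := nrm (cst 1); have n10 : 0 <= n1 by exact: nrm_ge0.
pose C4 := C1 + (`|phi 0| * n1 + c * (1 + 8 * K ^+ 4) * R0).
have C40 : 0 <= C4.
  apply: addr_ge0 => //; apply: addr_ge0; first exact: mulr_ge0.
  by apply: mulr_ge0 => //; apply: mulr_ge0; [exact: ltW|rewrite addr_ge0 ?mulr_ge0 ?exprn_ge0].
(* Large enough that the part of [C4 * nrm P] controlled by [HF] is at most [D / 8]; the added 1
   keeps [L] positive. *)
pose L := 64 * 8 * m * C4 + 1.
have L0 : 0 < L by rewrite ltr_wpDl// mulr_ge0// mulr_ge0.
have LC : L^-1 * (64 * m * C4) <= 8^-1.
  rewrite ler_pdivrMl// (_ : 64 * m * C4 = 64 * 8 * m * C4 * 8^-1); last by field.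
  by rewrite ler_wpM2r// lerDl.
exists (2 * 64 * (C4 * (L ^+ 3 * n1))), (2 * 64 * (3 * (C2 + 1) ^+ 2)); split.
- by apply: mulr_ge0 => //; apply: mulr_ge0 => //; apply: mulr_ge0 => //; apply: exprn_ge0; exact: ltW.
- by apply: mulr_ge0 => //; apply: mulr_ge0 => //; exact: sqr_ge0.
move=> dl h M u p gp d0 h0 M0 su hu hs hp iu ju H.
have [sp sgp [q [tq qp qg]]] := hp.
have hd := HF_continuous (ltW d0).
have tH n := test_H (ltW d0) (tq n).
have T0 s : 0 <= HF dl s by exact: HF_ge0 (ltW d0) s.
apply: (@fatou_nlim _ _ _ mu q p (fun s => HF dl s ^+ 3)) => //.
- by move=> n; exact: test_sqint.
- move=> s; apply: (@continuous_comp _ _ _ (HF dl) (fun t => t ^+ 3)); first exact: hd.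
  exact: exprn_continuous.
- by move=> s; apply: exprn_ge0.
- by move=> n; exact: (test_ig_pow 3 (tH n)).
have cg := nlim_gnrm_sub (fun n => test_gsq (tq n)) sgp qg.
(* Precision [h] in the gradient lets the approximation error merge with the residual term in
   [h * C2]. *)
have near_h : \forall n \near \oo, gnrm (fun i x => partial i (q n) x - gp i x) < h.
  exact: (cvgr_lt _ cg _ h0).
apply: filterS near_h => n hn; set psi := q n in hn *.
have tp : test psi by exact: tq.
pose D := \sum_(i < 3) J (fun x => dPsiF dl (psi x) * partial i psi x ^+ 2).
have jp := sobolev_test_H (ltW d0) tp; rewrite -/D in jp.
have tP := test_Psi (ltW d0) tp; have sP := test_sqint tP; have gP := test_gsq tP.
pose P x := PsiF dl (psi x).
pose dP i := partial i P.
have dPE i x : dP i x = dPsiF dl (psi x) * partial i psi x.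
  by rewrite /dP /P (@partial_Psi _ Omega _ (ltW d0) psi i x tp).
have dps s : 0 <= dPsiF dl s by exact: dPsiF_ge0 (ltW d0) s.
have D0 : 0 <= D.
  by apply: sumr_ge0 => i _; apply: J_ge0 => x; apply: mulr_ge0 => //; exact: sqr_ge0.
have DE : gip (fun i => partial i psi) dP = D.
  by apply: eq_bigr => i _; apply: eq_J => x; rewrite dPE; ring.
have gD : gnrm dP ^+ 2 <= 3 / dl * D.
  rewrite gnrm_sq /gip mulr_sumr; apply: ler_sum => i _.
  have iD : ig (fun x => dPsiF dl (psi x) * partial i psi x ^+ 2).
    apply: eq_ig (igM (test_gsq tp i) (gP i)) => x.
    by rewrite -/P -/(dP i) dPE; ring.
  rewrite ipE -(JZ _ iD); apply: J_le; first by case: (gP i).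
    exact: igZ.
  move=> x; rewrite dPE exprMn [_ ^+ 2]expr2 -mulrA ler_wpM2r//.
    by apply: mulr_ge0 => //; exact: sqr_ge0.
  exact: (dPsiF_le (ltW d0) _ d0).
have hphiP := phi_PsiF_bound d0 M0 D0 tp su hu hs iu ju jp.
have hw := H _ tP; rewrite -/P -/dP in hw hphiP.
have b1 : gip gp dP = D - gip (fun i x => partial i psi x - gp i x) dP.
  have spsi := test_gsq tp.
  by rewrite gipBl// DE subKr.
have b2 : `|gip (fun i x => partial i psi x - gp i x) dP| <= h * gnrm dP.
  apply: le_trans (gip_abs _ gP) _; first by apply: gsqB => //; exact: test_gsq.
  by rewrite ler_wpM2r ?gnrm_ge0// ltW.
have b3 : nrm P <= L^-1 * (m * (64 * D)) + L ^+ 3 * n1.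
  have sH := test_sqint (tH n).
  have s1 : sqint (cst 1) := sqint_cst Omega 1.
  apply: (@le_trans _ _ (nrm (fun x => L^-1 * HF dl (psi x) + L ^+ 3 * cst 1 x))).
    apply: le_nrm => //; first by apply: sqintD; exact: sqintZ.
    move=> x; apply: le_trans (PsiF_le (psi x) (ltW d0) L0) _.
    by rewrite /= mulr1; exact: ler_norm.
  apply: le_trans (nrmD (sqintZ _ sH) (sqintZ _ s1)) _.
  rewrite (nrmZ _ sH) (nrmZ _ s1) !ger0_norm ?invr_ge0 ?exprn_ge0 ?(ltW L0)//.
  rewrite lerD2r ler_wpM2l ?invr_ge0 ?(ltW L0)//.
  by apply: hm => //; [exact: mulr_ge0|exact: (test_ig_pow 3 (tH n))].
have nP0 : 0 <= nrm P by exact: nrm_ge0.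
have g0 : 0 <= gnrm dP by exact: gnrm_ge0.
have key : D <= C4 * nrm P + 8 * c * rho ^+ 4 * (M + 64 * D) + (h * C2 + h) * gnrm dP.
  rewrite /C4 /n1; move: hw hphiP b1 b2; rewrite !ler_norml => /andP[_ h1] /andP[h2 _] h3 /andP[_ h4].
  rewrite h3 in h1; move: h1 h2 h4; clear; abstract_integrals.
  lra.
have k1 : C4 * nrm P <= 8^-1 * D + C4 * (L ^+ 3 * n1).
  apply: le_trans (ler_wpM2l C40 b3) _; rewrite mulrDr lerD2r.
  rewrite (_ : C4 * _ = L^-1 * (64 * m * C4) * D); last by ring.
  exact: ler_wpM2r.
(* The smallness of [1024 * c * rho ^+ 4] is spent twice: as 2 * 8 * 64 here, to leave only [D / 8],
   and as 128 * 8 in [k5], to leave [M / 4]. *)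
have k2 : 8 * c * rho ^+ 4 * (M + 64 * D) <= 8 * c * rho ^+ 4 * M + 8^-1 * D.
  rewrite mulrDr lerD2l (_ : _ * (64 * D) = 2^-1 * (1024 * c * rho ^+ 4) * D); last by field.
  by rewrite ler_wpM2r//; move: rhoc; move: (1024 * c * rho ^+ 4) => y hy; lra.
(* Young's inequality with weight [dl / 12], which matches the [3 / dl] in the bound [gD] on the
   gradient of [P]. *)
have k3 : (h * C2 + h) * gnrm dP <= 4^-1 * D + 3 * (C2 + 1) ^+ 2 * (h ^+ 2 / dl).
  have k4 : dl / 12 * gnrm dP ^+ 2 <= 4^-1 * D.
    apply: (@le_trans _ _ (dl / 12 * (3 / dl * D))).
      by rewrite ler_wpM2l// divr_ge0// ltW.
    by apply/le_of_eq; field; rewrite gt_eqF.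
  apply: le_trans (lerD k4 (lexx _)); move: (gnrm dP) => g.
  rewrite -subr_ge0 (_ : _ - _ = 3 / dl * (dl / 6 * g - h * (C2 + 1)) ^+ 2); last by field; rewrite gt_eqF.
  by apply: mulr_ge0; [rewrite divr_ge0// ltW|exact: sqr_ge0].
have k5 : 128 * (8 * c * rho ^+ 4 * M) <= 4^-1 * M.
  rewrite (_ : 128 * _ = 1024 * c * rho ^+ 4 * M); last by ring.
  exact: ler_wpM2r.
(* The absorbed parts of [D] add up to 1/8 + 1/8 + 1/4, so half of [D] remains on the left; hence
   the factor 2 * 64 in [C6] and [C7]. *)
have fin : 64 * D <= 4^-1 * M + 2 * 64 * (C4 * (L ^+ 3 * n1)) + 2 * 64 * (3 * (C2 + 1) ^+ 2) * (h ^+ 2 / dl).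
  have := le_trans key (lerD (lerD k1 k2) k3).
  rewrite -(mulrA (2 * 64) (3 * _)); move: k5; clear.
  move: (C4 * (L ^+ 3 * n1)) (8 * c * rho ^+ 4 * M) (3 * (C2 + 1) ^+ 2 * (h ^+ 2 / dl)) (D) (M) => x1 x2 x3 E N.
  lra.
apply: le_trans jp _; rewrite lerXn2r ?nnegrE//; first exact: mulr_ge0.
by apply: le_trans fin; exact: mulr_ge0.
Qed.

End L12_step.

(** * Real derivatives, mean values and Gronwall's inequality *)

Section real_derivatives.
Context {R : realType}.
Implicit Types (F G : R -> R) (t a b : R).

Lemma ddD F G t a b : is_derive t 1 F a -> is_derive t 1 G b ->
  is_derive t 1 (fun s => F s + G s) (a + b).
Proof. by move=> h1 h2; exact: is_deriveD. Qed.

Lemma ddB F G t a b : is_derive t 1 F a -> is_derive t 1 G b ->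
  is_derive t 1 (fun s => F s - G s) (a - b).
Proof. by move=> h1 h2; exact: is_deriveB. Qed.

Lemma ddZ k F t a : is_derive t 1 F a -> is_derive t 1 (fun s => k * F s) (k * a).
Proof. by move=> h1; exact: is_deriveZ. Qed.

Lemma ddM F G t a b : is_derive t 1 F a -> is_derive t 1 G b ->
  is_derive t 1 (fun s => F s * G s) (F t * b + G t * a).
Proof. by move=> h1 h2; exact: is_deriveM. Qed.

Lemma dd_sum (F : nat -> R -> R) (a : nat -> R) n t : (forall j, is_derive t 1 (F j) (a j)) ->
  is_derive t 1 (fun s => \sum_(0 <= j < n) F j s) (\sum_(0 <= j < n) a j).
Proof.
move=> h; elim: n => [|n ih].
  rewrite big_nil (_ : (fun s => _) = cst 0); first exact: is_derive_cst.
  by apply/funext => s; rewrite big_nil.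
rewrite big_nat_recr//= (_ : (fun s => _) = fun s => \sum_(0 <= j < n) F j s + F n s).
  exact: ddD.
by apply/funext => s; rewrite big_nat_recr.
Qed.

Lemma is_derive_near F t d : (forall e, 0 < e ->
    \forall h \near (0 : R)^', `|(F (t + h) - F t) / h - d| <= e) ->
  is_derive t 1 F d.
Proof.
move=> H.
have C : (h^-1 *: ((F \o shift t) (h *: 1) - F t))%R @[h --> (0 : R)^'] --> d.
  apply/cvgrPdist_le => e e0; apply: filterS (H e e0) => h.
  by rewrite /= distrC /GRing.scale /= mulr1 [h + t]addrC [_^-1 * _]mulrC.
apply: DeriveDef; first by apply/cvg_ex; exists d.
exact: cvg_lim C.
Qed.

Lemma mvt_lt F (dF : R -> R) a b : 0 < a -> a < b ->
  (forall t, 0 < t -> is_derive t 1 F (dF t)) ->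
  exists2 th, a < th < b & F b - F a = dF th * (b - a).
Proof.
move=> a0 ab H; have [||th] := @MVT _ F dF a b ab.
- by move=> x; rewrite in_itv/= => /andP[ax _]; apply: H; exact: lt_trans ax.
- apply: derivable_within_continuous => x; rewrite in_itv/= => /andP[ax _].
  by have := H x (lt_le_trans a0 ax); case.
- by rewrite in_itv/=; exists th.
Qed.

Lemma mvt_pos F (dF : R -> R) a b : 0 < a -> 0 < b ->
  (forall t, 0 < t -> is_derive t 1 F (dF t)) ->
  exists th, [/\ 0 < th, `|th - a| <= `|b - a| & F b - F a = dF th * (b - a)].
Proof.
move=> a0 b0 H.
have [ab|ba|ab] := ltgtP a b.
- have [th /andP[h1 h2] E] := mvt_lt a0 ab H; exists th; split => //.
    exact: lt_trans h1.
  by rewrite !gtr0_norm ?subr_gt0// lerD2r ltW.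
- have [th /andP[h1 h2] E] := mvt_lt b0 ba H; exists th; split => //.
    exact: lt_trans h1.
    by rewrite !ltr0_norm ?subr_lt0// !opprB lerD2l lerN2 ltW.
  by apply: oppr_inj; rewrite opprB E; ring.
- exists a; split => //; first by rewrite subrr normr0 normr_ge0.
  by rewrite ab !subrr mulr0.
Qed.

Lemma is_derive_le F t d K : is_derive t 1 F d -> (forall h, 0 < h -> F (t + h) - F t <= K * h) ->
  d <= K.
Proof.
move=> [dF <-] hK; rewrite leNgt; apply/negP => Kd.
have C : (h^-1 *: ((F \o shift t) (h *: 1) - F t))%R @[h --> (0 : R)^'] --> 'D_1 F t by exact: dF.
have /nbhs_ballP[r /= r0 hr] : \forall h \near (0 : R)^', K < h^-1 *: ((F \o shift t) (h *: 1) - F t).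
  exact: (cvgr_gt _ C _ Kd).
have r2 : 0 < r / 2 by rewrite divr_gt0.
have := hr (r / 2); rewrite /ball /= sub0r normrN gtr0_norm// ltr_pdivrMr// ltr_pMr// ltr1n.
move=> /(_ isT); rewrite gt_eqF// => /(_ isT).
rewrite /GRing.scale /= mulr1 [r / 2 + t]addrC mulrC ltr_pdivlMr// ltNge => /negP; apply.
exact: hK.
Qed.

(** [M] serves to make the supremum finite and then drops out: the supremum is itself an admissible
    [W], hence satisfies [W <= q * W + C]. *)
Lemma contraction_bound (T : Type) (A : set T) (F : T -> R) (q M C : R) : q < 1 ->
  (forall x, A x -> F x <= M) ->
  (forall W, (forall x, A x -> F x <= W) -> forall x, A x -> F x <= q * W + C) ->
  forall x, A x -> F x <= C / (1 - q).
Proof.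
move=> q1 hM hW x Ax.
have hs : has_sup (F @` A).
  by split; [exists (F x), x|exists M => _ [y Ay <-]; exact: hM].
pose W := sup (F @` A).
have h1 y : A y -> F y <= W by move=> Ay; apply: (sup_upper_bound hs); exists y.
have h2 : W <= q * W + C.
  by apply: ge_sup; [exact: hs.1|move=> _ [y Ay <-]; exact: hW].
apply: le_trans (h1 _ Ax) _; rewrite ler_pdivlMr ?subr_gt0// mulrBr mulr1 lerBlDl.
by rewrite [W * q]mulrC.
Qed.

(** [expR (k * t) * (F t - C / k)] does not increase. The interval from 1 to 2 stays away from time
    0, where no derivative is assumed. *)
Lemma expR_gronwall F (dF : R -> R) (k C : R) : 0 < k ->
  (forall t, 0 < t -> is_derive t 1 F (dF t)) -> (forall t, 0 < t -> dF t <= - k * F t + C) ->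
  F 2 <= expR (- k) * F 1 + C / k * (1 - expR (- k)).
Proof.
move=> k0 hF hd.
pose G t := expR (k * t) * (F t - C / k).
pose dG t := expR (k * t) * dF t + (F t - C / k) * (k * expR (k * t)).
have hG t : 0 < t -> is_derive t 1 G (dG t).
  move=> t0; apply: ddM.
    have h := is_derive1_comp (is_derive_expR (k * t)) (ddZ k (is_derive_id t 1)).
    by apply: (is_derive_eq h); rewrite /GRing.scale /=; ring.
  have := ddB (hF t t0) (is_derive_cst (C / k) t 1).
  by rewrite subr0.
have [th [th0 _ E]] := mvt_pos ltr01 (ltr0n _ 2) hG.
have : G 2 - G 1 <= 0.
  rewrite E (_ : 2 - 1 = 1) ?mulr1; last by ring.
  rewrite (_ : dG th = expR (k * th) * (dF th + k * F th - C)); last by rewrite /dG; field; rewrite gt_eqF.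
  rewrite pmulr_rle0 ?expR_gt0//; have := hd th th0; lra.
rewrite /G mulr1 subr_le0 -(ler_pM2l (expR_gt0 (- k *+ 2))) !mulrA -!expRD.
rewrite (_ : - k *+ 2 + k * 2 = 0); last by rewrite mulr2n; ring.
rewrite (_ : - k *+ 2 + k = - k); last by rewrite mulr2n; ring.
rewrite expR0 mul1r lerBlDr => /le_trans; apply.
by apply/le_of_eq; ring.
Qed.

Lemma sum3_sqr_ge0 (a b k x y z : R) : 0 <= a -> 0 <= b -> 0 <= k ->
  0 <= a * x ^+ 2 + b * y ^+ 2 + k * z ^+ 2.
Proof. by move=> a0 b0 k0; apply: addr_ge0; [apply: addr_ge0|]; apply: mulr_ge0 => //; exact: sqr_ge0. Qed.

End real_derivatives.

(** * Trajectories on the attractor *)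

Section flow.
Context {R : realType} (Omega : smooth_bounded_domain R).
Local Notation mu := (lebesgue_on Omega).
Local Notation sqint := (sqint mu).
Local Notation ip := (ip mu).
Local Notation nrm := (nrm mu).
Local Notation nlim := (nlim mu).
Local Notation test := (test_function Omega).
Local Notation X := (calH Omega 0).
Local Notation gnrm := (gnrm Omega).
Local Notation gip := (gip Omega).
Local Notation Hap := (Hap Omega).
Implicit Types (x y z : X) (s t : R).
Variables (phi : R -> R) (f : L2 Omega) (c : R).
Hypothesis cphi : continuous phi.
Hypothesis c0 : 0 < c.
Hypothesis hphi : forall s t, `|phi s - phi t| <= c * `|s - t| * (1 + `|s| ^+ 4 + `|t| ^+ 4).
Variables (e : nat -> L2 Omega) (lamb : nat -> R) (de : nat -> 'I_3 -> R3 R -> R) (l1 : R).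
Hypothesis eb : eigenbasis e lamb.
Hypothesis eH : forall j, Hap (e j) (de j).
Hypothesis ew : forall j, wk Omega (e j) (de j).
Hypothesis eeq : forall j psi, test psi ->
  lamb j * ip (e j) psi = gip (de j) (fun i => partial i psi).
Hypothesis l10 : 0 < l1.
Hypothesis l1le : forall j, l1 <= lamb j.
Variable grd : X -> 'I_3 -> R3 R -> R.
Hypothesis grdP : forall z, Grad Omega e de (pos z) (grd z).
Variables (S : R -> X -> X) (A : set X).
Hypothesis gs : generated_semigroup phi f S.
Hypothesis cA : compact A.
Hypothesis iA : forall t, 0 <= t -> S t @` A = A.

Let se := eb_sq e.
Let eo := eb_ortho eb.
Let ec := eb_complete eb.
Let posH z : Hap (pos z) (grd z) := pos_Hap eb eH grdP z.
Let sg z : gsq Omega (grd z) := grd_sq grdP z.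
Let sf : sqint f := L2_sqint f.

Lemma flow_in x t : A x -> 0 <= t -> A (S t x).
Proof. by move=> Ax t0; rewrite -(iA t0); exists x. Qed.

Lemma flow_back z t : A z -> 0 <= t -> exists2 y, A y & S t y = z.
Proof. by move=> Az t0; move: Az; rewrite -{1}(iA t0) => -[y Ay yz]; exists y. Qed.

Lemma flowD t tau x : 0 <= t -> 0 <= tau -> S (t + tau) x = S t (S tau x).
Proof. by case: gs => _ h _ _ _ t0 tau0; rewrite h. Qed.

(** Solutions are continuous within [t >= 0]; on the open half-line this is ordinary continuity. *)
Lemma near_flow x t (d : R) : 0 < t -> 0 < d ->
  \forall s \near t, [/\ 0 < s, Hs_dist (S s x).1 (S t x).1 < d & Hs_dist (S s x).2 (S t x).2 < d].
Proof.
move=> t0 d0; have [_ _ _ /(_ x)[cS _ _] _] := gs.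
have cSt : {in [set s : R | 0 < s], continuous (S ^~ x)}.
  rewrite -continuous_open_subspace; last exact: open_gt.
  by apply: continuous_subspaceW cS => s /= /ltW.
have /= ct := cSt t (mem_set t0).
have h1 : \forall s \near t, Hs_dist (S s x).1 (S t x).1 < d /\ Hs_dist (S s x).2 (S t x).2 < d.
  exact: (ct _ (near_dist (S t x) d0)).
have h2 : \forall s \near t, 0 < s by exact: lt_nbhsr.
by apply: filterS2 h1 h2 => s /= [a b] c'; split.
Qed.

Lemma dpos x psi t : 0 < t -> sqint psi ->
  is_derive t 1 (fun s => ip (pos (S s x)) psi) (ip (vel (S t x)) psi).
Proof.
move=> t0 sp; have [_ _ _ /(_ x)[_ hv _] _] := gs.
apply: is_derive_near => ep ep0.
have n1 : 0 < nrm psi + 1 by rewrite ltr_wpDl ?nrm_ge0.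
have e1 : 0 < ep / (nrm psi + 1) by rewrite divr_gt0.
have H : \forall h \near (0 : R)^', norm2 Omega
    (fun w => (pos (S (t + h) x) w - pos (S t x) w) / h - vel (S t x) w) < ep / (nrm psi + 1).
  exact: (cvgr_lt _ (hv t t0) _ e1).
apply: filterS H => h; set q := (fun w : R3 R => _) => hq.
have sq : sqint q.
  apply: sqintB; last exact: vel_sqint.
  have : sqint (fun w => h^-1 * (pos (S (t + h) x) w - pos (S t x) w)).
    by apply: sqintZ; apply: sqintB; exact: pos_sqint.
  by apply: eq_sqint => y; rewrite mulrC.
rewrite norm2E// in hq.
have -> : (ip (pos (S (t + h) x)) psi - ip (pos (S t x)) psi) / h - ip (vel (S t x)) psi = ip q psi.
  have s1 := pos_sqint (S (t + h) x); have s2 := pos_sqint (S t x); have s3 := vel_sqint (S t x).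
  rewrite -ipBl// mulrC -ipZl//; last exact: sqintB.
  rewrite -ipBl//; last by apply: sqintZ; exact: sqintB.
  by apply: eq_ip => // y; rewrite /q mulrC.
apply: le_trans (cauchy_schwarz sq sp) _.
apply: le_trans (ler_wpM2r (nrm_ge0 _ _) (ltW hq)) _.
rewrite mulrAC ler_pdivrMr// ler_wpM2l ?(ltW ep0)//.
by rewrite lerDl.
Qed.

(** [A u + u_t] tested with [eta]. The damping is absorbed into the time derivative, so that [wrhs]
    contains no gradient of the velocity, which a priori is only in L^2. *)
Definition wform (eta : R3 R -> R) deta z := ip (vel z) eta + gip (grd z) deta.
Definition wrhs (eta : R3 R -> R) deta z :=
  - gip (grd z) deta - ip (phi \o pos z) eta + ip f eta.

Lemma dwform_test x psi t : 0 < t -> test psi ->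
  is_derive t 1 (fun s => wform psi (fun i => partial i psi) (S s x))
    (wrhs psi (fun i => partial i psi) (S t x)).
Proof.
move=> t0 tp; have [_ _ _ /(_ x)[_ _ /(_ psi tp t t0) hw] _] := gs.
have lapE z : gip (grd z) (fun i => partial i psi) = - ip (pos z) (laplacian psi).
  rewrite -(opprK (gip _ _)); congr (- _); symmetry.
  by apply: wk_laplacian => //; exact: (Grad_wk se eo ec eH ew (grdP z)).
have sl : sqint (laplacian psi).
  by apply: sqint_sum => i; apply: test_sqint; do 2 apply: test_partial.
have hp := dpos x t0 sl.
rewrite (_ : (fun s => _) = fun s => ip (vel (S s x)) psi - ip (pos (S s x)) (laplacian psi)); last first.
  by apply/funext => s; rewrite /wform lapE.
rewrite /wrhs lapE opprK.
have hw' : is_derive t 1 (fun s => ip (vel (S s x)) psi) (ip (vel (S t x)) (laplacian psi)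
    + ip (pos (S t x)) (laplacian psi) - ip (phi \o pos (S t x)) psi + ip f psi) := hw.
by apply: (is_derive_eq (ddB hw' hp)); nring.
Qed.

Lemma attractor_split rho : 0 < rho -> exists2 K, 0 <= K & forall z, A z -> split6 mu K rho (pos z).
Proof. exact: (compact_split eb eH eeq l10 l1le grdP cA). Qed.

(** Continuity in time of the right-hand side as a functional on H^1_0, uniformly in [eta]. The
    nonlinear part goes through [phi_small], where any fixed Lipschitz constant does. *)
Lemma wrhs_near x t (ep : R) : A x -> 0 < t -> 0 < ep -> \forall s \near t, forall eta deta, Hap eta deta ->
  `|wrhs eta deta (S s x) - wrhs eta deta (S t x)| <= ep * (nrm eta + gnrm deta).
Proof.
move=> Ax t0 ep0.
have [C C0 hC] := phi_small cphi c0 hphi posH attractor_split (ltr01 : 0 < 1 :> R).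
pose k := 2 + C / Num.sqrt l1.
have sl1 : 0 < Num.sqrt l1 by rewrite sqrtr_gt0.
have k0 : 0 < k by rewrite ltr_wpDr ?divr_ge0 ?(ltW sl1).
have d0 : 0 < ep / k by rewrite divr_gt0.
apply: filterS (near_flow x t0 d0) => s [s0 h1 _] eta deta he.
have [_ sd _] := he.
have As := flow_in Ax (ltW s0); have At := flow_in Ax (ltW t0).
have hp := hC _ _ _ _ As At he.
set y := S s x in h1 As hp *; set z := S t x in h1 At hp *.
have g1 := le_lt_trans (grd_dist eb eH eeq l10 l1le grdP y z) h1.
have g2 := pos_dist eb eH eeq l10 l1le grdP y z.
set D := gnrm (fun i w => grd y i w - grd z i w) in g1 g2 hp *.
set P := nrm (fun w => pos y w - pos z w) in g2 hp *.
have P1 : P <= D / Num.sqrt l1 by rewrite ler_pdivlMr// mulrC.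
have hg : `|gip (grd y) deta - gip (grd z) deta| <= D * gnrm deta.
  by rewrite -gipBl//; apply: gip_abs => //; exact: gsqB.
have -> : wrhs eta deta y - wrhs eta deta z = - (gip (grd y) deta - gip (grd z) deta)
    - (ip (phi \o pos y) eta - ip (phi \o pos z) eta) by rewrite /wrhs; ring.
apply: le_trans (ler_normB _ _) _; rewrite normrN.
apply: le_trans (lerD hg hp) _.
have D0 : 0 <= D by exact: gnrm_ge0.
have n0 := nrm_ge0 mu eta; have g0 := gnrm_ge0 Omega deta.
set N := nrm eta in n0 *; set G := gnrm deta in g0 *.
apply: le_trans (_ : D * k * (N + G) <= _); last first.
  by rewrite ler_wpM2r ?addr_ge0// -ler_pdivlMr// ltW.
have hh : C * (P * N) <= C * (D / Num.sqrt l1 * N) by rewrite ler_wpM2l// ler_wpM2r.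
apply: le_trans (_ : D * G + (C * (D / Num.sqrt l1 * N) + 1 * (D * G)) <= _).
  by rewrite lerD2l lerD2r.
rewrite -subr_ge0.
apply: le_trans (_ : 0 <= 2 * (D * N) + D * (C / Num.sqrt l1) * G) _.
  by apply: addr_ge0; rewrite !mulr_ge0 ?invr_ge0 ?(ltW sl1).
by rewrite /k; apply/le_of_eq; ring.
Qed.

(** Differentiability does not by itself survive limits of test functions. The mean value theorem
    first gives, on a neighbourhood independent of [eta], a remainder proportional to the H^1 norm
    of [eta], and this inequality does pass to the limit. *)
Lemma wform_diff x t (ep : R) : A x -> 0 < t -> 0 < ep -> \forall h \near (0 : R), forall eta deta, Hap eta deta ->
  0 < t + h /\
  `|wform eta deta (S (t + h) x) - wform eta deta (S t x) - h * wrhs eta deta (S t x)|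
    <= `|h| * ep * (nrm eta + gnrm deta).
Proof.
move=> Ax t0 ep0.
have /nbhs_ballP[r /= r0 hr] := wrhs_near Ax t0 ep0.
have h1 : \forall h \near (0 : R), `|h| < r.
  by apply/nbhs_ballP; exists r => //= h; rewrite /ball /= sub0r normrN.
have h2 : \forall h \near (0 : R), `|h| < t.
  by apply/nbhs_ballP; exists t => //= h; rewrite /ball /= sub0r normrN.
apply: filterS2 h1 h2 => h hr1 ht eta deta he.
have th0 : 0 < t + h by rewrite -ltrBlDl sub0r; move: ht; rewrite ltr_norml => /andP[].
split => //.
have tst psi : test psi -> `|wform psi (fun i => partial i psi) (S (t + h) x)
    - wform psi (fun i => partial i psi) (S t x) - h * wrhs psi (fun i => partial i psi) (S t x)|
    <= `|h| * ep * (nrm psi + gnrm (fun i => partial i psi)).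
  move=> tp.
  have H s (s0 : 0 < s) := dwform_test x s0 tp.
  have [th [thp hth E]] := mvt_pos t0 th0 H.
  rewrite E (_ : t + h - t = h); last by ring.
  rewrite (_ : _ - _ = h * (wrhs psi (partial^~ psi) (S th x) - wrhs psi (partial^~ psi) (S t x))); last by ring.
  rewrite normrM -mulrA ler_wpM2l//; apply: hr; last exact: Hap_test.
  by rewrite /ball /= distrC; apply: le_lt_trans hth _; rewrite (_ : t + h - t = h)//; ring.
have [sa sd [p [tp pe pd]]] := he.
have sp n := test_sqint (tp n); have spd n := test_gsq (tp n).
have c1 z : ip (vel z) (p n) @[n --> \oo] --> ip (vel z) eta.
  by apply: nlim_ip2 => //; [move=> n; exact: vel_sqint|exact: vel_sqint|exact: nlim_cst].
have cf : ip f (p n) @[n --> \oo] --> ip f eta.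
  by apply: nlim_ip2 => //; exact: nlim_cst.
have c2 z : gip (grd z) (fun i => partial i (p n)) @[n --> \oo] --> gip (grd z) deta.
  by apply: nlim_gip => // i; exact: nlim_cst.
have cn : nrm (p n) @[n --> \oo] --> nrm eta by exact: nlim_nrm.
have cg : gnrm (fun i => partial i (p n)) @[n --> \oo] --> gnrm deta by exact: nlim_gnrm.
have cp z : ip (phi \o pos z) (p n) @[n --> \oo] --> ip (phi \o pos z) eta.
  have [C C0 hC] := phi_pair cphi c0 hphi (posH z).
  have lim0 : C * (nrm (fun w => p n w - eta w) + gnrm (fun i w => partial i (p n) w - deta i w))
      @[n --> \oo] --> C * (0 + 0).
    apply: cvgMr; apply: cvgD => //.
    exact: nlim_gnrm_sub.
  rewrite addr0 mulr0 in lim0.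
  apply/cvgrPdist_le => ep1 ep10.
  have Hn : \forall n \near \oo, C * (nrm (fun w => p n w - eta w) +
      gnrm (fun i w => partial i (p n) w - deta i w)) < ep1 by exact: (cvgr_lt _ lim0 _ ep10).
  apply: filterS Hn => n hn.
  have hB := HapB (Hap_test (tp n)) he.
  rewrite distrC -(phi_pairB cphi c0 hphi (posH z) (Hap_test (tp n)) he).
  by apply: le_trans (hC _ _ hB).2 _; exact: ltW.
have cw z : wform (p n) (fun i => partial i (p n)) z @[n --> \oo] --> wform eta deta z.
  by apply: cvgD.
have cr z : wrhs (p n) (fun i => partial i (p n)) z @[n --> \oo] --> wrhs eta deta z.
  by apply: cvgD => //; apply: cvgB => //; exact: cvgN.
have cl : `|wform (p n) (fun i => partial i (p n)) (S (t + h) x)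
    - wform (p n) (fun i => partial i (p n)) (S t x) - h * wrhs (p n) (fun i => partial i (p n)) (S t x)|
    @[n --> \oo] --> `|wform eta deta (S (t + h) x) - wform eta deta (S t x) - h * wrhs eta deta (S t x)|.
  by apply: cvg_norm; apply: cvgB; [exact: cvgB|exact: cvgMr].
have crr : `|h| * ep * (nrm (p n) + gnrm (fun i => partial i (p n))) @[n --> \oo] -->
   `|h| * ep * (nrm eta + gnrm deta) by apply: cvgMr; exact: cvgD.
rewrite -(cvg_lim _ cl)// -(cvg_lim _ crr)//; apply: ler_lim.
- by apply/cvg_ex; eexists; exact: cl.
- by apply/cvg_ex; eexists; exact: crr.
- by apply: nearW => n; exact: tst.
Qed.

Lemma dwform x eta deta t : A x -> 0 < t -> Hap eta deta ->
  is_derive t 1 (fun s => wform eta deta (S s x)) (wrhs eta deta (S t x)).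
Proof.
move=> Ax t0 he; apply: is_derive_near => ep ep0.
pose N := nrm eta + gnrm deta + 1.
have N0 : 0 < N by rewrite ltr_wpDl// addr_ge0 ?nrm_ge0 ?gnrm_ge0.
have e1 : 0 < ep / N by rewrite divr_gt0.
have H := wform_diff Ax t0 e1.
have H' := nbhs_dnbhs H; have H0 : \forall h \near (0 : R)^', h != 0 by exact: nbhs_dnbhs_neq.
apply: filterS2 H' H0 => h /(_ eta deta he) [_ hb] hn.
have h0 : 0 < `|h| by rewrite normr_gt0.
rewrite -(ler_pM2l h0) -normrM mulrBr [h * (_ / h)]mulrC divfK//.
apply: le_trans hb _; rewrite -mulrA ler_wpM2l// mulrAC ler_pdivrMr//.
by rewrite ler_wpM2l ?(ltW ep0)// /N lerDl.
Qed.

Definition pmode j z := ip (pos z) (e j).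
Definition vmode j z := ip (vel z) (e j).

Lemma dpmode x j t : 0 < t -> is_derive t 1 (fun s => pmode j (S s x)) (vmode j (S t x)).
Proof. by move=> t0; apply: dpos => //; exact: se. Qed.

Lemma dvmode x j t : A x -> 0 < t -> is_derive t 1 (fun s => vmode j (S s x))
  (- lamb j * vmode j (S t x) - lamb j * pmode j (S t x) - ip (phi \o pos (S t x)) (e j) + ip f (e j)).
Proof.
move=> Ax t0.
have h1 := dwform Ax t0 (eH j); have h2 := ddZ (lamb j) (dpmode x j t0).
have gE z : gip (grd z) (de j) = lamb j * pmode j z by exact: (Grad_gip_de se eo ec eH eeq j (grdP z)).
have := ddB h1 h2; rewrite (_ : (fun s => _) = fun s => vmode j (S s x)); last first.
  by apply/funext => s; rewrite /wform gE addrK.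
move=> h3; apply: (is_derive_eq h3); rewrite /wrhs gE /vmode /pmode; nring.
Qed.

(** Every point of [A] is [S 2 y] with [y] in [A]. Gronwall therefore improves any bound [W] to
    [expR (- k) * W] plus a constant, and [contraction_bound] removes the dependence on [M]. *)
Lemma attractor_gronwall (L D : X -> R) (k C M : R) : 0 < k ->
  (forall z, A z -> L z <= M) ->
  (forall x t, A x -> 0 < t -> is_derive t 1 (fun s => L (S s x)) (D (S t x))) ->
  (forall z, A z -> D z <= - k * L z + C) -> forall z, A z -> L z <= C / k.
Proof.
move=> k0 hM hL hD.
have q1 : expR (- k) < 1 by rewrite expR_lt1 oppr_lt0.
suff H z : A z -> L z <= (C / k * (1 - expR (- k))) / (1 - expR (- k)).
  by move=> z /H; rewrite mulfK// gt_eqF// subr_gt0.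
move: z; apply: contraction_bound hM _ => // W hW z Az.
have [y Ay <-] := flow_back Az (ler0n _ 2).
have hLy t (t0 : 0 < t) := hL y t Ay t0.
have hDy t (t0 : 0 < t) := hD _ (flow_in Ay (ltW t0)).
have G := expR_gronwall k0 hLy hDy.
apply: le_trans G _.
by rewrite lerD2r ler_wpM2l ?expR_ge0//; apply: hW; exact: flow_in.
Qed.

Lemma flow_bound : exists2 M, 0 < M &
  forall z, A z -> [/\ gnrm (grd z) <= M, nrm (vel z) <= M & nrm (pos z) <= M].
Proof. exact: (compact_bound eb eH eeq l10 l1le grdP cA). Qed.

(** The displacement is tested against itself: the mean value theorem gives its squared norm as [h]
    times the product of a velocity with the displacement. *)
Lemma pos_lipschitz : exists2 M, 0 < M & forall z h, A z -> 0 < h ->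
  nrm (fun w => pos (S h z) w - pos z w) <= M * h.
Proof.
have [M M0 hM] := flow_bound; exists M => // z h Az h0.
(* The point is written as [S 1 y], since derivatives along trajectories are available at positive
   times only. *)
have [y Ay <-] := flow_back Az ler01; rewrite -(flowD y (ltW h0) ler01).
set psi := (fun w => _); have sp : sqint psi by apply: sqintB; exact: pos_sqint.
have h10 : 0 < h + 1 by rewrite ltr_wpDl ?ltW.
have H t (t0 : 0 < t) := dpos y t0 sp.
have [th [th0 _ E]] := mvt_pos ltr01 h10 H.
have E2 : nrm psi ^+ 2 = ip (vel (S th y)) psi * h.
  rewrite nrm_sq -[h](addrK 1) -E -ipBl//; exact: pos_sqint.
have [_ hv _] := hM _ (flow_in Ay (ltW th0)).
have := ip_le (vel_sqint (S th y)) sp => h1.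
have [n0|n0] := eqVneq (nrm psi) 0; [by rewrite n0; apply: mulr_ge0; exact: ltW|].
have np : 0 < nrm psi by rewrite lt_neqAle eq_sym n0 nrm_ge0.
rewrite -(ler_pM2r np) -expr2 E2 mulrAC ler_wpM2r ?(ltW h0)//.
by apply: le_trans h1 _; rewrite ler_wpM2r ?(ltW np).
Qed.

(** [phi \o pos z] is not yet known to be square integrable, so linearity rests on the integrability
    given by [phi_pair]. *)
Lemma phi_lc z a n : ip (phi \o pos z) (lc e a n) = \sum_(0 <= j < n) a j * ip (phi \o pos z) (e j).
Proof.
have [C _ hC] := phi_pair cphi c0 hphi (posH z).
elim: n => [|n ih].
  rewrite big_nil /ip (eq_J mu (g := fun=> 0)) ?J0// => w.
  by rewrite /lc big_nil mulr0.
rewrite big_nat_recr//= -ih /ip -JZ; last exact: (hC _ _ (eH n)).1.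
rewrite -JD; last 2 first.
- exact: (hC _ _ (Hap_lc eH a n)).1.
- by apply: igZ; exact: (hC _ _ (eH n)).1.
by apply: eq_J => w; rewrite /lc big_nat_recr//= mulrDr; ring.
Qed.

(** * Energy of a displacement in time *)

Section difference.
Variable h : R.
Hypothesis h0 : 0 < h.
Let dp j z := pmode j (S h z) - pmode j z.
Let dv j z := vmode j (S h z) - vmode j z.
Let dphi j z := ip (phi \o pos (S h z)) (e j) - ip (phi \o pos z) (e j).

Lemma flow_shift x s : 0 <= s -> S h (S s x) = S s (S h x).
Proof. by move=> s0; rewrite -(flowD x (ltW h0) s0) -(flowD x s0 (ltW h0)) addrC. Qed.

(** The displacement is the difference of the trajectories from [S h x] and from [x]. The flow
    identity behind this is known for nonnegative times only, hence an equality near [t]. *)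
Lemma near_shift_derive (F : X -> R) x t a b : 0 < t ->
  is_derive t 1 (fun s => F (S s (S h x))) a -> is_derive t 1 (fun s => F (S s x)) b ->
  is_derive t 1 (fun s => F (S h (S s x)) - F (S s x)) (a - b).
Proof.
move=> t0 ha hb; have := ddB ha hb; apply: near_eq_is_derive.
have : \forall s \near t, 0 < s by exact: lt_nbhsr.
by apply: filterS => s s0; rewrite (flow_shift x (ltW s0)).
Qed.

Lemma ddp x j t : 0 < t -> is_derive t 1 (fun s => dp j (S s x)) (dv j (S t x)).
Proof.
move=> t0; have := near_shift_derive t0 (dpmode (S h x) j t0) (dpmode x j t0).
by rewrite -(flow_shift x (ltW t0)).
Qed.

Lemma ddv x j t : A x -> 0 < t -> is_derive t 1 (fun s => dv j (S s x))
  (- lamb j * dv j (S t x) - lamb j * dp j (S t x) - dphi j (S t x)).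
Proof.
move=> Ax t0.
have := near_shift_derive t0 (dvmode j (flow_in Ax (ltW h0)) t0) (dvmode j Ax t0).
rewrite -(flow_shift x (ltW t0)) => H; apply: (is_derive_eq H).
by rewrite /dv /dp /dphi; nring.
Qed.

Variable d : R.
Hypothesis d0 : 0 < d.
Hypothesis d2 : d <= 2^-1.
Hypothesis dl : d <= l1 / 4.

(* The cross term, weighted by the small [d], damps the displacement [dp]. *)
Definition energy j z := 2^-1 * dv j z ^+ 2 + 2^-1 * lamb j * dp j z ^+ 2
  + d * (dv j z * dp j z + 2^-1 * lamb j * dp j z ^+ 2).
Definition energy_rate j z := - lamb j * dv j z ^+ 2 + d * dv j z ^+ 2 - d * lamb j * dp j z ^+ 2
  - dphi j z * (dv j z + d * dp j z).

Lemma denergy x j t : A x -> 0 < t -> is_derive t 1 (fun s => energy j (S s x)) (energy_rate j (S t x)).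
Proof.
move=> Ax t0; have hp := ddp x j t0; have hv := ddv j Ax t0.
have H := ddD (ddD (ddZ 2^-1 (ddM hv hv)) (ddZ (2^-1 * lamb j) (ddM hp hp)))
  (ddZ d (ddD (ddM hv hp) (ddZ (2^-1 * lamb j) (ddM hp hp)))).
apply: (is_derive_eq H); rewrite /energy_rate; move: (dv _ _) (dp _ _) (dphi _ _) (lamb j) => a b g l; by field.
Qed.

(** The difference of the two sides is a combination of three squares; its coefficients are
    nonnegative because [d] is at most 1/2 and at most [l1 / 4]. *)
Lemma energy_lower j z : 4^-1 * (dv j z ^+ 2 + lamb j * dp j z ^+ 2) <= energy j z.
Proof.
rewrite /energy; have := l1le j; move: (dv j z) (dp j z) (lamb j) => o w l ll.
rewrite -subr_ge0.
have -> : 2^-1 * o ^+ 2 + 2^-1 * l * w ^+ 2 + d * (o * w + 2^-1 * l * w ^+ 2) -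
    4^-1 * (o ^+ 2 + l * w ^+ 2) = 2^-1 * d * (o + w) ^+ 2 + 2^-1 * (2^-1 - d) * o ^+ 2
    + (4^-1 * (l - l1) + (4^-1 * l1 - 2^-1 * d)  + 2^-1 * d * l) * w ^+ 2 by field.
have l0 : 0 <= l by exact: le_trans (ltW l10) ll.
have a1 : 0 <= 2^-1 * d by rewrite mulr_ge0 ?ltW.
have a2 : 0 <= 2^-1 * (2^-1 - d) by rewrite mulr_ge0 ?subr_ge0.
have a3 : 0 <= 4^-1 * (l - l1) by rewrite mulr_ge0 ?subr_ge0.
have a4 : 0 <= 4^-1 * l1 - 2^-1 * d by move: d0 dl d2; move: (l1) (d) => ? ?; lra.
have a5 : 0 <= 2^-1 * d * l by exact: mulr_ge0.
apply: sum3_sqr_ge0 => //; apply: addr_ge0 => //; exact: addr_ge0.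
Qed.

Let k0 := 1 + l1^-1.

(** Comparison with the dissipation, where the velocity carries the weight [lamb j];
    [1 <= lamb j / l1] explains the constant [k0]. *)
Lemma energy_upper j z : energy j z <= k0 * (lamb j * dv j z ^+ 2 + lamb j * dp j z ^+ 2).
Proof.
rewrite /energy /k0; have := l1le j; move: (dv j z) (dp j z) (lamb j) => o w l ll.
have l0 : 0 <= l by exact: le_trans (ltW l10) ll.
have li : 1 <= l1^-1 * l by rewrite ler_pdivlMl// mulr1.
rewrite -subr_ge0.
have -> : (1 + l1^-1) * (l * o ^+ 2 + l * w ^+ 2) - (2^-1 * o ^+ 2 + 2^-1 * l * w ^+ 2 +
   d * (o * w + 2^-1 * l * w ^+ 2)) = 2^-1 * d * (o - w) ^+ 2
   + ((l1^-1 * l - 1) + 2^-1 * (1 - d) + l) * o ^+ 2 +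
   ((l1^-1 * l - 1) + (1 - 2^-1 * d) + (1 - 2^-1 - 2^-1 * d) * l) * w ^+ 2 by field; rewrite gt_eqF.
have a1 : 0 <= 2^-1 * d by rewrite mulr_ge0 ?ltW.
have a2 : 0 <= 2^-1 * (1 - d) by rewrite mulr_ge0//; move: d2; move: (d) => ?; lra.
have a3 : 0 <= 1 - 2^-1 * d by move: d2; move: (d) => ?; lra.
have a4 : 0 <= (1 - 2^-1 - 2^-1 * d) * l by rewrite mulr_ge0//; move: d2; move: (d) => ?; lra.
have a5 : 0 <= l1^-1 * l - 1 by rewrite subr_ge0.
apply: sum3_sqr_ge0 => //; apply: addr_ge0 => //; exact: addr_ge0.
Qed.

(** Summed over the modes, the nonlinear terms form the pairing of the difference of [phi] with
    [lc e a n], a function of H^1_0 whose squared gradient norm is the sum of [lamb j * a j ^+ 2].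
    The damping absorbs this gradient and leaves only [B ^+ 2]. *)
Lemma energy_rate_sum B z n : 0 <= B -> A z ->
  (forall eta deta, Hap eta deta ->
     `|ip (phi \o pos (S h z)) eta - ip (phi \o pos z) eta| <= B * (Num.sqrt l1 * nrm eta + gnrm deta)) ->
  \sum_(0 <= j < n) energy_rate j z <= - (d / (2 * k0)) * \sum_(0 <= j < n) energy j z + 8 * B ^+ 2.
Proof.
move=> B0 Az hB.
pose a j := dv j z + d * dp j z.
have he := Hap_lc eH a n.
have := hB _ _ he; rewrite !phi_lc -sumrB.
have ll j := lamb_ge0 l10 l1le j.
set G := gnrm _.
have GE : G ^+ 2 = \sum_(0 <= j < n) lamb j * a j ^+ 2.
  rewrite gnrm_sq (gip_glc_glc se eo eH eeq _ _ (leqnn n)).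
  by apply: eq_bigr => j _; ring.
have G0 : 0 <= G by exact: gnrm_ge0.
have nG : Num.sqrt l1 * nrm (lc e a n) <= G.
  rewrite -(@ler_pXn2r _ 2)// ?nnegrE ?mulr_ge0 ?sqrtr_ge0 ?nrm_ge0//.
  rewrite exprMn sqr_sqrtr ?(ltW l10)// GE nrm_sq ip_lc_lc// mulr_sumr.
  by apply: ler_sum => j _; rewrite -expr2 ler_wpM2r ?sqr_ge0.
move=> h1.
have h2 : - \sum_(0 <= j < n) dphi j z * a j <= B * (G + G).
  apply: le_trans (ler_norm _) _; rewrite normrN; apply: le_trans (_ : _ <= B * (Num.sqrt l1 * nrm (lc e a n) + G)) _.
    by move: h1; congr (`|_| <= _); apply: eq_bigr => j _; rewrite /dphi; ring.
  by rewrite ler_wpM2l// lerD2r.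
have h3 : B * (G + G) <= 8 * B ^+ 2 + 8^-1 * G ^+ 2.
  rewrite -subr_ge0 (_ : _ - _ = 8^-1 * (8 * B - G) ^+ 2); last by field.
  by rewrite mulr_ge0 ?sqr_ge0.
have -> : \sum_(0 <= j < n) energy_rate j z = \sum_(0 <= j < n)
    (- lamb j * dv j z ^+ 2 + d * dv j z ^+ 2 - d * lamb j * dp j z ^+ 2)
    - \sum_(0 <= j < n) dphi j z * a j.
  by rewrite -sumrB; apply: eq_bigr.
apply: le_trans (lerD (lexx _) (le_trans h2 h3)) _.
rewrite addrCA addrC lerD2r GE mulr_sumr -big_split mulr_sumr.
apply: ler_sum => j _ /=.
have k00 : 0 < k0 by rewrite /k0 addr_gt0 ?invr_gt0.
have qq : - (d / (2 * k0)) * (k0 * (lamb j * dv j z ^+ 2 + lamb j * dp j z ^+ 2)) <= - (d / (2 * k0)) * energy j z.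
  by rewrite !mulNr lerN2 ler_wpM2l ?energy_upper// divr_ge0 ?mulr_ge0 ?(ltW d0) ?(ltW k00).
apply: le_trans qq; rewrite /a; have := l1le j; have := ll j.
move: (dv j z) (dp j z) (lamb j) => o w l lj0 lj1.
have -> : - (d / (2 * k0)) * (k0 * (l * o ^+ 2 + l * w ^+ 2)) = - (d / 2) * (l * o ^+ 2 + l * w ^+ 2).
  by field; rewrite gt_eqF.
rewrite -subr_ge0.
have -> : - (d / 2) * (l * o ^+ 2 + l * w ^+ 2) - (- l * o ^+ 2 + d * o ^+ 2 - d * l * w ^+ 2 +
    8^-1 * (l * (o + d * w) ^+ 2)) =
    ((1 - d / 2 - 4^-1) * l - d) * o ^+ 2 + (d / 2 - d ^+ 2 * 4^-1) * l * w ^+ 2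
    + 8^-1 * l * (o - d * w) ^+ 2 by field.
have a1 : 0 <= (1 - d / 2 - 4^-1) * l - d.
  rewrite subr_ge0; apply: le_trans dl _; apply: le_trans (_ : l / 4 <= _).
    by rewrite ler_wpM2r.
  by rewrite [leLHS]mulrC ler_wpM2r//; move: d2; move: (d) => ?; lra.
have a2 : 0 <= (d / 2 - d ^+ 2 * 4^-1) * l.
  rewrite mulr_ge0// (_ : _ - _ = d * (2^-1 - d * 4^-1)); last by field.
  by rewrite mulr_ge0 ?(ltW d0)//; move: d2; move: (d) => ?; lra.
by apply: sum3_sqr_ge0 => //; exact: mulr_ge0.
Qed.

End difference.

Lemma energy_step : exists2 C, 0 <= C & forall h W, 0 < h ->
  (forall z, A z -> gnrm (fun i w => grd (S h z) i w - grd z i w) <= W) ->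
  forall z n, A z -> \sum_(0 <= j < n) ((vmode j (S h z) - vmode j z) ^+ 2 +
     lamb j * (pmode j (S h z) - pmode j z) ^+ 2) <= (2^-1 * W + C * h) ^+ 2.
Proof.
have [M M0 hM] := pos_lipschitz; have [M' M'0 hM'] := flow_bound.
pose d := Num.min 2^-1 (l1 / 4).
have d0 : 0 < d by rewrite lt_min invr_gt0 ltr0n divr_gt0.
have d2 : d <= 2^-1 by rewrite ge_min lexx.
have dl : d <= l1 / 4 by rewrite ge_min lexx orbT.
pose k := d / (2 * (1 + l1^-1)).
have k0 : 0 < k by rewrite divr_gt0// mulr_gt0// addr_gt0 ?invr_gt0.
(* Gronwall will yield [4 * (8 * B ^+ 2 / k)], which is [(s * B) ^+ 2]. With [(2 * s)^-1] as
   Lipschitz constant of [phi], the leading part of [s * B] is [W / 2]. *)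
pose s := Num.sqrt (32 / k).
have s0 : 0 < s by rewrite sqrtr_gt0 divr_gt0.
have ep0 : 0 < (2 * s)^-1 by rewrite invr_gt0 mulr_gt0.
have sl1 : 0 < Num.sqrt l1 by rewrite sqrtr_gt0.
have [C C0 hC] := phi_small cphi c0 hphi posH attractor_split ep0.
exists (s * (C * M / Num.sqrt l1)); first by apply: mulr_ge0; [exact: ltW|apply: divr_ge0; [exact: mulr_ge0 (ltW M0)|exact: ltW]].
move=> h W h0 hW z n Az.
have W0 : 0 <= W by apply: le_trans (hW z Az); exact: gnrm_ge0.
pose B := (2 * s)^-1 * W + C * (M * h) / Num.sqrt l1.
have B0 : 0 <= B.
  apply: addr_ge0; first by apply: mulr_ge0 => //; exact: ltW.
  apply: divr_ge0; last exact: ltW.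
  by apply: mulr_ge0 => //; apply: mulr_ge0; exact: ltW.
have -> : 2^-1 * W + s * (C * M / Num.sqrt l1) * h = s * B.
  by rewrite /B; field; rewrite !gt_eqF.
have hB y eta deta : A y -> Hap eta deta ->
   `|ip (phi \o pos (S h y)) eta - ip (phi \o pos y) eta| <= B * (Num.sqrt l1 * nrm eta + gnrm deta).
  move=> Ay he; apply: le_trans (hC _ _ _ _ (flow_in Ay (ltW h0)) Ay he) _.
  have n0 := nrm_ge0 mu eta; have g0 := gnrm_ge0 Omega deta.
  have b1 : C * (nrm (fun w => pos (S h y) w - pos y w) * nrm eta) <= C * (M * h * nrm eta).
    by rewrite ler_wpM2l// ler_wpM2r// hM.
  have b2 : (2 * s)^-1 * (gnrm (fun i w => grd (S h y) i w - grd y i w) * gnrm deta)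
      <= (2 * s)^-1 * (W * gnrm deta) by rewrite ler_wpM2l ?(ltW ep0)// ler_wpM2r// hW.
  apply: le_trans (lerD b1 b2) _; rewrite -subr_ge0.
  apply: le_trans (_ : 0 <= (2 * s)^-1 * W * (Num.sqrt l1 * nrm eta) + C * (M * h) / Num.sqrt l1 * gnrm deta) _.
    have a1 : 0 <= (2 * s)^-1 * W by apply: mulr_ge0 => //; exact: ltW.
    have a2 : 0 <= C * (M * h) / Num.sqrt l1.
      by apply: divr_ge0; [apply: mulr_ge0 => //; apply: mulr_ge0; exact: ltW|exact: ltW].
    by apply: addr_ge0; apply: mulr_ge0 => //; apply: mulr_ge0 => //; exact: ltW.
  rewrite /B; apply/le_of_eq.
  by move: (nrm eta) (gnrm deta) => a b; field; rewrite !gt_eqF.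
have hL x t (Ax : A x) (t0 : 0 < t) : is_derive t 1 (fun s => \sum_(0 <= j < n) energy h d j (S s x))
    (\sum_(0 <= j < n) energy_rate h d j (S t x)).
  by apply: (@dd_sum _ (fun j s => energy h d j (S s x)) (fun j => energy_rate h d j (S t x))) => j; exact: denergy.
have hR y (Ay : A y) := energy_rate_sum d0 d2 dl n B0 Ay (fun eta deta => hB y eta deta Ay).
(* A crude bound that depends on the number of modes; it only certifies that the energy is bounded
   on [A]. *)
pose N := \sum_(0 <= j < n) (1 + l1^-1) * (lamb j * (4 * M' ^+ 2) + lamb j * (4 * M' ^+ 2)).
have hN y : A y -> \sum_(0 <= j < n) energy h d j y <= N.
  move=> Ay; apply: ler_sum => j _; apply: le_trans (energy_upper h d0 d2 j y) _.
  have ej : nrm (e j) = 1 by rewrite /nrm eo eqxx sqrtr1.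
  have sq (u v : R3 R -> R) : sqint u -> sqint v -> nrm u <= M' -> nrm v <= M' ->
      (ip u (e j) - ip v (e j)) ^+ 2 <= 4 * M' ^+ 2.
    move=> su sv hu hv; rewrite (_ : 4 * M' ^+ 2 = (M' + M') ^+ 2); last by ring.
    rewrite -real_normK ?num_real// lerXn2r ?nnegrE ?addr_ge0 ?(ltW M'0)//.
    apply: le_trans (ler_normB _ _) _; apply: lerD.
      by apply: le_trans (cauchy_schwarz su (se j)) _; rewrite ej mulr1.
    by apply: le_trans (cauchy_schwarz sv (se j)) _; rewrite ej mulr1.
  have [g1 v1 p1] := hM' _ (flow_in Ay (ltW h0)); have [g2 v2 p2] := hM' _ Ay.
  apply: ler_wpM2l; first by rewrite addr_ge0 ?invr_ge0 ?(ltW l10).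
  have lj : 0 <= lamb j by exact: lamb_ge0 l10 l1le j.
  exact: (lerD (ler_wpM2l lj (sq _ _ (vel_sqint _) (vel_sqint _) v1 v2))
    (ler_wpM2l lj (sq _ _ (pos_sqint _) (pos_sqint _) p1 p2))).
have H := attractor_gronwall k0 hN hL hR Az.
have -> : (s * B) ^+ 2 = 4 * (8 * B ^+ 2 / k).
  have fE (b k' : R) : 0 < k' -> 32 / k' * b ^+ 2 = 4 * (8 * b ^+ 2 / k').
    by move=> k'0; field; rewrite gt_eqF.
  by rewrite exprMn sqr_sqrtr ?fE// divr_ge0// ltW.
rewrite -ler_pdivrMl// mulr_sumr; apply: le_trans H.
by apply: ler_sum => j _; exact: energy_lower.
Qed.

(** [energy_step] halves any bound [W] on the gradient of the displacement up to [C * h], so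
    [contraction_bound] gives [2 * C * h]. Feeding this value back as [W] bounds the difference of
    the velocities. *)
Lemma flow_lipschitz : exists2 C, 0 <= C & forall h z, 0 < h -> A z ->
  gnrm (fun i w => grd (S h z) i w - grd z i w) <= C * h /\
  nrm (fun w => vel (S h z) w - vel z w) <= C * h.
Proof.
have [C C0 hC] := energy_step; have [M M0 hM] := flow_bound.
have key h W z : 0 < h -> (forall y, A y -> gnrm (fun i w => grd (S h y) i w - grd y i w) <= W) ->
   A z -> gnrm (fun i w => grd (S h z) i w - grd z i w) <= 2^-1 * W + C * h /\
     nrm (fun w => vel (S h z) w - vel z w) <= 2^-1 * W + C * h.
  move=> h0 hW Az; have H n := hC h W h0 hW z n Az.
  have W0 : 0 <= W by apply: le_trans (hW z Az); exact: gnrm_ge0.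
  have B0 : 0 <= 2^-1 * W + C * h by apply: addr_ge0; apply: mulr_ge0 => //; exact: ltW.
  have lj j : 0 <= lamb j by exact: lamb_ge0 l10 l1le j.
  split.
    apply: (Grad_le se eo eH eeq (posB_Grad eH grdP (S h z) z)) => // n.
    apply: le_trans (H n); apply: ler_sum => j _.
    rewrite (ipBl (pos_sqint _) (pos_sqint _) (se _)).
    by apply: ler_wpDl; rewrite ?sqr_ge0.
  rewrite -(@ler_pXn2r _ 2)// ?nnegrE ?nrm_ge0// nrm_sq.
  apply: (parseval_le se eo ec); first by apply: sqintB; exact: vel_sqint.
  move=> n; apply: le_trans (H n); apply: ler_sum => j _.
  rewrite (ipBl (vel_sqint _) (vel_sqint _) (se _)).
  by apply: ler_wpDr => //; rewrite mulr_ge0 ?sqr_ge0.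
have G h z : 0 < h -> A z -> gnrm (fun i w => grd (S h z) i w - grd z i w) <= 2 * C * h.
  move=> h0 Az.
  have := @contraction_bound R X A (fun z => gnrm (fun i w => grd (S h z) i w - grd z i w)) 2^-1 (M + M) (C * h).
  rewrite (_ : C * h / (1 - 2^-1) = 2 * C * h); last by field.
  apply => //.
  - by rewrite invf_lt1// ltr1n.
  - move=> y Ay; have [g1 _ _] := hM _ (flow_in Ay (ltW h0)); have [g2 _ _] := hM _ Ay.
    by apply: le_trans (gnrmB (sg _) (sg _)) _; exact: lerD.
  - by move=> W hW y Ay; have [] := key h W y h0 hW Ay.
exists (2 * C); first exact: mulr_ge0.
move=> h z h0 Az; split; first exact: G.
have [_] := key h _ z h0 (fun y Ay => G h y h0 Ay) Az.
by rewrite (_ : 2^-1 * _ + _ = 2 * C * h)//; field.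
Qed.

(** The velocity as the derivative of a Lipschitz curve. Its coefficients are frozen at time 1 and
    cut at [n]; the gradient paired with the resulting field has derivative [V ^+ 2] at time 1,
    while the Lipschitz bound allows at most [C * V]. *)
Lemma vel_H1_bound : exists2 C, 0 <= C & forall z n, A z ->
  \sum_(0 <= j < n) lamb j * vmode j z ^+ 2 <= C ^+ 2.
Proof.
have [C C0 hC] := flow_lipschitz; exists C => // z n Az.
have [y Ay <-] := flow_back Az ler01.
pose a j := vmode j (S 1 y).
pose G z := gip (grd z) (glc de a n).
have sa : gsq Omega (glc de a n) by exact: glc_gsq eH _ _.
have GE z' : G z' = \sum_(0 <= j < n) (lamb j * a j) * pmode j z'.
  rewrite /G (gip_glc eH)//; apply: eq_bigr => j _.
  by rewrite (Grad_gip_de se eo ec eH eeq j (grdP z')) /pmode; ring.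
have dG : is_derive (1 : R) 1 (fun s => G (S s y)) (\sum_(0 <= j < n) (lamb j * a j) * a j).
  rewrite (_ : (fun s => _) = fun s => \sum_(0 <= j < n) (lamb j * a j) * pmode j (S s y)).
    apply: (@dd_sum _ (fun j s => (lamb j * a j) * pmode j (S s y)) (fun j => (lamb j * a j) * a j)) => j.
    by apply: ddZ; exact: dpmode.
  by apply/funext => s; rewrite GE.
pose V := gnrm (glc de a n).
have VE : V ^+ 2 = \sum_(0 <= j < n) (lamb j * a j) * a j.
  by rewrite gnrm_sq (gip_glc_glc se eo eH eeq).
have V0 : 0 <= V by exact: gnrm_ge0.
have le : V ^+ 2 <= C * V.
  rewrite VE; apply: (is_derive_le dG) => h h0.
  have A1 := flow_in Ay ler01.
  rewrite [1 + h]addrC (flowD y (ltW h0) ler01) /G -gipBl//.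
  apply: le_trans (ler_norm _) _; apply: le_trans (gip_abs (gsqB (sg _) (sg _)) sa) _.
  by rewrite mulrAC ler_wpM2r//; have [] := hC h _ h0 A1.
have -> : \sum_(0 <= j < n) lamb j * vmode j (S 1 y) ^+ 2 = V ^+ 2.
  by rewrite VE; apply: eq_bigr => j _; rewrite /a; ring.
rewrite lerXn2r ?nnegrE//.
have [->//|Vn] := eqVneq V 0.
have Vp : 0 < V by rewrite lt_neqAle eq_sym Vn.
by rewrite -(ler_pM2r Vp) -expr2.
Qed.

(** Mean value theorem for [wform] over a time [h]: the quotient of the gradients is traded for the
    right-hand side at an intermediate time and the quotient of the velocities. [flow_lipschitz]
    bounds the latter in L^2 and moves the right-hand side back to [z] with a gradient error of
    order [h]; the L^2 part of the [phi] error goes into [C1]. *)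
Lemma flow_momentum : exists C1 C2, [/\ 0 <= C1, 0 <= C2 & forall z h eta deta, A z -> 0 < h -> h <= 1 ->
  Hap eta deta ->
  `|gip (fun i w => grd z i w + h^-1 * (grd (S h z) i w - grd z i w)) deta + ip (phi \o pos z) eta|
    <= C1 * nrm eta + h * C2 * gnrm deta].
Proof.
have [C C0 hC] := flow_lipschitz; have [M M0 hM] := pos_lipschitz.
have [Cp Cp0 hCp] := phi_small cphi c0 hphi posH attractor_split (ltr01 : 0 < 1 :> R).
exists (C + nrm f + Cp * M), (2 * C); split.
- by rewrite addr_ge0 ?addr_ge0 ?nrm_ge0// mulr_ge0// ltW.
- exact: mulr_ge0.
move=> z h eta deta Az h0 h1 he; have [sa sd _] := he.
have [y Ay yz] := flow_back Az ler01.
have H t (t0 : 0 < t) := dwform Ay t0 he.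
have h10 : 1 < 1 + h by rewrite ltrDl.
have [th /andP[th1 thh] E] := mvt_lt ltr01 h10 H.
pose tau := th - 1.
have tau0 : 0 < tau by rewrite subr_gt0.
have tauh : tau <= h by rewrite lerBlDl ltW.
have zt : S th y = S tau z by rewrite -yz -(flowD y (ltW tau0) ler01) subrK.
rewrite [1 + h]addrC (flowD y (ltW h0) ler01) addrK zt yz in E.
have [g1 v1] := hC h z h0 Az; have [g2 _] := hC tau z tau0 Az.
have p2 := hM z tau Az tau0.
have hp := hCp _ _ _ _ (flow_in Az (ltW tau0)) Az he.
set z' := S tau z in E g2 p2 hp.
have sgg := gsqB (sg (S h z)) (sg z).
have -> : gip (fun i w => grd z i w + h^-1 * (grd (S h z) i w - grd z i w)) deta =
    gip (grd z) deta + h^-1 * (gip (grd (S h z)) deta - gip (grd z) deta).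
  by rewrite gipDl// ?gipZl// ?gipBl//; exact: gsqZ.
have b1 : `|ip (vel (S h z)) eta - ip (vel z) eta| <= C * h * nrm eta.
  rewrite -ipBl//; [|exact: vel_sqint|exact: vel_sqint].
  apply: le_trans (cauchy_schwarz (sqintB (vel_sqint _) (vel_sqint _)) sa) _.
  by rewrite ler_wpM2r ?nrm_ge0.
have b2 : `|gip (grd z') deta - gip (grd z) deta| <= C * h * gnrm deta.
  rewrite -gipBl//; apply: le_trans (gip_abs (gsqB (sg _) (sg _)) sd) _.
  rewrite ler_wpM2r ?gnrm_ge0//; apply: le_trans g2 _; exact: ler_wpM2l.
have b3 := cauchy_schwarz sf sa.
have b4 : `|ip (phi \o pos z') eta - ip (phi \o pos z) eta| <= Cp * (M * nrm eta) + C * h * gnrm deta.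
  apply: le_trans hp _; rewrite mul1r; apply: lerD.
    apply: ler_wpM2l => //; rewrite ler_wpM2r ?nrm_ge0//; apply: le_trans p2 _.
    by rewrite ler_piMr ?(ltW M0)// (le_trans tauh).
  rewrite ler_wpM2r ?gnrm_ge0//; apply: le_trans g2 _; exact: ler_wpM2l.
have -> : gip (grd z) deta + h^-1 * (gip (grd (S h z)) deta - gip (grd z) deta) + ip (phi \o pos z) eta
  = - (h^-1 * (ip (vel (S h z)) eta - ip (vel z) eta)) + ip f eta
    - (gip (grd z') deta - gip (grd z) deta) - (ip (phi \o pos z') eta - ip (phi \o pos z) eta).
  have -> : gip (grd (S h z)) deta - gip (grd z) deta =
     h * wrhs eta deta z' - (ip (vel (S h z)) eta - ip (vel z) eta).
    by rewrite [h * _]mulrC -E /wform; nring.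
  rewrite /wrhs; abstract_integrals; field; rewrite gt_eqF//.
apply: le_trans (ler_normB _ _) _; apply: le_trans (lerD (ler_normB _ _) b4) _.
apply: le_trans (lerD (lerD (ler_normD _ _) b2) (lexx _)) _.
have b1' : `|- (h^-1 * (ip (vel (S h z)) eta - ip (vel z) eta))| <= C * nrm eta.
  rewrite normrN normrM gtr0_norm ?invr_gt0// ler_pdivrMl//; apply: le_trans b1 _.
  by apply/le_of_eq; ring.
apply: le_trans (lerD (lerD (lerD b1' b3) (lexx _)) (lexx _)) _.
by apply/le_of_eq; nring.
Qed.

(** Let [W] be the supremum over the attractor and [M] its cube root. [L12_step] bounds the integral
    for [p] by [Q ^+ 3]; convexity gives [F (S h y) <= (1 - h) * W + h * Q ^+ 3], and as [S h] maps
    onto the attractor, [W <= Q ^+ 3]. Hence [M <= M / 4 + C6 + 1], which implies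
    [M <= 2 * (C6 + 1)]. *)
Lemma pos_HF_bound : exists2 B, 0 <= B & forall dl z, 0 < dl -> A z ->
  ig mu (fun w => HF dl (pos z w) ^+ 3) /\ J mu (fun w => HF dl (pos z w) ^+ 3) <= B ^+ 3.
Proof.
have n0 : 0 < 1024 :> R by rewrite ltr0n; exact: isT.
have k0 := mulr_gt0 n0 c0.
have e0 : 0 < 4^-1 :> R by rewrite invr_gt0.
have [rho rho0 rhoc] := small_pow4 k0 e0.
have [K K0 hK] := attractor_split rho0.
have [R0 R00 hR0] := flow_bound.
have [C1 [C2 [C10 C20 hC]]] := flow_momentum.
have [C6 [C7 [C60 C70 hS]]] := L12_step Omega cphi c0 hphi K0 rho0 rhoc (ltW R00) C10 C20.
exists (2 * (C6 + 1)); first by rewrite mulr_ge0 ?addr_ge0.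
move=> dl z d0.
pose F z := J mu (fun w => HF dl (pos z w) ^+ 3).
(* Finiteness for fixed [dl], which the supremum requires; this bound is not uniform in [dl]. *)
have iF y : ig mu (fun w => HF dl (pos y w) ^+ 3) /\ F y <= dl^-1 ^+ 3 * (8 * gnrm (grd y)) ^+ 6.
  have [mp ip6 jp6] := Hap_L6 (posH y).
  have le w : HF dl (pos y w) ^+ 3 <= dl^-1 ^+ 3 * pos y w ^+ 6.
    rewrite (_ : _ * _ = (dl^-1 * pos y w ^+ 2) ^+ 3); last by rewrite exprMn -exprM.
    rewrite lerXn2r ?nnegrE ?HF_ge0 ?HF_le_sqr ?(ltW d0)//.
    by apply: mulr_ge0; [rewrite invr_ge0 ltW|exact: sqr_ge0].
  have H0 w : 0 <= HF dl (pos y w) ^+ 3 by rewrite exprn_ge0// HF_ge0// ltW.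
  have ii : ig mu (fun w => HF dl (pos y w) ^+ 3).
    apply: ig_le (igZ (dl^-1 ^+ 3) ip6); last by move=> w; rewrite ger0_norm.
    apply: measurable_funX; apply: measurableT_comp mp; apply: continuous_measurable_fun.
    exact: HF_continuous (ltW d0).
  split => //; apply: le_trans (J_le ii (igZ (dl^-1 ^+ 3) ip6) le) _.
  by rewrite (JZ _ ip6) ler_wpM2l// exprn_ge0// invr_ge0 ltW.
move=> Az; split; first by case: (iF z).
have hs : has_sup (F @` A).
  split; first by exists (F z), z.
  exists (dl^-1 ^+ 3 * (8 * R0) ^+ 6) => _ [y Ay <-].
  have [_ hy] := iF y; apply: le_trans hy _; have [g _ _] := hR0 y Ay.
  rewrite ler_wpM2l ?exprn_ge0 ?invr_ge0 ?(ltW d0)//.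
  by rewrite lerXn2r ?nnegrE ?mulr_ge0 ?gnrm_ge0 ?(ltW R00)// ler_wpM2l.
pose W := sup (F @` A).
have FW y : A y -> F y <= W by move=> Ay; apply: (sup_upper_bound hs); exists y.
have F0 y : 0 <= F y by apply: J_ge0 => w; rewrite exprn_ge0// HF_ge0// ltW.
have W0 : 0 <= W by apply: le_trans (FW z Az).
pose M := W `^ 3^-1.
have M0 : 0 <= M by exact: powR_ge0.
have MW : M ^+ 3 = W by rewrite -powR_mulrn// -powRrM mulVf ?pnatr_eq0// powRr1.
(* Small against [dl], so that the error [C7 * (h ^+ 2 / dl)] is at most 1; [h <= 1] makes the
   combination convex. *)
pose h := Num.min 1 (dl / (C7 + 1)).
have C71 : 0 < C7 + 1 by rewrite ltr_wpDl.
have h0 : 0 < h by rewrite lt_min ltr01 divr_gt0.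
have h1 : h <= 1 by rewrite ge_min lexx.
have hC7 : C7 * (h ^+ 2 / dl) <= 1.
  have hd : h <= dl / (C7 + 1) by rewrite ge_min lexx orbT.
  apply: (@le_trans _ _ ((C7 + 1) * (h / dl))); last first.
    by rewrite mulrA ler_pdivrMr// mul1r mulrC -ler_pdivlMr.
  apply: ler_pM => //; [by rewrite divr_ge0 ?sqr_ge0 ?(ltW d0)|by rewrite lerDl|].
  by rewrite ler_pM2r ?invr_gt0// expr2 ler_piMr ?(ltW h0).
pose Q := 4^-1 * M + C6 + 1.
have step y : A y -> F (S h y) <= (1 - h) * W + h * Q ^+ 3.
  move=> Ay.
  pose p w := pos y w + h^-1 * (pos (S h y) w - pos y w).
  have hp : Hap p (fun i w => grd y i w + h^-1 * (grd (S h y) i w - grd y i w)).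
    by apply: HapD => //; apply: HapZ; exact: HapB.
  have [_ _ nu] := hR0 y Ay.
  have juW : J mu (fun w => HF dl (pos y w) ^+ 3) <= M ^+ 3 by rewrite MW; exact: FW.
  have [i1 j1] := hS dl h M _ _ _ d0 h0 M0 (pos_sqint y) nu (hK y Ay) hp (iF y).1 juW
     (fun eta te => hC y h _ _ Ay h0 h1 (Hap_test te)).
  have j2 : J mu (fun w => HF dl (p w) ^+ 3) <= Q ^+ 3.
    apply: le_trans j1 _.
    have q0 : 0 <= 4^-1 * M + C6 by rewrite addr_ge0 ?mulr_ge0.
    have q1 : 0 <= C7 * (h ^+ 2 / dl) by rewrite mulr_ge0 ?divr_ge0 ?sqr_ge0 ?(ltW d0).
    have qq : 4^-1 * M + C6 + C7 * (h ^+ 2 / dl) <= Q by rewrite lerD2l.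
    have qn := addr_ge0 q0 q1.
    by rewrite lerXn2r ?nnegrE//; exact: le_trans qn qq.
  have le w : HF dl (pos (S h y) w) ^+ 3 <= (1 - h) * HF dl (pos y w) ^+ 3 + h * HF dl (p w) ^+ 3.
    rewrite (_ : pos (S h y) w = (1 - h) * pos y w + h * p w); last by rewrite /p; field; rewrite gt_eqF.
    by apply: HF3_convex; [exact: ltW|rewrite h1 ltW].
  have ia := igZ (1 - h) (iF y).1; have ib := igZ h i1.
  apply: le_trans (J_le (iF _).1 (igD ia ib) le) _.
  rewrite (JD ia ib) (JZ _ (iF y).1) (JZ _ i1); apply: lerD.
    by rewrite ler_wpM2l ?subr_ge0//; exact: FW.
  by rewrite ler_wpM2l ?(ltW h0).
have Wle : W <= (1 - h) * W + h * Q ^+ 3.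
  apply: ge_sup; first exact: hs.1.
  by move=> _ [y Ay <-]; have [y' Ay' <-] := flow_back Ay (ltW h0); exact: step.
have WQ : M ^+ 3 <= Q ^+ 3.
  rewrite MW -(ler_pM2l h0); move: Wle; move: (h * Q ^+ 3) => q3 H.
  by rewrite -subr_ge0 (_ : _ - _ = (1 - h) * W + q3 - W) ?subr_ge0//; ring.
have Q0 : 0 <= Q by rewrite addr_ge0 ?addr_ge0 ?mulr_ge0.
have MQ : M <= Q by rewrite -(@ler_pXn2r _ 3)// ?nnegrE.
apply: le_trans (FW z Az) _; rewrite -MW lerXn2r ?nnegrE//; first by rewrite mulr_ge0 ?addr_ge0.
by move: MQ C60 M0; rewrite /Q; move: (M) (C6) => a b; lra.
Qed.

(** [dl] tends to 0 along the inverses of the positive integers; Fatou applies because the bound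
    does not depend on [dl]. The absolute value makes the cube nonnegative on all reals. *)
Lemma pos_L12_bound : exists2 B, 0 <= B & forall z, A z ->
  ig mu (fun w => pos z w ^+ 12) /\ J mu (fun w => pos z w ^+ 12) <= B ^+ 3.
Proof.
have [B B0 hB] := pos_HF_bound; exists B => // z Az.
pose dl (n : nat) : R := n.+1%:R^-1.
have dl0 n : 0 < dl n by rewrite invr_gt0.
have E (s : R) : 0 <= s -> `|s| ^+ 3 = s ^+ 3 by move=> s0; rewrite ger0_norm.
have H0 n w : 0 <= HF (dl n) (pos z w) by rewrite HF_ge0// ltW.
have mp := sqint_meas (pos_sqint z).
have := @fatou_ae _ _ _ mu (fun n w => HF (dl n) (pos z w)) (fun w => pos z w ^+ 4) (fun s => `|s| ^+ 3) (B ^+ 3).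
case.
- move=> n; apply: measurableT_comp mp; apply: continuous_measurable_fun; exact: HF_continuous (ltW (dl0 n)).
- exact: measurable_funX.
- move=> s; apply: (@continuous_comp _ _ _ (fun t : R => `|t|) (fun t => t ^+ 3)); first exact: norm_continuous.
  exact: exprn_continuous.
- by move=> s; rewrite exprn_ge0.
- apply: aeW => w; have dc : dl n @[n --> \oo] --> (0 : R) by exact: cvg_harmonic.
  rewrite -[X in _ --> X]divr1 /HF; apply: cvgM; first exact: cvg_cst.
  apply: cvgV; first by rewrite oner_eq0.
  rewrite -[X in _ --> X]addr0; apply: cvgD; first exact: cvg_cst.
  by rewrite -(mul0r (pos z w ^+ 2)); apply: cvgMl.
- by move=> n; apply: eq_ig (hB _ z (dl0 n) Az).1 => w; rewrite /= E.
- apply: nearW => n; rewrite (eq_J mu (g := fun w => HF (dl n) (pos z w) ^+ 3)).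
    exact: (hB _ z (dl0 n) Az).2.
  by move=> w; rewrite /= E.
have E4 w : ((fun s => `|s| ^+ 3) \o (fun w => pos z w ^+ 4)) w = pos z w ^+ 12.
  by rewrite /= E -?exprM// exprn_even_ge0.
move=> h1 h2; split; first exact: eq_ig h1.
by rewrite -(eq_J mu E4).
Qed.

(** Quintic growth needs ten powers for the square; comparing with the even power [pos z ^+ 6],
    through [t * (1 + t ^+ 4) <= 2 * (1 + t ^+ 6)], uses the twelve at hand. *)
Lemma phi_L2_bound : exists2 B, 0 <= B & forall z, A z ->
  sqint (phi \o pos z) /\ nrm (phi \o pos z) <= B.
Proof.
have [B B0 hB] := pos_L12_bound.
pose k := `|phi 0| + 2 * c.
have k0 : 0 <= k by rewrite addr_ge0 ?mulr_ge0 ?(ltW c0).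
exists (k * nrm (cst 1) + 2 * c * Num.sqrt (B ^+ 3)).
  by rewrite addr_ge0 ?mulr_ge0 ?nrm_ge0 ?sqrtr_ge0 ?(ltW c0).
move=> z Az; have [i12 j12] := hB z Az.
have mp := sqint_meas (pos_sqint z).
have s6 : sqint (fun w => pos z w ^+ 6).
  by split; [exact: measurable_funX|apply: eq_ig i12 => w; rewrite -exprM].
have s1 : sqint (cst 1) := sqint_cst Omega 1.
have sD : sqint (fun w => k * cst 1 w + 2 * c * pos z w ^+ 6) by apply: sqintD; exact: sqintZ.
have le w : `|phi (pos z w)| <= `|k * cst 1 w + 2 * c * pos z w ^+ 6|.
  apply: le_trans (phi_growth hphi (pos z w)) _.
  rewrite (ger0_norm (x := k * cst 1 w + _)); last first.
    rewrite /= mulr1; apply: addr_ge0 => //; apply: mulr_ge0; last exact: exprn_even_ge0.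
    by rewrite mulr_ge0 ?(ltW c0).
  rewrite /= mulr1 /k (_ : pos z w ^+ 6 = `|pos z w| ^+ 6); last by rewrite -(even_pow 3).
  move: (normr_ge0 (pos z w)); move: `|pos z w| => t t0.
  have tt : t * (1 + t ^+ 4) <= 2 * (1 + t ^+ 6).
    rewrite -subr_ge0.
    rewrite (_ : _ - _ = (1 + t ^+ 6) + (1 - t) ^+ 2 * (1 + t + t ^+ 2 + t ^+ 3 + t ^+ 4)); last by ring.
    apply: addr_ge0; first by rewrite addr_ge0 ?exprn_ge0.
    by apply: mulr_ge0; [exact: sqr_ge0|rewrite !addr_ge0 ?exprn_ge0].
  rewrite -mulrA -addrA lerD2l (_ : 2 * c + _ = c * (2 * (1 + t ^+ 6))); last by ring.
  by rewrite ler_wpM2l ?(ltW c0).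
have sp : sqint (phi \o pos z) by apply: sqint_le sD => //; exact: phi_meas.
split => //; apply: le_trans (le_nrm sp sD le) _.
apply: le_trans (nrmD (sqintZ _ s1) (sqintZ _ s6)) _.
rewrite (nrmZ _ s1) (nrmZ _ s6) (ger0_norm k0) ger0_norm ?mulr_ge0 ?(ltW c0)//.
rewrite lerD2l ler_wpM2l ?mulr_ge0 ?(ltW c0)// /nrm ipE ler_sqrt ?exprn_ge0//.
by apply: le_trans j12; apply/le_of_eq/eq_J => w; rewrite -exprM.
Qed.

(** In each mode, [a = lamb j * pmode + vmode] satisfies a' = - a + g, where g = u_t + f - phi(u) is
    now bounded in L^2. Then 2 a (- a + g) <= - a^2 + g^2, and Bessel's inequality sums the g terms
    uniformly in [n]. *)
Lemma pos_H2_bound : exists2 B, 0 <= B & forall z n, A z ->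
  \sum_(0 <= j < n) (lamb j * pmode j z) ^+ 2 <= B.
Proof.
have [B B0 hB] := phi_L2_bound; have [M M0 hM] := flow_bound.
pose G := M + nrm f + B.
have G0 : 0 <= G by rewrite !addr_ge0 ?nrm_ge0 ?(ltW M0).
exists (2 * G ^+ 2 + 2 * M ^+ 2); first by apply: addr_ge0; apply: mulr_ge0 => //; exact: sqr_ge0.
move=> z n Az.
pose g z w := vel z w + f w - phi (pos z w).
have sgz y : A y -> sqint (g y).
  by move=> Ay; apply: sqintB; [apply: sqintD => //; exact: vel_sqint|exact: (hB y Ay).1].
have ng y : A y -> nrm (g y) <= G.
  move=> Ay; have [sp np] := hB y Ay; have [_ nv _] := hM y Ay.
  apply: le_trans (nrmB (sqintD (vel_sqint y) sf) sp) _; apply: lerD => //.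
  by apply: le_trans (nrmD (vel_sqint y) sf) _; rewrite lerD2r.
pose a j z := lamb j * pmode j z + vmode j z.
pose D j z := 2 * (a j z * (- a j z + ip (g z) (e j))).
have hL x t : A x -> 0 < t -> is_derive t 1 (fun s => \sum_(0 <= j < n) a j (S s x) ^+ 2)
   (\sum_(0 <= j < n) D j (S t x)).
  move=> Ax t0; apply: (@dd_sum _ (fun j s => a j (S s x) ^+ 2) (fun j => D j (S t x))) => j.
  have h := ddD (ddZ (lamb j) (dpmode x j t0)) (dvmode j Ax t0).
  have At := flow_in Ax (ltW t0); have [sp _] := hB _ At.
  have gE : ip (g (S t x)) (e j) = vmode j (S t x) + ip f (e j) - ip (phi \o pos (S t x)) (e j).
    by rewrite (ipBl (sqintD (vel_sqint _) sf) sp (se j)) (ipDl (vel_sqint _) sf (se j)).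
  rewrite (_ : (fun s => _) = fun s => a j (S s x) * a j (S s x)); last first.
    by apply/funext => s; rewrite expr2.
  apply: (is_derive_eq (ddM h h)); rewrite /D gE /a /pmode /vmode; nring.
have hD y : A y -> \sum_(0 <= j < n) D j y <= - 1 * \sum_(0 <= j < n) a j y ^+ 2 + G ^+ 2.
  move=> Ay; have := bessel se eo n (sgz y Ay); rewrite -nrm_sq => hb.
  have hG : nrm (g y) ^+ 2 <= G ^+ 2 by rewrite lerXn2r ?nnegrE ?nrm_ge0// ng.
  apply: le_trans (lerD (lexx _) (le_trans hb hG)); rewrite mulN1r -sumrN -big_split.
  apply: ler_sum => j _; rewrite /D /=; move: (a j y) (ip _ _) => s t.
  by rewrite -subr_ge0 (_ : _ - _ = (s - t) ^+ 2) ?sqr_ge0//; ring.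
have nm y j : A y -> `|a j y| <= lamb j * M + M.
  move=> Ay; have [_ nv np] := hM y Ay; have lj : 0 <= lamb j := lamb_ge0 l10 l1le j.
  have ej : nrm (e j) = 1 by rewrite /nrm eo eqxx sqrtr1.
  apply: le_trans (ler_normD _ _) _; rewrite normrM (ger0_norm lj); apply: lerD.
    have hp := cauchy_schwarz (pos_sqint y) (se j); rewrite ej mulr1 in hp.
    exact: (ler_wpM2l lj (le_trans hp np)).
  have hv := cauchy_schwarz (vel_sqint y) (se j); rewrite ej mulr1 in hv.
  exact: (le_trans hv nv).
(* Again only finiteness: this bound depends on [n] and disappears in [attractor_gronwall]. *)
have hN y : A y -> \sum_(0 <= j < n) a j y ^+ 2 <= \sum_(0 <= j < n) (lamb j * M + M) ^+ 2.
  move=> Ay; apply: ler_sum => j _; rewrite -real_normK ?num_real//.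
  by rewrite lerXn2r ?nnegrE// ?nm//; exact: le_trans (nm y j Ay).
have := attractor_gronwall ltr01 hN hL hD Az; rewrite divr1 => hA.
have hv : \sum_(0 <= j < n) vmode j z ^+ 2 <= M ^+ 2.
  apply: le_trans (bessel se eo n (vel_sqint z)) _; rewrite -nrm_sq.
  by have [_ nv _] := hM z Az; rewrite lerXn2r ?nnegrE ?nrm_ge0 ?(ltW M0).
apply: le_trans (lerD (ler_wpM2l (ler0n _ 2) hA) (ler_wpM2l (ler0n _ 2) hv)).
rewrite !mulr_sumr -big_split; apply: ler_sum => j _ /=; rewrite /a.
move: (lamb j * pmode j z) (vmode j z) => s t.
by rewrite -subr_ge0 (_ : _ - _ = (s + 2 * t) ^+ 2) ?sqr_ge0//; ring.
Qed.

End flow.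

Theorem theorem4p3 (R : realType) (Omega : smooth_bounded_domain R)
    (f : L2 Omega) (phi : R -> R) (c lambda1 : R)
    (S : R -> calH Omega 0 -> calH Omega 0) (A : set (calH Omega 0)) :
  continuous phi ->
  0 < c ->
  (forall u v, `|phi u - phi v| <= c * `|u - v| * (1 + `|u| ^+ 4 + `|v| ^+ 4)) ->
  0 < lambda1 ->
  first_eigenvalue Omega lambda1 ->
  (limf_einf (fun u : R => (phi u / u)%:E) (@abs_infty R) > (- lambda1)%:E)%E ->
  generated_semigroup phi f S ->
  global_attractor S A ->
  bounded_in 1 A.
Proof.
move=> cphi c0 hphi l10 hl1 _ gs [cA iA _].
have [->|/set0P[z0 _]] := eqVneq A set0; first by exists 0.
(* The eigenbasis is read off a point of the attractor: its velocity lies in the domain of A^0, and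
   membership there exhibits a basis through [Apow_graph]. This is why the empty set is treated
   apart. *)
have [w0 [e [lamb [eb _]]]] := set_mem (valP (z0.2 : Apow_dom (0 / 2))).
have [de [eH ew eeq]] := eb_grad eb.
have l1le j := eb_ge eb j hl1.
have [grd grdP] := choice (pos_grad eb eH eeq l10 l1le).
have [B B0 hB] := pos_H2_bound cphi c0 hphi eb eH ew eeq l10 l1le grdP gs cA iA.
have [C C0 hC] := vel_H1_bound cphi c0 hphi eb eH ew eeq l10 l1le grdP gs cA iA.
have lamb0 j : 0 <= lamb j by exact: le_trans (ltW l10) (l1le j).
(* The powers 1 on the position and 1/2 on the velocity turn the two spectral sums into the squared
   norms of the components of [calH Omega 1]. *)
exists (Num.sqrt (B + C ^+ 2)) => z Az.
have hU n : \sum_(0 <= j < n) (lamb j `^ ((1 + 1) / 2) * ip (lebesgue_on Omega) (Hs_val z.1) (e j)) ^+ 2 <= B.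
  apply: le_trans (hB z n Az); apply/le_of_eq/eq_bigr => j _.
  by rewrite (_ : (1 + 1) / 2 = 1 :> R) ?powRr1//; field.
have hV n : \sum_(0 <= j < n) (lamb j `^ (1 / 2) * ip (lebesgue_on Omega) (Hs_val z.2) (e j)) ^+ 2 <= C ^+ 2.
  apply: le_trans (hC z n Az); apply/le_of_eq/eq_bigr => j _.
  have sq (a b : R) : 0 <= a -> (a `^ (1 / 2) * b) ^+ 2 = a * b ^+ 2.
    by move=> a0; have := sqr_powR_half b a0; rewrite add0r.
  exact: sq.
have [U [Uz nU]] := Hs_exists eb hU; have [V [Vz nV]] := Hs_exists eb hV.
exists ((U, V) : calH Omega 1); first by rewrite /calH_val /= Uz Vz.
by rewrite /calH_norm ler_wsqrtr//; exact: lerD.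
Qed.
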